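(* Let $Q=2n+2$ and $0<\sigma<Q$. There is a constant $d(n,\sigma)$ depending only on $n$ and $\sigma$ such that for every positive, finite Radon measure $\mu$ with compact support on $\mathbb{H}^n$, $$I_\sigma(\mu)=d(n,\sigma)\int_{\widehat{\mathbb{H}}^n}\mathfrak{K}_{Q-\sigma}(\alpha,\lambda)\,|\widehat\mu_{\mathbb{H}^n}(\zeta)|^2\,d\zeta,$$ where $\zeta=(\alpha,\beta,\lambda)$, and $$I_\sigma(\mu)=\int_{\mathbb{H}^n}\int_{\mathbb{H}^n}\|q^{-1}p\|_{\mathbb{H}^n}^{-\sigma}\,d\mu(q)\,d\mu(p).$$
   Context: The Heisenberg group $\mathbb{H}^n$ is $\mathbb{R}^{2n}\times\mathbb{R}$ with group law $(z,t)(z',t')=(z+z',\,t+t'-\tfrac12\omega(z,z'))$, where for $z=(x,y)$, $z'=(x',y')$ with $x,y,x',y'\in\mathbb{R}^n$, $\omega(z,z')=x\cdot y'-y\cdot x'$. The Koranyi gauge is $\|(z,t)\|_{\mathbb{H}^n}=(|z|^4+16t^2)^{1/4}$. For $\lambda\in\mathbb{R}^*=\mathbb{R}\setminus\{0\}$, the unitary representation $\rho_\lambda$ of $\mathbb{H}^n$ on $L^2(\mathbb{R}^n)$ is $\rho_\lambda(x,y,t)\varphi(\xi)=e^{i\lambda(t+x\cdot\xi+\frac{x\cdot y}{2})}\varphi(\xi+y)$. Hermite functions: $\mathscr{H}_k(x)=(-1)^k e^{x^2}\frac{d^k}{dx^k}e^{-x^2}$ and $\phi_k(x)=(2^k\sqrt\pi\,k!)^{-1/2}e^{-x^2/2}\mathscr{H}_k(x)$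 for $x\in\mathbb{R}$, $k\in\mathbb{N}=\{0,1,2,\dots\}$; $\phi_\alpha(x)=\prod_{j=1}^n\phi_{\alpha_j}(x_j)$ for $\alpha\in\mathbb{N}^n$; $\phi_{\alpha,\lambda}(x)=|\lambda|^{n/4}\phi_\alpha(|\lambda|^{1/2}x)$. Let $\widetilde{\mathbb{H}}^n=\mathbb{N}^n\times\mathbb{N}^n\times\mathbb{R}^*$ with points $\zeta=(\alpha,\beta,\lambda)$, and measure $d\zeta$ given by $\int_{\widetilde{\mathbb{H}}^n}\eta(\zeta)\,d\zeta=\sum_{\alpha\in\mathbb{N}^n}\sum_{\beta\in\mathbb{N}^n}\int_{\mathbb{R}^*}\eta(\alpha,\beta,\lambda)\,d\varrho(\lambda)$, $d\varrho(\lambda)=\frac{|\lambda|^n}{(2\pi)^{n+1}}d\lambda$. The frequency space $\widehat{\mathbb{H}}^n$ is the completion of $\widetilde{\mathbb{H}}^n$ for the metric $|\lambda(\alpha+\beta)-\lambda'(\alpha'+\beta')|_{\ell^1}+|(\alpha-\beta)-(\alpha'-\beta')|_{\ell^1}+|\lambda-\lambda'|$, and the integral over $\widehat{\mathbb{H}}^n$ is by definition the integral over $\widetilde{\mathbb{H}}^n$ of the restriction (i.e. the added points have measure zero). For a compactly supported positive finite Radon measure $\mu$, $\widehat\mu_{\mathbb{H}^n}(\alpha,\beta,\lambda)=\int_{\mathbb{H}^n}\langle\rho_\lambda(p)\phi_{\alpha,\lambda},\phi_{\beta,\lambda}\rangle_{L^2(\mathbb{R}^n)}\,d\mu(p)$.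 For $0<s<Q$, $\mathfrak{K}_s(\alpha,\lambda)=(2|\lambda|)^{-s/2}\,\dfrac{\Gamma\big(|\alpha|+\frac{Q-s}{4}\big)}{\Gamma\big(|\alpha|+\frac{Q+s}{4}\big)}$, where $|\alpha|=\alpha_1+\dots+\alpha_n$. Both sides of the identity are allowed to be $+\infty$. *)

(* Defs.v *)
From HB Require Import structures.
From mathcomp Require Import all_boot all_order all_algebra complex.
From mathcomp Require Import lra.
From mathcomp Require Import all_classical all_reals all_analysis.

Set Implicit Arguments.
Unset Strict Implicit.
Unset Printing Implicit Defensive.

Import Order.TTheory GRing.Theory Num.Theory.
Import numFieldNormedType.Exports.

Local Open Scope classical_set_scope.
Local Open Scope ring_scope.

(* Matrices carry the sigma-algebra generated by the entries.  On R^n and on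
   the Heisenberg group (with the product sigma-algebra) this is the Borel
   sigma-algebra of the library topology: see [rV_measurableE] and
   [heis_measurableE]. *)
Definition measure_matrix_display : measure_display -> measure_display.
Proof. exact. Qed.

Definition matrix_generators d (T : measurableType d) (m n : nat) :
    set (set 'M[T]_(m, n)) :=
  \bigcup_(ij in [set: 'I_m * 'I_n])
    preimage_set_system setT (fun M : 'M[T]_(m, n) => M ij.1 ij.2) measurable.

Section measurable_matrix.
Context d (T : measurableType d) (m n : nat).

Let G := @matrix_generators d T m n.

HB.instance Definition _ := @isMeasurable.Build (measure_matrix_display d)
  'M[T]_(m, n) <<s G >> (@sigma_algebra0 _ setT G)
  (fun A => @sigma_algebraC _ G A) (@sigma_algebra_bigcup _ setT G).

End measurable_matrix.

Section measurable_matrix_theory.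
Context d (T : measurableType d) (m n : nat).

Lemma measurable_mxentry (i : 'I_m) (j : 'I_n) :
  measurable_fun setT (fun M : 'M[T]_(m, n) => M i j).
Proof.
move=> _ Y mY; rewrite setTI; apply: sub_sigma_algebra.
by exists (i, j) => //; exists Y => //; rewrite setTI.
Qed.

Lemma measurable_fun_mxentryP d' (X : measurableType d') (f : X -> 'M[T]_(m, n)) :
  (forall i j, measurable_fun setT (fun x => f x i j)) -> measurable_fun setT f.
Proof.
move=> mf; apply: (measurability (@matrix_generators d T m n)) => //.
move=> _ [_ [[i j] _ [B mB <-]] <-]; rewrite !setTI.
by have := mf i j measurableT B mB; rewrite setTI.
Qed.

End measurable_matrix_theory.

(* Lebesgue measure on R^n, as the n-fold product of [lebesgue_measure]. *)
Section row_product.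
Context (R : realType) (n : nat).

Definition row_cons (p : R * 'rV[R]_n) : 'rV[R]_n.+1 :=
  row_mx (const_mx p.1 : 'rV[R]_1) p.2.

Definition row_uncons (v : 'rV[R]_n.+1) : R * 'rV[R]_n :=
  (v 0 0, \row_j v 0 (lift ord0 j)).

Lemma row_cons0 p : row_cons p 0 0 = p.1.
Proof.
have -> : (0 : 'I_n.+1) = lshift n (0 : 'I_1) by exact/val_inj.
by rewrite [LHS]row_mxEl mxE.
Qed.

Lemma row_consS p j : row_cons p 0 (lift ord0 j) = p.2 0 j.
Proof.
have -> : lift ord0 j = rshift 1 j by exact/val_inj.
by rewrite [LHS]row_mxEr.
Qed.

Lemma row_consK : cancel row_cons row_uncons.
Proof.
move=> p; rewrite /row_uncons row_cons0 [RHS]surjective_pairing.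
by congr pair; apply/rowP => j; rewrite mxE row_consS.
Qed.

Lemma row_unconsK : cancel row_uncons row_cons.
Proof.
move=> v; apply/rowP => i; have [j ->|->] := unliftP ord0 i.
  by rewrite row_consS mxE.
by rewrite row_cons0.
Qed.

Lemma measurable_row_cons : measurable_fun setT row_cons.
Proof.
apply: measurable_fun_mxentryP => i; rewrite ord1 => j.
have [k ->|->] := unliftP ord0 j; last first.
  by under eq_fun do rewrite row_cons0; exact: measurable_fst.
under eq_fun do rewrite row_consS.
exact: (measurableT_comp (measurable_mxentry (0 : 'I_1) k) measurable_snd).
Qed.

Lemma measurable_row_uncons : measurable_fun setT row_uncons.
Proof.
apply/measurable_fun_pair; first exact: measurable_mxentry.
apply: measurable_fun_mxentryP => i j.
under eq_fun do rewrite mxE.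
exact: measurable_mxentry.
Qed.

Variable nu : {sigma_finite_measure set 'rV[R]_n -> \bar R}.

Definition row_product : set 'rV[R]_n.+1 -> \bar R :=
  pushforward (lebesgue_measure \x nu)%E row_cons.

Let row_product0 : row_product set0 = 0%E.
Proof. by rewrite /row_product /pushforward preimage_set0 measure0. Qed.

Let row_product_ge0 A : (0 <= row_product A)%E.
Proof. by rewrite /row_product /pushforward measure_ge0. Qed.

Let row_product_sigma_additive : semi_sigma_additive row_product.
Proof.
move=> F mF tF mUF.
have mpre A : measurable A -> measurable (row_cons @^-1` A).
  by move=> mA; rewrite -[X in measurable X]setTI; exact: measurable_row_cons.
rewrite /row_product /pushforward preimage_bigcup.
apply: (@measure_semi_sigma_additive _ _ _ (lebesgue_measure \x nu)%E).
- by move=> k; exact: mpre.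
- apply/trivIsetP => i j _ _ ij; rewrite -preimage_setI.
  by move/trivIsetP : tF => /(_ _ _ _ _ ij) ->//; rewrite preimage_set0.
- by rewrite -preimage_bigcup; exact: mpre.
Qed.

HB.instance Definition _ := isMeasure.Build _ _ _ row_product
  row_product0 row_product_ge0 row_product_sigma_additive.

Let row_product_sigma_finite : sigma_finite setT row_product.
Proof.
have /sigma_finiteP[F [FT ndF Foo]] := sigma_finiteT (@lebesgue_measure R).
have /sigma_finiteP[G [GT ndG Goo]] := sigma_finiteT nu.
exists (fun k => row_uncons @^-1` (F k `*` G k)).
  rewrite -preimage_bigcup (_ : \bigcup_k _ = setT) ?preimage_setT//.
  apply/seteqP; split => // -[x y] _.
  have [k _ Fx] : (\bigcup_i F i) x by rewrite -FT.
  have [l _ Gy] : (\bigcup_i G i) y by rewrite -GT.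
  exists (maxn k l) => //; split => /=.
    by move: x Fx; exact/subsetPset/ndF/leq_maxl.
  by move: y Gy; exact/subsetPset/ndG/leq_maxr.
move=> k; have [mF Fk] := Foo k; have [mG Gk] := Goo k; split.
  rewrite -[X in measurable X]setTI; apply: measurable_row_uncons => //.
  exact: measurableX.
rewrite /row_product /pushforward -comp_preimage.
rewrite (_ : _ \o _ = id); last by apply/funext => p /=; rewrite row_consK.
by rewrite preimage_id product_measure1E// lte_mul_pinfty// ge0_fin_numE.
Qed.

HB.instance Definition _ := Measure_isSigmaFinite.Build _ _ _ row_product
  row_product_sigma_finite.

End row_product.

Fixpoint lebesgue_row (R : realType) (n : nat) :
    {sigma_finite_measure set 'rV[R]_n -> \bar R} :=
  match n with
  | 0 => dirac (0 : 'rV[R]_0)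
  | m.+1 => row_product (lebesgue_row R m)
  end.

Definition has_countable_base (X : topologicalType) (G : set (set X)) :=
  exists (I : countType) (B : I -> set X), (forall i, G (B i)) /\
    (forall x U, nbhs x U -> exists2 i, B i x & B i `<=` U).

Lemma countable_base_open (X : topologicalType) (G : set (set X)) :
  sigma_algebra setT G -> has_countable_base G -> @open X `<=` G.
Proof.
move=> [G0 GC GU] [I [B [GB nB]]] U oU.
pose F k := if unpickle k is Some i then
  (if `[< B i `<=` U >] then B i else set0) else set0.
rewrite (_ : U = \bigcup_k F k).
  apply: GU => k; rewrite /F; case: unpickle => [i|//].
  by case: ifP => // _; exact: GB.
apply/seteqP; split => [x Ux|x [k _]].
  have [i Bx BU] := nB x U (open_nbhs_nbhs (conj oU Ux)).
  exists (pickle i) => //; rewrite /F pickleK.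
  by case: asboolP.
by rewrite /F; case: unpickle => [i|//]; case: asboolP => // BU /BU.
Qed.

Lemma borel_preimage (X Y : topologicalType) (f : X -> Y) (B : set Y) :
  continuous f -> <<s @open Y >> B -> <<s @open X >> (f @^-1` B).
Proof.
move=> /continuousP cf.
have : <<s @open Y >> `<=` image_set_system setT f <<s @open X >>.
  apply: smallest_sub; first exact/sigma_algebra_image/smallest_sigma_algebra.
  move=> U oU; rewrite /image_set_system/= setTI.
  by apply: sub_sigma_algebra; exact: cf.
by move=> /[apply]; rewrite /image_set_system/= setTI.
Qed.

Section borel_sets.
Context (R : realType).

Lemma R_countable_base : has_countable_base (@measurable _ R).
Proof.
exists (rat * rat)%type, (fun p => `]ratr p.1, ratr p.2[%classic); split=> //.
move=> x U /nbhs_ballP[e /= e0 xU].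
have /rat_in_itvoo[a] : x - e < x by rewrite ltrBlDr ltrDl.
have /rat_in_itvoo[b] : x < x + e by rewrite ltrDl.
rewrite !in_itv/= => /andP[xb be] /andP[ea ax].
exists (a, b) => /=; first by rewrite in_itv/= ax xb.
move=> y /=; rewrite in_itv/= => /andP[ay yb]; apply: xU.
rewrite /ball/= ltr_norml; apply/andP; split; lra.
Qed.

Lemma rV_countable_base n : has_countable_base (@measurable _ 'rV[R]_n).
Proof.
have [I [B [mB nB]]] := R_countable_base.
exists {ffun 'I_n -> I}, (fun g : {ffun 'I_n -> I} => [set v : 'rV[R]_n | forall j, B (g j) (v 0 j)]).
split=> [g|v U [P nP PU]].
  rewrite (_ : mkset _ =
      \bigcap_(j in [set: 'I_n]) (fun v : 'rV[R]_n => v 0 j) @^-1` B (g j)).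
    apply: fin_bigcap_measurable => // j _.
    rewrite -[X in measurable X]setTI.
    exact: (measurable_mxentry (0 : 'I_1) j).
  by apply/seteqP; split => [v Bv j _|v Bv j]; exact: Bv.
have {}nB (j : 'I_n) : exists i, B i (v 0 j) /\ B i `<=` P 0 j.
  by have [i ? ?] := nB _ _ (nP 0 j); exists i.
have [g gP] := choice nB; exists (finfun g) => [j|w Bw].
  by rewrite ffunE; have [] := gP j.
apply: PU => i j; rewrite ord1; have [_] := gP j; apply.
by have := Bw j; rewrite ffunE.
Qed.

Lemma R_measurableE : @measurable _ R = <<s @open R >>.
Proof.
apply/seteqP; split; last first.
  apply: smallest_sub; first exact: sigma_algebra_measurable.
  by move=> U; exact: measurable_realfun.open_measurable.
have -> : @measurable _ R = <<s @measurable_realfun.RGenOpens.G R >>.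
  exact: measurable_realfun.RGenOpens.measurableE.
apply: sub_smallest2r.
  exact: smallest_sigma_algebra.
by move=> _ [x [y ->]]; exact: interval_open.
Qed.

Lemma rV_measurableE n : @measurable _ 'rV[R]_n = <<s @open 'rV[R]_n >>.
Proof.
apply/seteqP; split.
  apply: smallest_sub; first exact: smallest_sigma_algebra.
  move=> _ [[i j] _ [B mB <-]]; rewrite setTI.
  apply: borel_preimage; first exact: coord_continuous.
  by rewrite -R_measurableE.
apply: smallest_sub; first exact: sigma_algebra_measurable.
apply: countable_base_open; first exact: sigma_algebra_measurable.
exact: rV_countable_base.
Qed.

End borel_sets.

Lemma prod_countable_base (X Y : topologicalType) (G : set (set X))
    (H : set (set Y)) (K : set (set (X * Y))) :
  (forall A B, G A -> H B -> K (A `*` B)) ->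
  has_countable_base G -> has_countable_base H -> has_countable_base K.
Proof.
move=> GHK [I [A [GA nA]]] [J [B [HB nB]]].
exists (I * J)%type, (fun ij => A ij.1 `*` B ij.2); split=> [[i j]|].
  exact: GHK.
move=> [x y] U [[P Q] /= [nP nQ] PQU].
have [i Ax AP] := nA _ _ nP; have [j By BQ] := nB _ _ nQ.
by exists (i, j) => //= -[x' y'] [/= /AP Px' /BQ Qy']; exact: PQU.
Qed.

Definition heis (R : realType) (n : nat) : Type :=
  ('rV[R]_n * 'rV[R]_n * R)%type.

Lemma heis_measurableE (R : realType) (n : nat) :
  @measurable _ (heis R n) = <<s @open (heis R n) >>.
Proof.
apply/seteqP; split; last first.
  apply: smallest_sub; first exact: sigma_algebra_measurable.
  apply: countable_base_open; first exact: sigma_algebra_measurable.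
  apply: (prod_countable_base _ _ (R_countable_base R)).
    by move=> A B mA mB; exact: (measurableX mA mB).
  apply: (prod_countable_base _ (rV_countable_base R n) (rV_countable_base R n)).
  by move=> A B mA mB; exact: (measurableX mA mB).
have cfst (X Y : topologicalType) : continuous (@fst X Y).
  by move=> ?; exact: cvg_fst.
have csnd (X Y : topologicalType) : continuous (@snd X Y).
  by move=> ?; exact: cvg_snd.
apply: smallest_sub; first exact: smallest_sigma_algebra.
move=> _ [[B mB <-]|[B mB <-]]; rewrite setTI; apply: borel_preimage.
- exact: cfst.
- move: B mB; apply: smallest_sub; first exact: smallest_sigma_algebra.
  move=> _ [[B mB <-]|[B mB <-]]; rewrite setTI; apply: borel_preimage.
  + exact: cfst.
  + by rewrite -rV_measurableE.
  + exact: csnd.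
  + by rewrite -rV_measurableE.
- exact: csnd.
- by rewrite -R_measurableE.
Qed.

Section heisenberg_group.
Context (R : realType) (n : nat).
Implicit Types (x y : 'rV[R]_n) (z : 'rV[R]_n * 'rV[R]_n) (p q : heis R n).

Definition dot x y : R := \sum_(j < n) x 0 j * y 0 j.

Definition omega z z' : R := dot z.1 z'.2 - dot z.2 z'.1.

Definition heis_mul p q : heis R n :=
  (p.1 + q.1, p.2 + q.2 - 2^-1 * omega p.1 q.1).

Definition heis_one : heis R n := (0, 0).

Definition heis_inv p : heis R n := (- p.1, - p.2).

Lemma dotNl x y : dot (- x) y = - dot x y.
Proof. by rewrite /dot -sumrN; apply: eq_bigr => j _; rewrite mxE mulNr. Qed.

Lemma dotC x y : dot x y = dot y x.
Proof. by rewrite /dot; apply: eq_bigr => j _; rewrite mulrC. Qed.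

Lemma heis_mulVp p : heis_mul (heis_inv p) p = heis_one.
Proof.
case: p => -[x y] t; rewrite /heis_mul /heis_inv /heis_one/= /omega/=.
by rewrite !dotNl (dotC y) subrr mulr0 subr0 !addNr.
Qed.

Lemma heis_mulpV p : heis_mul p (heis_inv p) = heis_one.
Proof.
case: p => -[x y] t; rewrite /heis_mul /heis_inv /heis_one/= /omega/=.
by rewrite (dotC x) (dotC y) !dotNl (dotC y) !subrr mulr0 subr0.
Qed.

Definition koranyi p : R :=
  let: (x, y, t) := p in
  ((dot x x + dot y y) ^+ 2 + 16 * t ^+ 2) `^ 4^-1.

(* The homogeneous dimension Q. *)
Definition hdim : R := (2 * n + 2)%:R.

End heisenberg_group.

Section radon_measures.
Context (R : realType) (n : nat).
Implicit Type mu : {measure set (heis R n) -> \bar R}.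

(* The measurable sets are the Borel sets, by [heis_measurableE]. *)
Definition radon mu :=
  [/\ forall K : set (heis R n), compact K -> (mu K < +oo)%E,
      forall A : set (heis R n), measurable A ->
        mu A = ereal_inf [set mu U | U in [set U | open U /\ A `<=` U]]
    & forall U : set (heis R n), open U ->
        mu U = ereal_sup [set mu K | K in [set K | compact K /\ K `<=` U]]].

Definition measure_support mu : set (heis R n) :=
  [set p | forall U : set (heis R n), open_nbhs p U -> (0 < mu U)%E].

(* [powR] is real-valued, with [0 `^ (- sigma) = 0]; the kernel takes the
   value +oo on the diagonal, so it is defined in the extended reals. *)
Definition koranyi_kernel (sigma : R) (p : heis R n) : \bar R :=
  if koranyi p == 0 then +oo%E else (koranyi p `^ (- sigma))%:E.

Definition energy (sigma : R) mu : \bar R :=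
  (\int[mu]_p \int[mu]_q koranyi_kernel sigma (heis_mul (heis_inv q) p))%E.

End radon_measures.

Section fourier_transform.
Context (R : realType).

Definition Cintegral d (T : measurableType d)
    (mu : {measure set T -> \bar R}) (f : T -> R[i]) : R[i] :=
  Complex (\int[mu]_x complex.Re (f x)) (\int[mu]_x complex.Im (f x)).

(* The norm of [R[i]] takes its values in [R[i]]. *)
Definition cmod (z : R[i]) : R := complex.Re `|z|.

Definition cexpi (theta : R) : R[i] := Complex (cos theta) (sin theta).

Definition L2inner n (f g : 'rV[R]_n -> R[i]) : R[i] :=
  Cintegral (lebesgue_row R n) (fun xi => f xi * conjc (g xi)).

Definition schrodinger n (lambda : R) (p : heis R n) (phi : 'rV[R]_n -> R[i]) :
    'rV[R]_n -> R[i] :=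
  let: (x, y, t) := p in fun xi =>
  cexpi (lambda * (t + dot x xi + dot x y / 2)) * phi (xi + y).

(* Physicists' Hermite polynomial, by Rodrigues' formula. *)
Definition hermite (k : nat) (x : R) : R :=
  (-1) ^+ k * expR (x ^+ 2) * derive1n k (fun u : R => expR (- u ^+ 2)) x.

Definition hermite_fun (k : nat) (x : R) : R :=
  (2 ^+ k * Num.sqrt pi * k`!%:R) `^ (- 2^-1) * expR (- (x ^+ 2) / 2) *
  hermite k x.

Definition multi_index (n : nat) := {ffun 'I_n -> nat}.

Definition mi_abs n (alpha : multi_index n) : nat := \sum_(j < n) alpha j.

Definition hermite_multi n (alpha : multi_index n) (x : 'rV[R]_n) : R :=
  \prod_(j < n) hermite_fun (alpha j) (x 0 j).

Definition hermite_scaled n (alpha : multi_index n) (lambda : R)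
    (x : 'rV[R]_n) : R[i] :=
  (`|lambda| `^ (n%:R / 4) *
   hermite_multi alpha (`|lambda| `^ 2^-1 *: x))%:C%C.

Definition fourier n (mu : {measure set (heis R n) -> \bar R})
    (alpha beta : multi_index n) (lambda : R) : R[i] :=
  Cintegral mu (fun p =>
    L2inner (schrodinger lambda p (hermite_scaled alpha lambda))
            (hermite_scaled beta lambda)).

(* Integral over the frequency space with respect to d zeta, for a nonnegative
   integrand.  The points added by the completion of N^n x N^n x R^* are a null
   set by definition, hence do not appear. *)
Definition freq_integral n
    (eta : multi_index n -> multi_index n -> R -> \bar R) : \bar R :=
  (\esum_(alpha in [set: multi_index n]) \esum_(beta in [set: multi_index n])
     \int[lebesgue_measure]_(lambda in [set l : R | l != 0%R])
       (eta alpha beta lambda *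
        (`|lambda| ^+ n / (2 * pi) ^+ n.+1)%:E))%E.

Definition Gamma (x : R) : R :=
  \int[lebesgue_measure]_(t in `]0, +oo[) (t `^ (x - 1) * expR (- t)).

Definition riesz_symbol n (s : R) (alpha : multi_index n) (lambda : R) : R :=
  (2 * `|lambda|) `^ (- s / 2) *
  (Gamma ((mi_abs alpha)%:R + (hdim R n - s) / 4) /
   Gamma ((mi_abs alpha)%:R + (hdim R n + s) / 4)).

End fourier_transform.

(* Main.v *)
Require Import Defs.
From HB Require Import structures.
From mathcomp Require Import all_boot all_order all_algebra complex.
From mathcomp Require Import ring lra.
From mathcomp Require Import all_classical all_reals all_analysis.
From mathcomp Require Import measurable_realfun.

(** Why the identity holds. The squared modulus of the Fourier transform of [mu]
    is a double integral over pairs of points [(g, h)] of a product of two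
    matrix coefficients, and all sums over the Hermite indices can be computed
    before integrating over the pairs. Summed over a box of multi-indices
    with weights [u^|alpha| v^|beta|], the products of Hermite functions
    factor over the coordinates into partial sums of Mehler's series
    ([cvg_mehler], [cvg_box_kernel]); in the limit the coefficients become
    one Gaussian integral over [R^n x R^n], which is explicit
    ([has_integral_trace_density]). Letting [v] increase to 1 gives the trace
    formula ([trace_formula], [trace_value1]): with [A = |z - z'|^2 / 4] for
    the horizontal parts and [tau] the vertical part of [h^-1 g],

      sum over alpha, beta of [u^|alpha| |mu^(alpha, beta, lambda)|^2]
        = [(1 - u)^-n] times the integral over [mu \x mu] of
          [exp (- |lambda| A (1 + u) / (1 - u)) cos (lambda tau)].

    The quotient of Gamma functions in the symbol is a Beta integral. With
    [a = sigma / 4] and [u = p / (p + 2 |lambda|)] it reads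
    ([has_integral_riesz_symbol])

      [|lambda|^n K(alpha, lambda)] = constant times the integral over [p > 0] of
          [p^(a-1) (p + 2 |lambda|)^(a-1) (1 - u)^n u^|alpha|],

    and for this [u] one has [|lambda| (1 + u) / (1 - u) = p + |lambda|]. By
    monotone convergence the integral over the frequency space is therefore
    a constant times the integral over [(lambda, p)] of
    [p^(a-1) (p + 2 |lambda|)^(a-1) E(lambda, p)], where [E(lambda, p) >= 0] is
    the [mu \x mu]-average of [exp (- (p + |lambda|) A) cos (lambda tau)]
    ([freq_integral_average]).

    Integrating in [(lambda, p)] first, the coordinates [p] and
    [q = p + 2 |lambda|] split the integral into the squared modulus of the
    Laplace transform of [p^(a-1)] at [(A + i tau) / 2]
    ([laplace_modulus], [has_integral_cone]). Its value is a constant times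
    [(A^2 + tau^2)^(-a)], that is, a constant times the kernel
    [||h^-1 g||^(-sigma)]. The exchange of integrations is justified after
    inserting a factor [exp (- e (p + |lambda|))], which replaces [A] by
    [A + e] ([damped_average]); as [e] decreases to 0 both sides increase to
    their values without the factor, so the identity also holds when they are
    infinite ([energy_average]). *)

Set Implicit Arguments.
Unset Strict Implicit.
Unset Printing Implicit Defensive.

Import Order.TTheory GRing.Theory Num.Theory.
Import numFieldNormedType.Exports.

Local Open Scope classical_set_scope.
Local Open Scope ring_scope.

(** * Integrals with a known value *)

(** Integrability and value are stated together: linearity, domination and
    Fubini then carry both along. *)
Definition has_integral d (T : measurableType d) (R : realType)
    (mu : {measure set T -> \bar R}) (f : T -> R) (v : R) : Prop :=
  mu.-integrable setT (EFin \o f) /\ (\int[mu]_x (f x)%:E = v%:E)%E.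

Section has_integral_theory.
Context d (T : measurableType d) (R : realType).
Variable mu : {measure set T -> \bar R}.
Implicit Types (f g : T -> R) (v w c : R).

Lemma has_integral_measurable f v :
  has_integral mu f v -> measurable_fun setT f.
Proof. by case=> /integrableP[/measurable_EFinP]. Qed.

Lemma has_integral_eq f g v w :
  f =1 g -> v = w -> has_integral mu f v -> has_integral mu g w.
Proof. by move=> /funext <- <-. Qed.

Lemma has_integralZ c f v :
  has_integral mu f v -> has_integral mu (fun x => c * f x) (c * v).
Proof.
move=> [fi fv]; split.
  by rewrite /comp; under eq_fun do rewrite EFinM; exact: integrableZl.
by under eq_integral do rewrite EFinM; rewrite integralZl// fv EFinM.
Qed.

Lemma has_integralD f g v w : has_integral mu f v -> has_integral mu g w ->
  has_integral mu (fun x => f x + g x) (v + w).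
Proof.
move=> [fi fv] [gi gw]; split.
  by rewrite /comp; under eq_fun do rewrite EFinD; exact: integrableD.
by under eq_integral do rewrite EFinD; rewrite integralD_EFin// fv gw EFinD.
Qed.

Lemma has_integralB f g v w : has_integral mu f v -> has_integral mu g w ->
  has_integral mu (fun x => f x - g x) (v - w).
Proof.
move=> hf /(has_integralZ (-1)) hg.
by apply: has_integral_eq (has_integralD hf hg) => [x|]; rewrite mulN1r.
Qed.

Lemma integrable_has_integral f : mu.-integrable setT (EFin \o f) ->
  has_integral mu f (\int[mu]_x f x).
Proof. by move=> fi; split=> //; rewrite fineK//; exact: integrable_fin_num. Qed.

Lemma has_integral_unique f v w :
  has_integral mu f v -> has_integral mu f w -> v = w.
Proof. by move=> [_ fv] [_]; rewrite fv => -[]. Qed.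

Lemma has_integral_ge0 f v :
  measurable_fun setT f -> (forall x, 0 <= f x) ->
  (\int[mu]_x (f x)%:E = v%:E)%E -> has_integral mu f v.
Proof.
move=> mf f0 fv; split=> //; apply/integrableP; split; first exact/measurable_EFinP.
by under eq_integral do rewrite /= ger0_norm//; rewrite fv ltry.
Qed.

Lemma has_integral_dominated f g v :
  measurable_fun setT f -> (forall x, `|f x| <= g x) -> has_integral mu g v ->
  mu.-integrable setT (EFin \o f).
Proof.
move=> mf fg [gi _]; apply: le_integrable gi => //; first exact/measurable_EFinP.
by move=> x _; rewrite /= lee_fin (le_trans (fg x))// ler_norm.
Qed.

Lemma has_integral_le f g v w : (forall x, f x <= g x) ->
  has_integral mu f v -> has_integral mu g w -> v <= w.
Proof.
move=> fg [fi fv] [gi gw]; rewrite -lee_fin -fv -gw; apply: le_integral => //.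
by move=> x _; rewrite lee_fin.
Qed.

Lemma has_integral_norm_le f g v w : (forall x, `|f x| <= g x) ->
  has_integral mu f v -> has_integral mu g w -> `|v| <= w.
Proof.
move=> fg hf hg; rewrite ler_norml; apply/andP; split; last first.
  by apply: has_integral_le hf hg => x; exact: le_trans (ler_norm _) (fg x).
rewrite -mulN1r; apply: has_integral_le (has_integralZ (-1) hg) hf => x.
by rewrite mulN1r; have := fg x; rewrite ler_norml => /andP[].
Qed.

Lemma has_integral_sum (I : Type) (s : seq I) (F : I -> T -> R) (V : I -> R) :
  (forall i, has_integral mu (F i) (V i)) ->
  has_integral mu (fun x => \sum_(i <- s) F i x) (\sum_(i <- s) V i).
Proof.
move=> FV; elim: s => [|i s IH].
  rewrite big_nil; under [fun x => _]eq_fun do rewrite big_nil.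
  by apply: has_integral_ge0 => //; rewrite integral0.
rewrite big_cons; under [fun x => _]eq_fun do rewrite big_cons.
exact: has_integralD.
Qed.

Lemma has_integral_cvg (F : nat -> T -> R) (V : nat -> R) f g v :
  (forall N, has_integral mu (F N) (V N)) -> has_integral mu g v ->
  (forall N x, `|F N x| <= g x) -> (forall x, F ^~ x @ \oo --> f x) ->
  has_integral mu f (\int[mu]_x f x) /\ V @ \oo --> \int[mu]_x f x.
Proof.
move=> FV hg Fg Ff.
have mF N : measurable_fun setT (EFin \o F N).
  by apply/measurable_EFinP; exact: has_integral_measurable (FV N).
have mf : measurable_fun setT (EFin \o f).
  apply: (emeasurable_fun_cvg (fun N => EFin \o F N)) => // x _.
  by apply: cvg_EFin; [exact: nearW|exact: Ff].
have [fi _ cv] : [/\ mu.-integrable setT (EFin \o f),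
    (\int[mu]_x `|(F n x)%:E - (f x)%:E|)%E @[n --> \oo] --> 0%E
    & (\int[mu]_x (F n x)%:E)%E @[n --> \oo] --> (\int[mu]_x (f x)%:E)%E].
  apply: (@dominated_convergence _ _ _ mu setT measurableT
    (fun N => EFin \o F N) (EFin \o f) (EFin \o g)) => //.
  - by apply: aeW => x _; apply: cvg_EFin; [exact: nearW|exact: Ff].
  - exact: hg.1.
  - by apply: aeW => x N _; rewrite /= lee_fin.
have hf := integrable_has_integral fi; split=> //.
have : (\int[mu]_x (EFin \o F N) x)%E @[N --> \oo] --> (\int[mu]_x f x)%:E.
  by move: cv; rewrite [X in _ --> X](proj2 hf).
rewrite [X in X @ _ --> _](_ : _ = EFin \o V); last by apply/funext => N /=; rewrite -(proj2 (FV N)).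
by move/fine_cvgP => [_].
Qed.

End has_integral_theory.

(** The measure [lebesgue_row] is an image of a product, so its integrals
    are computed on the product. *)
Lemma has_integral_image d1 d2 (X : measurableType d1) (Y : measurableType d2)
    (R : realType) (phi : X -> Y) (mu : {measure set X -> \bar R})
    (nu : {measure set Y -> \bar R}) (f : Y -> R) (v : R) :
  measurable_fun setT phi ->
  (forall B, measurable B -> nu B = mu (phi @^-1` B)) ->
  measurable_fun setT f ->
  has_integral mu (f \o phi) v -> has_integral nu f v.
Proof.
move=> mphi nuE mf [fi fv].
have mfE : measurable_fun setT (EFin \o f) by exact/measurable_EFinP.
have eqm B : measurable B -> B `<=` setT -> pushforward mu phi B = nu B.
  by move=> mB _; rewrite /pushforward nuE.
split.
  apply/integrableP; split=> //.
  rewrite -(eq_measure_integral _ eqm).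
  by have /integrableP[] := integrable_pushforward mphi mfE fi measurableT.
by rewrite -(eq_measure_integral _ eqm) integral_pushforward.
Qed.

(** The dominating function [g] carries all the integrability, so that the
    iterated integrals of [f] need no separate bookkeeping. *)
Lemma has_integral_prod d1 d2 (T1 : measurableType d1) (T2 : measurableType d2)
    (R : realType) (m1 : {sigma_finite_measure set T1 -> \bar R})
    (m2 : {sigma_finite_measure set T2 -> \bar R}) (f g : T1 * T2 -> R)
    (F G : T1 -> R) (c : R) :
  measurable_fun setT f -> measurable_fun setT g ->
  (forall z, `|f z| <= g z) ->
  (forall x, has_integral m2 (fun y => g (x, y)) (G x)) ->
  has_integral m1 G c ->
  (forall x, has_integral m2 (fun y => f (x, y)) (F x)) ->
  has_integral (m1 \x m2)%E f (\int[m1]_x F x) /\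
  has_integral m1 F (\int[m1]_x F x).
Proof.
move=> mf mg fg hg hG hf.
have gi : (m1 \x m2)%E.-integrable setT (EFin \o g).
  apply/integrable12ltyP; first exact/measurable_EFinP.
  rewrite (eq_integral (fun x => (G x)%:E)); first by rewrite hG.2 ltry.
  move=> x _; rewrite -(hg x).2; apply: eq_integral => y _ /=.
  by rewrite ger0_norm// (le_trans _ (fg _)).
have fi : (m1 \x m2)%E.-integrable setT (EFin \o f).
  apply: le_integrable gi => //; first exact/measurable_EFinP.
  by move=> z _; rewrite /= lee_fin (le_trans (fg z))// ler_norm.
have FE : EFin \o F = fubini_F m2 (EFin \o f).
  by apply/funext => x; rewrite /fubini_F/= (hf x).2.
have Fi : m1.-integrable setT (EFin \o F).
  by rewrite FE; exact: integrable_fubini_F fi.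
have hF := integrable_has_integral Fi; split=> //; split=> //.
rewrite -(integral12_prod_meas1 fi) -hF.2.
by apply: eq_integral => x _; rewrite -[RHS]/((EFin \o F) x) FE.
Qed.

(** Once [has_integral_prod] has evaluated the integral of [f] in one order,
    the other order computes the same number. *)
Lemma has_integral_swap d1 d2 (T1 : measurableType d1) (T2 : measurableType d2)
    (R : realType) (m1 : {sigma_finite_measure set T1 -> \bar R})
    (m2 : {sigma_finite_measure set T2 -> \bar R}) (f : T1 * T2 -> R) (v : R) :
  has_integral (m1 \x m2)%E f v ->
  forall G, (forall y, has_integral m1 (fun x => f (x, y)) (G y)) ->
  has_integral m2 G v.
Proof.
move=> [fi fv] G hG.
have GE : EFin \o G = fubini_G m1 (EFin \o f).
  by apply/funext => y; rewrite /fubini_G/= (hG y).2.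
split.
  apply/integrableP; split; first by rewrite GE; exact: measurable_fubini_G fi.
  have mf := measurable_int _ fi.
  apply: le_lt_trans ((integrable21ltyP _ _ mf).1 fi).
  apply: ge0_le_integral => //.
  - apply: measurableT_comp => //; rewrite GE; exact: measurable_fubini_G fi.
  - apply: (measurable_fun_fubini_tonelli_G (abse \o (EFin \o f))).
      exact: measurableT_comp.
    by move=> z; exact: abse_ge0.
  - move=> y _; rewrite [leLHS]/= -[(`|G y|%:E)%E]/(`|(G y)%:E|%E) -(hG y).2.
    apply: le_abse_integral => //.
    by have /integrableP[] := (hG y).1.
rewrite -fv -(integral21_prod_meas1 fi).
by apply: eq_integral => y _; rewrite -[LHS]/((EFin \o G) y) GE.
Qed.

(** * Changes of variables on the line *)

Section affine_change.
Context (R : realType) (c d : R).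
Hypothesis c_gt0 : 0 < c.

Let phi (x : measurableTypeR R) : measurableTypeR R := c * x + d.

Let mphi : measurable_fun setT phi.
Proof. by apply: measurable_funD => //; exact: measurable_funM. Qed.

Lemma lebesgue_measure_affine (A : set R) : measurable A ->
  lebesgue_measure A = (c%:E * lebesgue_measure (phi @^-1` A))%E.
Proof.
pose k : {nonneg R} := NngNum (ltW c_gt0).
move=> mA; rewrite (@lebesgue_measure_unique R
  (mscale k (pushforward lebesgue_measure phi)) _ A mA)//.
move=> _ [[a b]] _ <-.
transitivity (c%:E * lebesgue_measure (phi @^-1` `]a, b]))%E => //.
rewrite (_ : preimage _ _ = `](a - d) / c, (b - d) / c]%classic); last first.
  apply/seteqP; split => x /=; rewrite !in_itv/= /phi.
    by rewrite ltr_pdivrMr// ler_pdivlMr// ltrBlDr lerBrDr (mulrC x).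
  by rewrite ltr_pdivrMr// ler_pdivlMr// ltrBlDr lerBrDr (mulrC x).
rewrite !lebesgue_measure_itv/= !lte_fin ltr_pM2r ?invr_gt0// ltrD2r.
case: ifPn => // _; last by rewrite mule0.
by rewrite -EFinM -EFinB; congr EFin; field; rewrite gt_eqF.
Qed.

Lemma ge0_integral_affine (f : R -> \bar R) :
  measurable_fun setT f -> (forall x, 0 <= f x)%E ->
  (\int[lebesgue_measure]_x f (phi x) =
   (c^-1)%:E * \int[lebesgue_measure]_x f x)%E.
Proof.
move=> mf f0.
pose k : {nonneg R} := NngNum (ltW c_gt0).
have eqm B : measurable B -> B `<=` setT ->
    mscale k (pushforward lebesgue_measure phi) B = lebesgue_measure B.
  by move=> mB _; rewrite lebesgue_measure_affine.
rewrite -[in RHS](eq_measure_integral _ (eqm mphi)) ge0_integral_mscale//.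
rewrite ge0_integral_pushforward//= muleA -EFinM mulVf ?gt_eqF// mul1e.
by [].
Qed.

Lemma has_integral_affine (f : R -> R) (v : R) :
  has_integral (@lebesgue_measure R) f v ->
  has_integral (@lebesgue_measure R) (fun x => f (c * x + d)) (v / c).
Proof.
move=> hf; have mf := has_integral_measurable hf.
have mfE : measurable_fun setT (EFin \o f) by exact/measurable_EFinP.
split.
  apply/integrableP; split; first exact/measurable_EFinP/measurableT_comp.
  rewrite (ge0_integral_affine (f := fun x => `|(f x)%:E|%E))//; last first.
    exact: measurableT_comp.
  rewrite lte_mul_pinfty ?lee_fin ?invr_ge0 ?(ltW c_gt0)//.
  by case: hf => /integrableP[].
rewrite -[LHS]/(\int[lebesgue_measure]_x ((EFin \o f) \o phi) x)%E.
rewrite integralE funepos_comp funeneg_comp.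
rewrite !ge0_integral_affine//; first last.
- exact: measurable_funepos.
- exact: measurable_funeneg.
rewrite -muleBr//; last first.
  apply: fin_num_adde_defl; rewrite fin_numN.
  exact: (@integrable_neg_fin_num _ _ _ _ _ measurableT _ hf.1).
by rewrite -integralE hf.2 -EFinM mulrC.
Qed.

End affine_change.

(** * Oscillatory integrals *)

Section derivative_integral.
Context (R : realType).
Notation leb := (@lebesgue_measure R).

Lemma has_integral_itv_derivative (a b : R) (f g : R -> R) : a < b ->
  (forall x, x \in `[a, b] -> is_derive x 1 f (g x)) ->
  (forall x, x \in `[a, b] -> {for x, continuous g}) ->
  has_integral leb (g \_ (`[a, b]%classic : set R)) (f b - f a).
Proof.
move=> ab df cg.
have cab : {within `[a, b], continuous g}.
  by apply: continuous_in_subspaceT => x /set_mem; exact: cg.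
have aI : a \in `[a, b] by rewrite in_itv/= lexx ltW.
have bI : b \in `[a, b] by rewrite in_itv/= lexx ltW.
have cf x : x \in `[a, b] -> {for x, continuous f}.
  move=> xab; apply/differentiable_continuous/derivable1_diffP.
  by have [] := df x xab.
split.
  have mI : measurable (`[a, b]%classic : set (measurableTypeR R)).
    exact: measurable_itv.
  have H := (@integrable_mkcond _ _ _ leb _ (EFin \o g) mI).1.
  rewrite -restrict_EFin; apply: H.
  by apply: continuous_compact_integrable => //; exact: segment_compact.
under eq_integral do rewrite -[(_ _)%:E]/((EFin \o (g \_ _)) _) -restrict_EFin.
rewrite -integral_mkcond (@continuous_FTC2 _ g f)//.
- split.
  + by move=> x xab; have [] := df x (subset_itv_oo_cc xab).
  + exact: (cvg_at_right_filter (cf a aI)).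
  + exact: (cvg_at_left_filter (cf b bI)).
- move=> x xab; have dx := df x (subset_itv_oo_cc xab).
  by rewrite derive1E derive_val.
Qed.

Section exhaustion.
Variables (D : set R) (a b : nat -> R) (f g h : R -> R) (l : R).
Hypothesis ab : forall N, a N < b N.
Hypothesis abD : forall N, `[a N, b N] `<=` D.
Hypothesis exD : forall x, D x -> \forall N \near \oo, x \in `[a N, b N].
Hypothesis df : forall x, D x -> is_derive x 1 f (g x).
Hypothesis cg : forall x, D x -> {for x, continuous g}.
Hypothesis hD : forall x, D x -> h x = g x.
Hypothesis hnD : forall x, ~ D x -> h x = 0.
Hypothesis fab : f (b N) - f (a N) @[N --> \oo] --> l.

Let F N := h \_ (`[a N, b N]%classic : set R).

Let F_cvg x : F ^~ x @ \oo --> h x.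
Proof.
have [Dx|Dx] := pselect (D x); last first.
  rewrite hnD//; apply: cvg_near_cst; apply: nearW => N.
  by rewrite /F patchE; case: ifP => // _; exact: hnD.
apply: cvg_near_cst; apply: filterS (exD Dx) => N xN.
by rewrite /F patchE mem_set.
Qed.

Let F_integral N : has_integral leb (F N) (f (b N) - f (a N)).
Proof.
rewrite (_ : F N = g \_ (`[a N, b N]%classic : set R)); last first.
  apply/funext => x; rewrite /F !patchE; case: ifPn => // /set_mem/abD; exact: hD.
by apply: has_integral_itv_derivative => // x xI;
  [apply: df|apply: cg]; exact: abD xI.
Qed.

(** Only the increments of [f] over an exhaustion of [D] matter, so that [f]
    may be defined and differentiable on an open half line only. *)
Lemma has_integral_derivative :
  leb.-integrable setT (EFin \o h) -> has_integral leb h l.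
Proof.
move=> hi.
have Fh N x : `|F N x| <= `|h x|.
  by rewrite /F patchE; case: ifP => // _; rewrite normr0.
have [hh cv] := has_integral_cvg F_integral
  (integrable_has_integral (integrable_norm hi)) Fh F_cvg.
by rewrite (cvg_unique _ fab cv).
Qed.

Lemma ge0_has_integral_derivative :
  (forall x, 0 <= h x) -> has_integral leb h l.
Proof.
move=> h0; apply: has_integral_derivative.
have F0 N x : 0 <= F N x by rewrite /F patchE; case: ifP.
have mF N : measurable_fun setT (EFin \o F N).
  by apply/measurable_EFinP; exact: has_integral_measurable (F_integral N).
have cF x : (F N x)%:E @[N --> \oo] --> (h x)%:E.
  by apply: cvg_EFin; [exact: nearW|exact: F_cvg].
have mh : measurable_fun setT (EFin \o h).
  by apply: (emeasurable_fun_cvg (fun N => EFin \o F N)) => // x _; exact: cF.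
apply/integrableP; split; first exact: mh.
under eq_integral do rewrite /= ger0_norm//.
have := @fatou _ _ _ leb setT measurableT (fun N => EFin \o F N) mF
  (fun N x _ => F0 N x).
have -> : (\int[leb]_x limn_einf (fun N => (EFin \o F N) x) =
    \int[leb]_x (h x)%:E)%E.
  apply: eq_integral => x _; rewrite is_cvg_limn_einfE.
    exact: (cvg_lim _ (cF x)).
  by apply/cvg_ex; eexists; exact: cF.
have -> : (fun N => \int[leb]_x (EFin \o F N) x)%E =
    (fun N => (f (b N) - f (a N))%:E).
  by apply/funext => N; exact: (F_integral N).2.
have cl : (f (b N) - f (a N))%:E @[N --> \oo] --> l%:E.
  by apply: cvg_EFin; [exact: nearW|exact: fab].
rewrite is_cvg_limn_einfE; last by apply/cvg_ex; eexists; exact: cl.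
by rewrite (cvg_lim _ cl)// => /le_lt_trans; apply; rewrite ltry.
Qed.

End exhaustion.

Lemma continuous_cos_affine (c phi : R) :
  continuous (fun s : R => cos (c * s + phi)).
Proof.
move=> s; apply: (cvg_comp (fun s => c * s + phi) cos); last exact: continuous_cos.
by apply: (@cvgD _ R^o); [apply: cvgM; [exact: cvg_cst|exact: cvg_id]|exact: cvg_cst].
Qed.

Lemma measurable_cos_affine (c phi : R) :
  measurable_fun setT (fun s : R => cos (c * s + phi)).
Proof. by apply: continuous_measurable_fun; exact: continuous_cos_affine. Qed.

Lemma integrable_cosM (h : R -> R) (c phi : R) :
  leb.-integrable setT (EFin \o h) ->
  leb.-integrable setT (EFin \o (fun s => h s * cos (c * s + phi))).
Proof.
move=> hi; apply: (@has_integral_dominated _ _ _ leb _ (fun s => `|h s|)) => [|s|].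
- apply: measurable_funM; last exact: measurable_cos_affine.
  exact: has_integral_measurable (integrable_has_integral hi).
- by rewrite normrM ler_piMr// ler_norml cos_geN1 cos_le1.
- by apply: integrable_has_integral; exact: integrable_norm.
Qed.

(** The phase [phi] is kept as a parameter because a quarter turn changes
    the cosine integral into the sine integral: the pair [phi = 0, - pi / 2]
    stands for a complex exponential. *)
Definition cos_integral (h : R -> R) (phi c : R) : R :=
  \int[leb]_s (h s * cos (c * s + phi)).

Lemma cos_integralP (h : R -> R) (phi c : R) :
  leb.-integrable setT (EFin \o h) ->
  has_integral leb (fun s => h s * cos (c * s + phi)) (cos_integral h phi c).
Proof. by move=> hi; apply/integrable_has_integral/integrable_cosM. Qed.

(** Differentiating in the frequency multiplies [h] by [s] and advances the
    phase by a quarter turn. *)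
Lemma is_derive_cos_integral (h : R -> R) (phi c : R) :
  leb.-integrable setT (EFin \o h) ->
  leb.-integrable setT (EFin \o (fun s => s * h s)) ->
  is_derive c 1 (cos_integral h phi)
    (cos_integral (fun s => s * h s) (phi + pi / 2) c).
Proof.
move=> hi shi.
pose k (c s : R) : R := h s * cos (c * s + phi).
have dk (x s : R) : is_derive x 1 (k^~ s) (s * h s * cos (x * s + (phi + pi / 2))).
  rewrite addrA cosDpihalf.
  rewrite /k; apply: is_derive_eq.
  by rewrite /GRing.scale/= !(mulr0, mul0r, add0r, addr0, mulr1); ring.
have d1k x s : partial1of2 k x s = s * h s * cos (x * s + (phi + pi / 2)).
  by rewrite partial1of2E; have dx := dk x s; rewrite derive_val.
have ki x : leb.-integrable setT (EFin \o k x) by exact: integrable_cosM.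
have Ic : (`]c - 1, c + 1[%classic : set R) c by rewrite /= in_itv/=; lra.
have G0 (s : R) : 0 <= `|s * h s| by [].
have Gi : leb.-integrable setT (EFin \o (fun s => `|s * h s|)).
  exact: integrable_norm.
have Gub (x s : R) : (`]c - 1, c + 1[%classic : set R) x -> setT s ->
    `|partial1of2 k x s| <= `|s * h s|.
  move=> _ _; rewrite d1k normrM ler_piMr//.
  by rewrite ler_norml cos_geN1 cos_le1.
have der (x s : R) : (`]c - 1, c + 1[%classic : set R) x -> setT s ->
  derivable (k^~ s) x 1 by move=> _ _; have [] := dk x s.
apply: DeriveDef.
  exact: (derivable_under_integral measurableT Ic (fun x _ => ki x) der G0 Gi Gub).
rewrite -derive1E.
rewrite (differentiation_under_integral measurableT Ic (fun x _ => ki x) der G0 Gi Gub).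
by apply: eq_Rintegral => s _; rewrite d1k.
Qed.

End derivative_integral.

(** * Gaussian integrals *)

Section gaussian.
Context (R : realType).
Notation leb := (@lebesgue_measure R).

Lemma integrable_expR_sqr (A : R) : 0 < A ->
  leb.-integrable setT (EFin \o (fun s => expR (- A * s ^+ 2))).
Proof.
move=> A0; have sA0 : 0 < Num.sqrt A by rewrite sqrtr_gt0.
have hg := integrable_has_integral (@integrableT_gauss R).
have [+ _] := has_integral_affine 0 sA0 hg.
apply: eq_integrable => // s _; rewrite /= /gauss_fun addr0 exprMn.
by rewrite sqr_sqrtr ?ltW// mulNr.
Qed.

Lemma expr_le_expR_sqr (k : nat) (s : R) :
  `|s| ^+ k <= (1 + 2 ^+ k * k`!%:R) * expR (2^-1 * s ^+ 2).
Proof.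
have s20 : 0 <= 2^-1 * s ^+ 2 by rewrite mulr_ge0 ?sqr_ge0.
have e1 : 1 <= expR (2^-1 * s ^+ 2) by rewrite -[leLHS]expR0 ler_expR.
have fk0 : (0 : R) < k`!%:R by rewrite ltr0n fact_gt0.
rewrite mulrDl mul1r; have [s1|s1] := leP `|s| 1.
  have /le_trans : `|s| ^+ k <= 1 by exact: exprn_ile1.
  apply.
  by rewrite (le_trans e1)// lerDl mulr_ge0 ?expR_ge0 ?mulr_ge0 ?exprn_ge0 ?ltW.
apply: (@le_trans _ _ (2 ^+ k * k`!%:R * expR (2^-1 * s ^+ 2))); last first.
  by rewrite lerDr expR_ge0.
apply: (@le_trans _ _ ((s ^+ 2) ^+ k)).
  rewrite -(real_normK (num_real s)) -exprM ler_weXn2l ?(ltW s1)//.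
  by rewrite mul2n -addnn leq_addr.
have {fk0} : (2^-1 * s ^+ 2) ^+ k / k`!%:R <= expR (2^-1 * s ^+ 2).
  case: k fk0 => [|k] _; first by rewrite expr0 fact0 divr1.
  by apply: le_trans (expR_ge1Dxn k s20); rewrite lerDr.
rewrite ler_pdivrMr ?ltr0n ?fact_gt0// exprMn exprVn ler_pdivrMl ?exprn_gt0//.
by rewrite -mulrA [X in _ * X]mulrC.
Qed.

Lemma integrable_gauss_moment (k : nat) :
  leb.-integrable setT (EFin \o (fun s => s ^+ k * gauss_fun s)).
Proof.
have A0 : (0 : R) < 2^-1 by rewrite invr_gt0.
have hA := integrable_has_integral (integrable_expR_sqr A0).
apply: (@has_integral_dominated _ _ _ leb _ _ _ _ _
  (has_integralZ (1 + 2 ^+ k * k`!%:R) hA)).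
  apply: measurable_funM; last exact: measurable_gauss_fun.
  exact: measurable_funX.
move=> s; rewrite normrM normrX (ger0_norm (gauss_fun_ge0 _)) /gauss_fun.
rewrite (_ : expR (- 2^-1 * s ^+ 2) =
  expR (2^-1 * s ^+ 2) * expR (- s ^+ 2)); last first.
  by rewrite -expRD; congr expR; field.
by rewrite mulrA ler_wpM2r ?expR_ge0// expr_le_expR_sqr.
Qed.

Lemma cvg_gauss_nat (th : R -> R) : (forall x, `|th x| <= 1) ->
  gauss_fun (N.+1%:R : R) * th N.+1%:R @[N --> \oo] --> 0.
Proof.
move=> th1; have g0 : gauss_fun (N.+1%:R : R) @[N --> \oo] --> 0.
  apply: (cvg_comp (fun N : nat => N.+1%:R : R) (@gauss_fun R)); last first.
    exact: cvg_gauss_fun.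
  by rewrite (cvg_shiftS (fun n : nat => n%:R : R)); exact: cvgr_idn.
apply/norm_cvg0P; apply: (squeeze_cvgr _ (@cvg_cst _ (0 : R) _ _ _) g0).
apply: nearW => N; rewrite normr_ge0/= normrM ger0_norm ?gauss_fun_ge0//.
by rewrite ler_piMr ?gauss_fun_ge0.
Qed.

(** In the frequency [b] the integral satisfies [F' = - (b / 2) F], by
    integration by parts, so that [F(b) exp (b^2 / 4)] is constant. *)
Lemma cos_integral_gauss (phi b : R) :
  cos_integral (@gauss_fun R) phi b =
  Num.sqrt pi * cos phi * expR (- b ^+ 2 / 4).
Proof.
pose F := cos_integral (@gauss_fun R) phi.
have gi := @integrableT_gauss R.
have sgi : leb.-integrable setT (EFin \o (fun s => s * gauss_fun s)).
  by apply: eq_integrable (integrable_gauss_moment 1) => // s _ /=; rewrite expr1.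
(* The derivative of the Gaussian against a wave has integral zero. *)
have F'E x : cos_integral (fun s => s * gauss_fun s) (phi + pi / 2) x =
    - (x / 2) * F x.
  have h1 := cos_integralP (phi + pi / 2) x sgi.
  have h2 := cos_integralP phi x gi.
  have h3 := has_integralD (has_integralZ 2 h1) (has_integralZ x h2).
  suff /has_integral_unique/(_ h3) H : has_integral leb
      (fun s => 2 * (s * gauss_fun s * cos (x * s + (phi + pi / 2))) +
        x * (gauss_fun s * cos (x * s + phi))) 0.
    by rewrite -/F in H; lra.
  apply: (@has_integral_derivative R setT (fun N => - N.+1%:R) (fun N => N.+1%:R)
    (fun s => gauss_fun s * sin (x * s + phi))
    (fun s => 2 * (s * gauss_fun s * cos (x * s + (phi + pi / 2))) +
        x * (gauss_fun s * cos (x * s + phi))) _ _ _ _ _ _ _ _ _ _ h3.1) => //.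
  - by move=> N; rewrite gtrN.
  - move=> s _; near=> N; rewrite in_itv/= -ler_norml.
    apply: (@le_trans _ _ N%:R); last by rewrite ler_nat.
    by near: N; exact: nbhs_infty_ger.
  - move=> s _; rewrite addrA cosDpihalf /gauss_fun; apply: is_derive_eq.
    by rewrite /GRing.scale/= !(mulr0, mul0r, add0r, addr0, mulr1); ring.
  - move=> s _; apply: (@cvgD _ R^o); apply: cvgM; try exact: cvg_cst.
      apply: cvgM; last exact: continuous_cos_affine.
      by apply: cvgM; [exact: cvg_id|exact: continuous_gauss_fun].
    by apply: cvgM; [exact: continuous_gauss_fun|exact: continuous_cos_affine].
  - by move=> s /(_ I).
  - have H1 : gauss_fun N.+1%:R * sin (x * N.+1%:R + phi) @[N --> \oo] --> 0.
      apply: (@cvg_gauss_nat (fun y => sin (x * y + phi))) => y.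
      by rewrite ler_norml sin_geN1 sin_le1.
    have H2 : gauss_fun (- N.+1%:R) * sin (x * - N.+1%:R + phi)
        @[N --> \oo] --> 0.
      under eq_fun do rewrite /gauss_fun sqrrN -/(gauss_fun _).
      apply: (@cvg_gauss_nat (fun y => sin (x * - y + phi))) => y.
      by rewrite ler_norml sin_geN1 sin_le1.
    by have := cvgB H1 H2; rewrite subrr; apply.
have dF (x : R) : is_derive x 1 F (- (x / 2) * F x).
  by rewrite -F'E; exact: is_derive_cos_integral.
have dFe (x : R) : is_derive x 1 (fun y => F y * expR (y ^+ 2 / 4)) 0.
  have dFx := dF x.
  apply: is_derive_eq.
  by rewrite /GRing.scale/= !(mulr0, mul0r, add0r, addr0, mulr1, mul1r); field.
have := is_derive_0_is_cst b 0 dFe.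
rewrite [in RHS]expr0n/= mul0r expR0 mulr1 => H.
have -> : cos_integral (@gauss_fun R) phi b =
    F b * expR (b ^+ 2 / 4) * expR (- b ^+ 2 / 4).
  by rewrite -mulrA -expRD mulNr subrr expR0 mulr1.
rewrite H; congr (_ * _).
apply: (has_integral_unique (cos_integralP phi 0 gi)).
have := has_integralZ (cos phi) (conj gi (@integralT_gauss R)).
by apply: has_integral_eq => [s|]; rewrite ?mul0r ?add0r mulrC.
Unshelve. all: by end_near. Qed.

Lemma has_integral_gauss_wave (A B b c : R) : 0 < A ->
  has_integral leb (fun x => cos (c + b * x) * expR (- A * x ^+ 2 + B * x))
    (Num.sqrt (pi / A) * expR ((B ^+ 2 - b ^+ 2) / (4 * A)) *
     cos (c + b * B / (2 * A))).
Proof.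
move=> A0; have [r r0 ->] : exists2 r, 0 < r & A = r ^+ 2.
  by exists (Num.sqrt A); rewrite ?sqrtr_gt0// sqr_sqrtr ?ltW.
have r0' : r != 0 by rewrite gt_eqF.
have := cos_integralP (c + b * B / (2 * r ^+ 2)) (b / r) (@integrableT_gauss R).
rewrite cos_integral_gauss.
move=> /(has_integral_affine (- (B / (2 * r))) r0).
move=> /(has_integralZ (expR (B ^+ 2 / (4 * r ^+ 2)))); apply: has_integral_eq => [x|].
  rewrite mulrA -expRD mulrC; congr (cos _ * expR _); field => //.
rewrite sqrtrM ?pi_ge0// sqrtrV ?sqr_ge0// sqrtr_sqr gtr0_norm//.
rewrite (_ : (B ^+ 2 - b ^+ 2) / (4 * r ^+ 2) = B ^+ 2 / (4 * r ^+ 2) + (- (b / r) ^+ 2 / 4)).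
  by rewrite expRD; ring.
by field.
Qed.

End gaussian.

Section row_gaussian.
Context (R : realType).

Lemma measurable_dot d (X : measurableType d) n (f g : X -> 'rV[R]_n) :
  measurable_fun setT f -> measurable_fun setT g ->
  measurable_fun setT (fun x => dot (f x) (g x)).
Proof.
move=> mf mg; rewrite /dot; apply: measurable_sum => j.
apply: measurable_funM.
  exact: (measurableT_comp (measurable_mxentry (0 : 'I_1) j) mf).
exact: (measurableT_comp (measurable_mxentry (0 : 'I_1) j) mg).
Qed.

Lemma measurable_cosT d (X : measurableType d) (f : X -> R) :
  measurable_fun setT f -> measurable_fun setT (fun x => cos (f x)).
Proof.
move=> mf; apply: (measurableT_comp (f := cos)) => //.
by apply: continuous_measurable_fun; exact: continuous_cos.
Qed.

Lemma measurable_expRT d (X : measurableType d) (f : X -> R) :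
  measurable_fun setT f -> measurable_fun setT (fun x => expR (f x)).
Proof. by move=> mf; apply: (measurableT_comp (f := expR)). Qed.

Let tail n (v : 'rV[R]_n.+1) : 'rV[R]_n := (row_uncons v).2.

Lemma dot_row_cons n (b : 'rV[R]_n.+1) (s : R) (v : 'rV[R]_n) :
  dot b (row_cons (s, v)) = b 0 0 * s + dot (tail b) v.
Proof.
rewrite /dot big_ord_recl row_cons0; congr (_ + _).
by apply: eq_bigr => j _; rewrite row_consS mxE.
Qed.

Lemma dot_row_uncons n (a b : 'rV[R]_n.+1) :
  dot a b = a 0 0 * b 0 0 + dot (tail a) (tail b).
Proof.
by rewrite -[b in LHS]row_unconsK dot_row_cons.
Qed.

(** The one-dimensional formula, one coordinate at a time. The integrand
    without oscillation ([c = 0], [b = 0]) dominates, and its integral is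
    given by the same formula. *)
Lemma has_integral_gauss_row n (A c : R) (B b : 'rV[R]_n) : 0 < A ->
  has_integral (lebesgue_row R n)
    (fun x => cos (c + dot b x) * expR (- A * dot x x + dot B x))
    (Num.sqrt (pi / A) ^+ n * expR ((dot B B - dot b b) / (4 * A)) *
     cos (c + dot b B / (2 * A))).
Proof.
move=> A0; elim: n c B b => [|n IH] c B b.
  have z (x y : 'rV[R]_0) : dot x y = 0 by rewrite /dot big_ord0.
  apply: has_integral_eq (_ : has_integral _ (fun=> cos c) (cos c)) => [x|/=|].
  - by rewrite !z addr0 mulr0 addr0 expR0 mulr1.
  - by rewrite !z expr0 subrr !mul0r expR0 addr0 !mul1r.
  split; last by rewrite /= integral_cst//= diracT mule1.
  apply: (@measurable_bounded_integrable _ _ _ (dirac (0 : 'rV[R]_0))) => //.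
    by rewrite /= diracT ltry.
  exact: bounded_cst.
pose f (c : R) (b : 'rV[R]_n.+1) (x : 'rV[R]_n.+1) : R :=
  cos (c + dot b x) * expR (- A * dot x x + dot B x).
have mf c' b' : measurable_fun setT (f c' b').
  apply: measurable_funM.
    by apply/measurable_cosT/measurable_funD => //; exact: measurable_dot.
  apply/measurable_expRT/measurable_funD; last exact: measurable_dot.
  by apply: measurable_funM => //; exact: measurable_dot.
pose H c (b : 'rV[R]_n.+1) (s : R) : R :=
  Num.sqrt (pi / A) ^+ n *
  expR ((dot (tail B) (tail B) - dot (tail b) (tail b)) / (4 * A)) *
  (cos (c + dot (tail b) (tail B) / (2 * A) + b 0 0 * s) *
   expR (- A * s ^+ 2 + B 0 0 * s)).
have inner c' b' s :
    has_integral (lebesgue_row R n) (fun v => f c' b' (row_cons (s, v))) (H c' b' s).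
  have := has_integralZ (expR (- A * s ^+ 2 + B 0 0 * s))
    (IH (c' + b' 0 0 * s) (tail B) (tail b')).
  apply: has_integral_eq => [v|]; last first.
    by rewrite /H (addrAC c') [LHS]mulrC !mulrA.
  rewrite /f !dot_row_cons row_cons0 mulrCA -expRD /=.
  rewrite (_ : tail (row_cons (s, v)) = v); last by rewrite /tail (row_consK (s, v)).
  by congr (cos _ * expR _); ring.
have outer c' b' : has_integral (@lebesgue_measure R) (H c' b')
    (Num.sqrt (pi / A) ^+ n.+1 * expR ((dot B B - dot b' b') / (4 * A)) *
     cos (c' + dot b' B / (2 * A))).
  have := has_integralZ (Num.sqrt (pi / A) ^+ n *
    expR ((dot (tail B) (tail B) - dot (tail b') (tail b')) / (4 * A)))
    (has_integral_gauss_wave (B 0 0) (b' 0 0) (c' + dot (tail b') (tail B) / (2 * A)) A0).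
  apply: has_integral_eq => // .
  rewrite (dot_row_uncons B B) (dot_row_uncons b' b') (dot_row_uncons b' B).
  rewrite (_ : (_ + _ - _) / (4 * A) =
    (dot (tail B) (tail B) - dot (tail b') (tail b')) / (4 * A) +
    (B 0 0 ^+ 2 - b' 0 0 ^+ 2) / (4 * A)); last by field; rewrite gt_eqF.
  rewrite expRD (_ : c' + dot (tail b') (tail B) / (2 * A) +
    b' 0 0 * B 0 0 / (2 * A) =
    c' + (b' 0 0 * B 0 0 + dot (tail b') (tail B)) / (2 * A)); last by ring.
  rewrite (exprSr _ n).
  by move: (_ ^+ n) => S; ring.
have cons : @measurable_fun _ _ (measurableTypeR R * 'rV[R]_n)%type
    'rV[R]_n.+1 setT (@row_cons R n) by exact: measurable_row_cons.
have img := @has_integral_image _ _ (measurableTypeR R * 'rV[R]_n)%type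
  'rV[R]_n.+1 R (@row_cons R n)
  (lebesgue_measure \x lebesgue_row R n)%E
  (lebesgue_row R n.+1) (f c b) _ cons (fun=> fun=> erefl) (mf _ _).
apply: img.
have dom (z : measurableTypeR R * 'rV[R]_n) :
    `|(f c b \o @row_cons R n) z| <= (f 0 0 \o @row_cons R n) z.
  rewrite /f/= normrM (ger0_norm (expR_ge0 _)).
  rewrite (_ : dot 0 _ = 0) ?addr0 ?cos0 ?ler_wpM2r ?expR_ge0//.
    by rewrite ler_norml cos_geN1 cos_le1.
  by rewrite /dot big1// => j _; rewrite mxE mul0r.
have [hprod hH] := @has_integral_prod _ _ _ _ R lebesgue_measure
  (lebesgue_row R n) (f c b \o @row_cons R n) (f 0 0 \o @row_cons R n)
  (H c b) (H 0 0) _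
  (measurableT_comp (mf _ _) cons) (measurableT_comp (mf _ _) cons)
  dom (inner 0 0) (outer 0 0) (inner c b).
by rewrite -(has_integral_unique hH (outer c b)).
Qed.

End row_gaussian.

Lemma has_integral_mul d1 d2 (T1 : measurableType d1) (T2 : measurableType d2)
    (R : realType) (m1 : {sigma_finite_measure set T1 -> \bar R})
    (m2 : {sigma_finite_measure set T2 -> \bar R}) (f : T1 -> R) (g : T2 -> R)
    (v w : R) :
  has_integral m1 f v -> has_integral m2 g w ->
  has_integral (m1 \x m2)%E (fun z => f z.1 * g z.2) (v * w).
Proof.
move=> hf hg.
have mf := has_integral_measurable hf; have mg := has_integral_measurable hg.
have hf' : has_integral m1 (fun x => `|f x|) (\int[m1]_x `|f x|).
  exact: integrable_has_integral (integrable_norm hf.1).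
have hg' : has_integral m2 (fun y => `|g y|) (\int[m2]_y `|g y|).
  exact: integrable_has_integral (integrable_norm hg.1).
have m2f (p : T1 -> R) (q : T2 -> R) : measurable_fun setT p ->
    measurable_fun setT q ->
    measurable_fun setT (fun z : T1 * T2 => p z.1 * q z.2).
  move=> mp mq; apply: measurable_funM.
    exact: (measurableT_comp mp measurable_fst).
  exact: (measurableT_comp mq measurable_snd).
have hF := has_integralZ w hf.
have dom (z : T1 * T2) : `|f z.1 * g z.2| <= `|f z.1| * `|g z.2|.
  by rewrite normrM.
have secG x : has_integral m2 (fun y => `|f (x, y).1| * `|g (x, y).2|)
    (\int[m2]_y `|g y| * `|f x|).
  by rewrite mulrC /=; exact: has_integralZ.
have secF x : has_integral m2 (fun y => f (x, y).1 * g (x, y).2) (w * f x).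
  by rewrite mulrC /=; exact: has_integralZ.
have [+ hF'] := @has_integral_prod _ _ _ _ R m1 m2 (fun z => f z.1 * g z.2)
  (fun z => `|f z.1| * `|g z.2|) _ _ _ (m2f _ _ mf mg)
  (m2f _ _ (has_integral_measurable hf') (has_integral_measurable hg'))
  dom secG (has_integralZ _ hf') secF.
by rewrite (has_integral_unique hF' hF) mulrC.
Qed.

(** * Hermite functions and the Mehler kernel *)

Section mehler.
Context (R : realType).
Notation leb := (@lebesgue_measure R).

Let hmoment (k : nat) (s : R) : R := s ^+ k * gauss_fun s.

(** The Gaussian is its own Fourier transform up to scaling, and each
    derivative in [x] brings down a factor [2 s] and a quarter turn. *)
Lemma derive1n_gauss (k : nat) (x : R) :
  derive1n k (fun u : R => expR (- u ^+ 2)) x =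
  (Num.sqrt pi)^-1 * 2 ^+ k * cos_integral (hmoment k) (k%:R * (pi / 2)) (2 * x).
Proof.
elim: k x => [|k IH] x.
  rewrite derive1n0 expr0 mulr1 mul0r.
  rewrite (_ : hmoment 0 = @gauss_fun R); last first.
    by apply/funext => s; rewrite /hmoment expr0 mul1r.
  rewrite cos_integral_gauss cos0 mulr1 mulKf ?gt_eqF ?sqrtr_gt0 ?pi_gt0//.
  by congr expR; field.
rewrite derive1nS (funext IH).
have shE : (fun s : R => s * hmoment k s) = hmoment k.+1.
  by apply/funext => s; rewrite /hmoment exprS mulrA.
have := @is_derive_cos_integral R (hmoment k) (k%:R * (pi / 2)) (2 * x)
  (integrable_gauss_moment R k).
rewrite shE => /(_ (integrable_gauss_moment R k.+1)).
rewrite (_ : k%:R * (pi / 2) + pi / 2 = k.+1%:R * (pi / 2)); last first.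
  by rewrite -(natr1 k) [RHS]mulrDl mul1r.
move=> dC; rewrite derive1E; apply: derive_val.
have d2 : is_derive x (1 : R) (fun y : R => 2 * y) 2.
  by apply: is_derive_eq; rewrite /GRing.scale/= mulr1.
have := is_derive1_comp (f := cos_integral (hmoment k) (k%:R * (pi / 2)))
  (g := fun y : R => 2 * y) (x := x) dC d2.
move=> dcomp; apply: is_derive_eq.
by rewrite /GRing.scale/= exprS; ring.
Qed.

Lemma cosDkpi (x : R) (k : nat) : cos (x + k%:R * pi) = (-1) ^+ k * cos x.
Proof.
elim: k x => [|k IH] x; first by rewrite mul0r addr0 expr0 mul1r.
rewrite -(natr1 k) [(_ + 1) * _]mulrDl mul1r addrA cosDpi IH exprS.
by rewrite mulN1r mulNr.
Qed.

(** The two phases [k pi / 2] enter the product only through [(-1)^k]; a sum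
    over [k] against [z^k / k!] becomes a pair of exponentials. *)
Lemma cosM_quarter_turns (a b : R) (k : nat) :
  cos (a + k%:R * (pi / 2)) * cos (b + k%:R * (pi / 2)) =
  2^-1 * ((-1) ^+ k * cos (a + b) + cos (a - b)).
Proof.
have cosMcos (p q : R) : cos p * cos q = 2^-1 * (cos (p + q) + cos (p - q)).
  by rewrite cosD cosB; field.
rewrite cosMcos -cosDkpi; congr (_ * (cos _ + cos _)); last by ring.
by move: (pi : R) => r; field.
Qed.

Lemma cvg_expR_series (z : R) :
  \sum_(k < N) z ^+ k / k`!%:R @[N --> \oo] --> expR z.
Proof.
have := is_cvg_series_exp_coeff z; rewrite /expR => /cvg_ex[l cl].
rewrite (cvg_lim _ cl)//; move: cl; rewrite /series/=.
by under eq_fun do rewrite big_mkord.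
Qed.

Lemma sum_exp_le (z : R) N : 0 <= z -> \sum_(k < N) z ^+ k / k`!%:R <= expR z.
Proof.
move=> z0; rewrite -(cvg_lim _ (@cvg_expR_series z))//.
apply: (nondecreasing_cvgn_le (u_ := fun N => \sum_(k < N) z ^+ k / k`!%:R)).
  apply/nondecreasing_seqP => m; rewrite big_ord_recr lerDl.
  by rewrite divr_ge0 ?exprn_ge0.
by apply/cvg_ex; exists (expR z); exact: (@cvg_expR_series z).
Qed.

(** The closed form of the sum of [u^k phi_k(x) phi_k(y)]. *)
Definition mehler (u x y : R) : R :=
  (Num.sqrt pi * Num.sqrt (1 - u ^+ 2))^-1 *
  expR ((x ^+ 2 - y ^+ 2) / 2 - (x - u * y) ^+ 2 / (1 - u ^+ 2)).

Let C (k : nat) (x : R) := cos_integral (hmoment k) (k%:R * (pi / 2)) (2 * x).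

Lemma hermite_funE (k : nat) (x : R) : hermite_fun k x =
  (2 ^+ k * Num.sqrt pi * k`!%:R) `^ (- 2^-1) * (-1) ^+ k * 2 ^+ k /
  Num.sqrt pi * expR (x ^+ 2 / 2) * C k x.
Proof.
rewrite /hermite_fun /hermite derive1n_gauss -/(C k x).
rewrite (_ : expR (x ^+ 2 / 2) = expR (- x ^+ 2 / 2) * expR (x ^+ 2)); first by ring.
by rewrite -expRD; congr expR; field.
Qed.

Lemma hermite_funM (k : nat) (x y : R) :
  hermite_fun k x * hermite_fun k y =
  Num.sqrt pi ^- 3 * expR ((x ^+ 2 + y ^+ 2) / 2) *
  (2 ^+ k / k`!%:R * (C k x * C k y)).
Proof.
have sp0 : 0 < Num.sqrt (pi : R) by rewrite sqrtr_gt0 pi_gt0.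
have kf0 : (0 : R) < k`!%:R by rewrite ltr0n fact_gt0.
have k20 : (0 : R) < 2 ^+ k by rewrite exprn_gt0.
rewrite !hermite_funE; set N := (_ `^ _).
have NN : N * N = (2 ^+ k * Num.sqrt pi * k`!%:R)^-1.
  rewrite /N -powRD; last by apply/implyP => _; rewrite gt_eqF ?mulr_gt0.
  rewrite (_ : - 2^-1 - 2^-1 = -1 :> R); last by field.
  by rewrite powR_inv1// ltW// !mulr_gt0.
have sg : (-1) ^+ k * (-1) ^+ k = 1 :> R by rewrite -expr2 sqrr_sign.
transitivity (N * N * ((-1) ^+ k * (-1) ^+ k) * 2 ^+ k * 2 ^+ k /
   Num.sqrt pi ^+ 2 * (expR (x ^+ 2 / 2) * expR (y ^+ 2 / 2)) * (C k x * C k y)).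
  move: (Num.sqrt pi) sp0 (2 ^+ k) ((-1) ^+ k) => s s0 t r.
  by field; rewrite gt_eqF.
rewrite NN sg -expRD -mulrDl.
move: (Num.sqrt pi) (2 ^+ k) (expR _) sp0 k20 => s t e sp0 k20.
by field; rewrite !gt_eqF.
Qed.

End mehler.

Section mehler_formula.
Context (R : realType).
Notation leb := (@lebesgue_measure R).
Notation leb2 := (leb \x leb)%E.

Let C (k : nat) (x : R) :=
  cos_integral (fun s => s ^+ k * gauss_fun s) (k%:R * (pi / 2)) (2 * x).

Let term (u x y : R) (k : nat) (z : measurableTypeR R * measurableTypeR R) : R :=
  (2 * u) ^+ k / k`!%:R *
  ((z.1 ^+ k * gauss_fun z.1 * cos (2 * x * z.1 + k%:R * (pi / 2))) *
   (z.2 ^+ k * gauss_fun z.2 * cos (2 * y * z.2 + k%:R * (pi / 2)))).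

Let term_integral u x y k :
  has_integral leb2 (term u x y k) ((2 * u) ^+ k / k`!%:R * (C k x * C k y)).
Proof.
apply: has_integralZ.
have := has_integral_mul (cos_integralP (k%:R * (pi / 2)) (2 * x) (integrable_gauss_moment R k))
  (cos_integralP (k%:R * (pi / 2)) (2 * y) (integrable_gauss_moment R k)).
exact.
Qed.

Let termE u x y k z : term u x y k z =
  gauss_fun z.1 * gauss_fun z.2 / 2 *
  (cos (2 * x * z.1 + 2 * y * z.2) * ((- (2 * u * z.1 * z.2)) ^+ k / k`!%:R) +
   cos (2 * x * z.1 - 2 * y * z.2) * ((2 * u * z.1 * z.2) ^+ k / k`!%:R)).
Proof.
rewrite /term.
transitivity ((2 * u) ^+ k * z.1 ^+ k * z.2 ^+ k / k`!%:R *
    (gauss_fun z.1 * gauss_fun z.2) *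
    (cos (2 * x * z.1 + k%:R * (pi / 2)) * cos (2 * y * z.2 + k%:R * (pi / 2)))).
  by ring.
rewrite cosM_quarter_turns -!exprMn [in RHS]exprNn.
by ring.
Qed.

Let term_limit (u x y : R) (z : measurableTypeR R * measurableTypeR R) : R :=
  gauss_fun z.1 * gauss_fun z.2 / 2 *
  (cos (2 * x * z.1 + 2 * y * z.2) * expR (- (2 * u * z.1 * z.2)) +
   cos (2 * x * z.1 - 2 * y * z.2) * expR (2 * u * z.1 * z.2)).

Let cvg_term u x y z :
  \sum_(k < N) term u x y k z @[N --> \oo] --> term_limit u x y z.
Proof.
under eq_fun do (under eq_bigr do rewrite termE).
under eq_fun do rewrite -mulr_sumr big_split/= -!mulr_sumr.
apply: cvgM; first exact: cvg_cst.
by apply: (@cvgD _ R^o); apply: cvgM; (try exact: cvg_cst); exact: cvg_expR_series.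
Qed.

Let dom (u : R) (z : measurableTypeR R * measurableTypeR R) : R :=
  expR (- (1 - u) * z.1 ^+ 2) * expR (- (1 - u) * z.2 ^+ 2).

(** [2 u |s t| <= u (s^2 + t^2)] leaves the Gaussian factor [exp (- (1 - u)
    (s^2 + t^2))]. *)
Let term_dom u x y N z : 0 <= u -> `|\sum_(k < N) term u x y k z| <= dom u z.
Proof.
move=> u0.
apply: (@le_trans _ _ (gauss_fun z.1 * gauss_fun z.2 *
    \sum_(k < N) (2 * u * (`|z.1| * `|z.2|)) ^+ k / k`!%:R)).
  rewrite mulr_sumr; apply: (le_trans (ler_norm_sum _ _ _)); apply: ler_sum => k _.
  have c1 t : `|cos t| <= 1 :> R by rewrite ler_norml cos_geN1 cos_le1.
  rewrite /term !normrM !normrX !normrM (ger0_norm u0) normfV !normr_nat.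
  rewrite !(ger0_norm (gauss_fun_ge0 _)).
  set a := gauss_fun z.1; set b := gauss_fun z.2.
  set c := `|cos _|; set d := `|cos _|.
  rewrite !exprMn.
  rewrite [leLHS](_ : _ = a * b * (2 ^+ k * u ^+ k * (`|z.1| ^+ k * `|z.2| ^+ k) / k`!%:R) *
    (c * d)); last by ring.
  rewrite ler_piMr//; last by rewrite mulr_ile1 ?normr_ge0 ?c1.
  by rewrite !mulr_ge0 ?gauss_fun_ge0 ?exprn_ge0 ?invr_ge0.
apply: (@le_trans _ _ (gauss_fun z.1 * gauss_fun z.2 *
    expR (2 * u * (`|z.1| * `|z.2|)))).
  rewrite ler_wpM2l ?mulr_ge0 ?gauss_fun_ge0// sum_exp_le//.
  by rewrite !mulr_ge0.
rewrite /gauss_fun /dom -!expRD ler_expR.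
rewrite -(real_normK (num_real z.1)) -(real_normK (num_real z.2)).
have := mulr_ge0 u0 (sqr_ge0 (`|z.1| - `|z.2|)).
by move: `|z.1| `|z.2| => s t; nra.
Qed.

Let limit_inner u x y (s : R) :
  has_integral leb (fun r => term_limit u x y (s, r))
    (Num.sqrt pi * expR (- y ^+ 2) *
     (cos (0 + 2 * (x - u * y) * s) * expR (- (1 - u ^+ 2) * s ^+ 2 + 0 * s))).
Proof.
have h1 := has_integral_gauss_wave (- (2 * u * s)) (2 * y) (2 * x * s) ltr01.
have h2 := has_integral_gauss_wave (2 * u * s) (- (2 * y)) (2 * x * s) ltr01.
have := has_integralZ (gauss_fun s / 2) (has_integralD h1 h2).
apply: has_integral_eq => [r|].
  rewrite /term_limit /= !expRD !mulN1r /gauss_fun !mulNr.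
  by ring.
rewrite !divr1 !mulr1 /gauss_fun !mul0r !addr0 add0r.
rewrite (_ : 2 * x * s + 2 * y * - (2 * u * s) / 2 = 2 * (x - u * y) * s); last by field.
rewrite (_ : 2 * x * s + - (2 * y) * (2 * u * s) / 2 = 2 * (x - u * y) * s); last by field.
rewrite sqrrN (sqrrN (2 * y)).
rewrite (_ : expR ((_ - _) / 4) = expR (u ^+ 2 * s ^+ 2) * expR (- y ^+ 2)); last first.
  by rewrite -expRD; congr expR; field.
rewrite (_ : - (1 - u ^+ 2) * s ^+ 2 = - s ^+ 2 + u ^+ 2 * s ^+ 2); last by ring.
by rewrite expRD; field.
Qed.

(** Mehler's formula. Each Hermite function is a cosine integral of [s^k exp
    (- s^2)]; under the double integral the series in [k] becomes an
    exponential series, and a Gaussian integral remains. *)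
Lemma cvg_mehler (u x y : R) : 0 <= u < 1 ->
  \sum_(k < N) u ^+ k * (hermite_fun k x * hermite_fun k y) @[N --> \oo] -->
  mehler u x y.
Proof.
move=> /andP[u0 u1]; have u1' : 0 < 1 - u by rewrite subr_gt0.
have u2 : 0 < 1 - u ^+ 2 by rewrite subr_gt0 expr_lt1.
have hS N : has_integral leb2 (fun z => \sum_(k < N) term u x y k z)
    (\sum_(k < N) (2 * u) ^+ k / k`!%:R * (C k x * C k y)).
  by apply: has_integral_sum => k; exact: term_integral.
have hd1 := integrable_has_integral (integrable_expR_sqr u1').
have hdom := has_integral_mul hd1 hd1.
have [hl cv] := has_integral_cvg hS hdom (fun N z => term_dom x y N z u0)
  (fun z => @cvg_term u x y z).
have limit_dom z : `|term_limit u x y z| <= dom u z.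
  apply: (cvgr_to_le (cvg_norm (@cvg_term u x y z))); apply: nearW => N.
  exact: term_dom.
have houter := has_integralZ (Num.sqrt pi * expR (- y ^+ 2))
  (has_integral_gauss_wave 0 (2 * (x - u * y)) 0 u2).
have secD s : has_integral leb (fun r => dom u (s, r))
    ((\int[leb]_x expR (- (1 - u) * x ^+ 2)) * expR (- (1 - u) * s ^+ 2)).
  by rewrite mulrC /dom/=; exact: has_integralZ.
have [hl' hF] := @has_integral_prod _ _ _ _ R leb leb (term_limit u x y) (dom u)
  _ _ _ (has_integral_measurable hl) (has_integral_measurable hdom)
  limit_dom secD (has_integralZ _ hd1)
  (limit_inner u x y).
have /= VE := has_integral_unique hF houter.
rewrite (has_integral_unique hl hl') VE in cv.
rewrite (_ : mehler u x y = Num.sqrt pi ^- 3 * expR ((x ^+ 2 + y ^+ 2) / 2) *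
  (Num.sqrt pi * expR (- y ^+ 2) * (Num.sqrt (pi / (1 - u ^+ 2)) *
   expR ((0 ^+ 2 - (2 * (x - u * y)) ^+ 2) / (4 * (1 - u ^+ 2))) *
   cos (0 + 2 * (x - u * y) * 0 / (2 * (1 - u ^+ 2)))))); last first.
  rewrite mulr0 mul0r addr0 cos0 mulr1 /mehler.
  rewrite sqrtrM ?pi_ge0// sqrtrV ?ltW//.
  rewrite (_ : (x ^+ 2 - y ^+ 2) / 2 - (x - u * y) ^+ 2 / (1 - u ^+ 2) =
    (x ^+ 2 + y ^+ 2) / 2 + - y ^+ 2 +
    (0 ^+ 2 - (2 * (x - u * y)) ^+ 2) / (4 * (1 - u ^+ 2))); last first.
    by field; rewrite gt_eqF.
  rewrite !expRD; have := sqrtr_gt0 (pi : R); rewrite pi_gt0.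
  have := sqrtr_gt0 (1 - u ^+ 2); rewrite u2.
  move: (Num.sqrt pi) (Num.sqrt (1 - u ^+ 2)) => a b b0 a0.
  by field; rewrite !gt_eqF.
have tE k : u ^+ k * (hermite_fun k x * hermite_fun k y) =
    Num.sqrt pi ^- 3 * expR ((x ^+ 2 + y ^+ 2) / 2) *
      ((2 * u) ^+ k / k`!%:R * (C k x * C k y)).
  rewrite hermite_funM -/(C k x) -/(C k y) (exprMn _ 2).
  by move: (2 ^+ k) (u ^+ k) (Num.sqrt pi ^- 3) => a b c; ring.
under eq_fun do (under eq_bigr do rewrite tE).
under eq_fun do rewrite -mulr_sumr.
by apply: cvgM => //; exact: cvg_cst.
Qed.

End mehler_formula.

Section hermite_bounds.
Context (R : realType).

Lemma continuous_hermite_fun (k : nat) : continuous (@hermite_fun R k).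
Proof.
move=> x; rewrite (funext (@hermite_funE R k)).
have d2 : is_derive x (1 : R) (fun y : R => 2 * y) 2.
  by apply: is_derive_eq; rewrite /GRing.scale/= mulr1.
have dC := @is_derive_cos_integral R (fun s => s ^+ k * gauss_fun s)
  (k%:R * (pi / 2)) (2 * x) (integrable_gauss_moment R k).
have {}dC := dC _.
have cC : {for x, continuous (fun y : R => cos_integral
    (fun s => s ^+ k * gauss_fun s) (k%:R * (pi / 2)) (2 * y))}.
  apply/differentiable_continuous/derivable1_diffP.
  have [|+ _] := is_derive1_comp (dC _) d2; last by [].
  apply: eq_integrable (integrable_gauss_moment R k.+1) => // s _ /=.
  by rewrite exprS mulrA.
apply: cvgM; last exact: cC.
apply: cvgM; first exact: cvg_cst.
apply: (cvg_comp (fun y : R => y ^+ 2 / 2) expR); last exact: continuous_expR.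
by apply: cvgM; [exact: sqr_continuous|exact: cvg_cst].
Qed.

Lemma measurable_hermite_fun (k : nat) : measurable_fun setT (@hermite_fun R k).
Proof. by apply: continuous_measurable_fun; exact: continuous_hermite_fun. Qed.

(** The diagonal terms of the Mehler series are nonnegative, so each of them is
    bounded by the sum; this gives Gaussian decay of the Hermite functions with
    a geometric dependence on the degree. *)
Lemma hermite_fun_bound (t : R) : 0 < t < 1 ->
  exists K delta : R, [/\ 0 <= K, 0 < delta &
    forall k x, t ^+ k * `|hermite_fun k x| <= K * expR (- delta * x ^+ 2)].
Proof.
move=> /andP[t0 t1]; pose w := t ^+ 2.
have w0 : 0 < w by rewrite exprn_gt0.
have w1 : w < 1 by rewrite expr_lt1 ?ltW.
have w01 : 0 <= w < 1 by rewrite ltW.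
pose C := (Num.sqrt pi * Num.sqrt (1 - w ^+ 2))^-1 : R.
have C0 : 0 <= C by rewrite invr_ge0 mulr_ge0.
(* On the diagonal the exponent of the Mehler kernel is
   [- x^2 (1 - w) / (1 + w)]; the bound is its square root. *)
exists (Num.sqrt C), ((1 - w) / (1 + w) / 2); split => //.
  by rewrite !divr_gt0 ?subr_gt0 ?addr_gt0.
move=> k x; rewrite -(ler_pXn2r (n := 2))// ?nnegrE; last 2 first.
- by rewrite mulr_ge0 ?exprn_ge0 ?(ltW t0).
- by rewrite mulr_ge0 ?expR_ge0.
rewrite !exprMn sqr_sqrtr// real_normK ?num_real// -exprM mulnC exprM -/w.
have -> : C * expR (- ((1 - w) / (1 + w) / 2) * x ^+ 2) ^+ 2 = mehler w x x.
  rewrite /mehler subrr mul0r add0r -/C; congr (_ * _).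
  rewrite -expRM_natl; congr expR; field.
  have -> : 1 - w ^+ 2 = (1 - w) * (1 + w) by ring.
  by rewrite mulf_neq0 ?gt_eqF ?subr_gt0 ?addr_gt0.
rewrite -(cvg_lim _ (@cvg_mehler R w x x w01))//.
pose S N := \sum_(k < N) w ^+ k * (hermite_fun k x * hermite_fun k x).
have p0 j : 0 <= w ^+ j * (hermite_fun j x * hermite_fun j x).
  by apply: mulr_ge0; [rewrite exprn_ge0 ?ltW|rewrite -expr2 sqr_ge0].
apply: (@le_trans _ _ (S k.+1)).
  rewrite /S big_ord_recr/= expr2 lerDr; exact: sumr_ge0.
apply: (nondecreasing_cvgn_le (u_ := S)).
  by apply/nondecreasing_seqP => m; rewrite /S big_ord_recr lerDl.
by apply/cvg_ex; exists (mehler w x x); exact: (@cvg_mehler R w x x w01).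
Qed.

(** With [u = s t^2] the factor [t^(2 k)] pays for the growth in [k] of the
    two Hermite functions and [s^k] gives a geometric series. *)
Lemma mehler_sum_bound (u : R) : 0 < u < 1 ->
  exists K delta : R, [/\ 0 <= K, 0 < delta & forall N x y,
    \sum_(k < N) u ^+ k * `|hermite_fun k x * hermite_fun k y| <=
    K * expR (- delta * (x ^+ 2 + y ^+ 2))].
Proof.
move=> /andP[u0 u1]; pose s := Num.sqrt u; pose t := Num.sqrt s.
have s0 : 0 < s by rewrite sqrtr_gt0.
have t0 : 0 < t by rewrite sqrtr_gt0.
have s1 : s < 1 by rewrite -[ltRHS]sqrtr1 ltr_sqrt.
have t1 : t < 1 by rewrite -[ltRHS]sqrtr1 ltr_sqrt.
have uE : u = s * t ^+ 2 by rewrite sqr_sqrtr ?(ltW s0)// -expr2 sqr_sqrtr ?ltW.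
have [|K [delta [K0 d0 bd]]] := @hermite_fun_bound t; first by rewrite t0.
exists ((1 - s)^-1 * (K * K)), delta; split => //.
  by rewrite mulr_ge0 ?invr_ge0 ?subr_ge0 ?(ltW s1)// mulr_ge0.
move=> N x y.
apply: (@le_trans _ _ (\sum_(k < N) s ^+ k *
    (K * K * expR (- delta * (x ^+ 2 + y ^+ 2))))).
  apply: ler_sum => k _; rewrite uE exprMn -[leLHS]mulrA ler_wpM2l ?exprn_ge0 ?(ltW s0)//.
  rewrite normrM mulrDr expRD.
  rewrite (_ : _ * _ = (t ^+ k * `|hermite_fun k x|) * (t ^+ k * `|hermite_fun k y|)).
    rewrite (_ : K * K * _ = (K * expR (- delta * x ^+ 2)) * (K * expR (- delta * y ^+ 2))).
      by apply: ler_pM => //; rewrite mulr_ge0 ?exprn_ge0 ?(ltW t0).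
    by ring.
  by rewrite -exprM mulnC exprM expr2; ring.
rewrite -mulr_suml -[leRHS]mulrA ler_wpM2r ?mulr_ge0 ?expR_ge0//.
have s1n : `|s| < 1 by rewrite ger0_norm ?ltW.
have := geometric_le_lim N (ler01 : 0 <= 1 :> R) s0 s1n.
rewrite /series/= big_mkord mul1r; apply: le_trans.
by apply: ler_sum => k _; rewrite mul1r.
Qed.

End hermite_bounds.

(** * Box sums of Hermite functions on [R^n] *)

Section box_sums.
Context (R : realType) (n : nat).
Implicit Types (x y : 'rV[R]_n) (u : R).

Definition box_index N (f : {ffun 'I_n -> 'I_N}) : multi_index n :=
  [ffun j => f j : nat].

(** Boxes of multi-indices are used as partial sums because on a box a sum
    of products over the coordinates factors. *)
Lemma box_sum_prod N u (F : 'I_n -> nat -> R) :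
  \sum_(f : {ffun 'I_n -> 'I_N})
    u ^+ mi_abs (box_index f) * \prod_j F j (box_index f j) =
  \prod_j \sum_(k < N) u ^+ k * F j k.
Proof.
rewrite bigA_distr_bigA; apply: eq_bigr => f _.
rewrite big_split/= prodrXr; congr (_ ^+ _ * _).
  by apply: eq_bigr => j _; rewrite ffunE.
by apply: eq_bigr => j _; rewrite ffunE.
Qed.

Lemma measurable_hermite_multi d (X : measurableType d) (alpha : multi_index n)
    (f : X -> 'rV[R]_n) : measurable_fun setT f ->
  measurable_fun setT (fun w => hermite_multi alpha (f w)).
Proof.
move=> mf; rewrite /hermite_multi; apply: measurable_prod => j _.
apply: (measurableT_comp (measurable_hermite_fun (alpha j))).
exact: (measurableT_comp (measurable_mxentry (0 : 'I_1) j) mf).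
Qed.

(** [mehler u x y] is a multiple of [exp (- P (x^2 + y^2) + Q x y)]. *)
Definition mehlerP u : R := (1 + u ^+ 2) / (2 * (1 - u ^+ 2)).
Definition mehlerQ u : R := 2 * u / (1 - u ^+ 2).

Lemma mehlerE u (a b : R) : 0 <= u < 1 -> mehler u a b =
  (Num.sqrt (pi * (1 - u ^+ 2)))^-1 *
  expR (- mehlerP u * (a ^+ 2 + b ^+ 2) + mehlerQ u * (a * b)).
Proof.
move=> /andP[u0 u1]; rewrite sqrtrM ?pi_ge0// /mehler; congr (_ * expR _).
rewrite /mehlerP /mehlerQ; field.
by rewrite subr_eq0 eq_sym lt_eqF// expr_lt1.
Qed.

(** The real function of which [hermite_scaled] is the complex version. *)
Definition scaled_hermite (l : R) (alpha : multi_index n) x : R :=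
  l `^ (n%:R / 4) * hermite_multi alpha (l `^ 2^-1 *: x).

Lemma measurable_scaled_hermite d (X : measurableType d) (alpha : multi_index n)
    (l : X -> R) (f : X -> 'rV[R]_n) :
  measurable_fun setT l -> measurable_fun setT f ->
  measurable_fun setT (fun w => scaled_hermite (l w) alpha (f w)).
Proof.
move=> ml mf.
have mpow (b : R) : measurable_fun setT (fun w => l w `^ b).
  by apply: (measurableT_comp (f := fun c : R => c `^ b)) => //; exact: measurable_powR.
apply: measurable_funM => //; apply: measurable_hermite_multi.
apply: measurable_fun_mxentryP => i j; under eq_fun do rewrite mxE.
apply: measurable_funM => //.
exact: (measurableT_comp (measurable_mxentry i j) mf).
Qed.

Variable l : R.
Hypothesis l_gt0 : 0 < l.

Let kappa : R := l `^ 2^-1.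

Let kappa_sqr : kappa ^+ 2 = l.
Proof. by rewrite /kappa powR12_sqrt ?ltW// sqr_sqrtr ?ltW. Qed.

Definition box_kernel N u x y : R :=
  \sum_(f : {ffun 'I_n -> 'I_N}) u ^+ mi_abs (box_index f) *
    (scaled_hermite l (box_index f) x * scaled_hermite l (box_index f) y).

Definition mehler_kernel u x y : R :=
  Num.sqrt (l / (pi * (1 - u ^+ 2))) ^+ n *
  expR (l * (- mehlerP u * (dot x x + dot y y) + mehlerQ u * dot x y)).

Let scale_sqr : (l `^ (n%:R / 4)) * (l `^ (n%:R / 4)) = kappa ^+ n.
Proof.
rewrite -powRD; last by rewrite (gt_eqF l_gt0) implybT.
rewrite /kappa -powR_mulrn ?powR_ge0// -powRrM; congr (_ `^ _).
by field.
Qed.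

Let box_kernelE N u x y : box_kernel N u x y =
  kappa ^+ n * \prod_(j < n) \sum_(k < N)
    u ^+ k * (hermite_fun k (kappa * x 0 j) * hermite_fun k (kappa * y 0 j)).
Proof.
rewrite -(box_sum_prod N u (fun j k =>
  hermite_fun k (kappa * x 0 j) * hermite_fun k (kappa * y 0 j))).
rewrite mulr_sumr; apply: eq_bigr => f _.
rewrite /scaled_hermite mulrACA scale_sqr [LHS]mulrCA; congr (_ * (_ * _)).
rewrite [RHS]big_split/= /hermite_multi.
by congr (_ * _); apply: eq_bigr => j _; rewrite !mxE ffunE.
Qed.

Let dotD_sqr x y : dot x x + dot y y = \sum_(j < n) (x 0 j ^+ 2 + y 0 j ^+ 2).
Proof.
by rewrite big_split/= /dot; congr (_ + _); apply: eq_bigr => j _; rewrite expr2.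
Qed.

Let mehler_kernelE u x y : 0 <= u < 1 -> mehler_kernel u x y =
  kappa ^+ n * \prod_(j < n) mehler u (kappa * x 0 j) (kappa * y 0 j).
Proof.
move=> u01; have /andP[u0 u1] := u01.
under eq_bigr do rewrite mehlerE//.
rewrite big_split/= -expR_sum prodr_const card_ord mulrA -exprMn.
rewrite /mehler_kernel; congr (_ ^+ _ * expR _).
  rewrite (sqrtrM _ (ltW l_gt0)) sqrtrV; last first.
    by rewrite mulr_ge0 ?pi_ge0// subr_ge0 expr_le1// ltW.
  by rewrite /kappa powR12_sqrt ?ltW.
rewrite dotD_sqr [RHS]big_split/= -!mulr_sumr mulrDr; congr (_ + _).
  rewrite mulrCA; congr (_ * _); rewrite mulr_sumr; apply: eq_bigr => j _.
  by rewrite !exprMn kappa_sqr; ring.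
rewrite mulrCA; congr (_ * _); rewrite /dot mulr_sumr; apply: eq_bigr => j _.
by rewrite -kappa_sqr; ring.
Qed.

Lemma cvg_box_kernel u x y : 0 <= u < 1 ->
  box_kernel N u x y @[N --> \oo] --> mehler_kernel u x y.
Proof.
move=> u01; rewrite mehler_kernelE//.
under eq_fun do rewrite box_kernelE.
apply: cvgM; first exact: cvg_cst.
apply: cvg_big => [|j _]; first exact: mul_continuous.
exact: cvg_mehler.
Qed.

Lemma box_kernel_bound u : 0 < u < 1 ->
  exists C delta : R, [/\ 0 <= C, 0 < delta & forall N x y,
    `|box_kernel N u x y| <= C * expR (- delta * (dot x x + dot y y))].
Proof.
move=> u01; have /andP[u0 _] := u01.
have [K [delta [K0 d0 bd]]] := mehler_sum_bound u01.
exists (kappa ^+ n * K ^+ n), (delta * l); split.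
- by rewrite mulr_ge0 ?exprn_ge0 ?powR_ge0.
- by rewrite mulr_gt0.
move=> N x y; rewrite box_kernelE normrM ger0_norm ?exprn_ge0 ?powR_ge0//.
rewrite -mulrA ler_wpM2l ?exprn_ge0 ?powR_ge0//.
rewrite normr_prod; apply: (@le_trans _ _ (\prod_(j < n)
    (K * expR (- delta * ((kappa * x 0 j) ^+ 2 + (kappa * y 0 j) ^+ 2))))).
  apply: ler_prod => j _; rewrite normr_ge0/=.
  apply: le_trans (bd N _ _); apply: (le_trans (ler_norm_sum _ _ _)).
  by apply: ler_sum => k _; rewrite normrM (ger0_norm (exprn_ge0 _ (ltW u0))).
rewrite big_split/= prodr_const card_ord -expR_sum.
rewrite (_ : \sum_(j < n) _ = - (delta * l) * (dot x x + dot y y))//.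
rewrite dotD_sqr mulr_sumr; apply: eq_bigr => j _.
by rewrite !exprMn kappa_sqr; ring.
Qed.

End box_sums.

(** * The Gaussian integral behind the trace formula *)

Section dot_algebra.
Context (R : realType) (n : nat).
Implicit Types (x y z : 'rV[R]_n) (c : R).

Lemma dotDl x y z : dot (x + y) z = dot x z + dot y z.
Proof. by rewrite /dot -big_split; apply: eq_bigr => j _; rewrite mxE mulrDl. Qed.

Lemma dotDr x y z : dot z (x + y) = dot z x + dot z y.
Proof. by rewrite dotC dotDl !(dotC _ z). Qed.

Lemma dotZl c x y : dot (c *: x) y = c * dot x y.
Proof. by rewrite /dot mulr_sumr; apply: eq_bigr => j _; rewrite mxE mulrA. Qed.

Lemma dotZr c x y : dot x (c *: y) = c * dot x y.
Proof. by rewrite dotC dotZl dotC. Qed.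

Lemma dotNr x y : dot x (- y) = - dot x y.
Proof. by rewrite dotC dotNl dotC. Qed.

Lemma dot_ge0 x : 0 <= dot x x.
Proof. by rewrite /dot sumr_ge0// => j _; rewrite -expr2 sqr_ge0. Qed.

Definition dotE := (dotDl, dotDr, dotZl, dotZr, dotNl, dotNr).

Lemma has_integral_row_gauss (A : R) : 0 < A ->
  has_integral (lebesgue_row R n) (fun x => expR (- A * dot x x))
    (Num.sqrt (pi / A) ^+ n).
Proof.
move=> A0; have := @has_integral_gauss_row R n A 0 0 0 A0.
have z x : dot 0 x = 0 by rewrite /dot big1// => j _; rewrite mxE mul0r.
apply: has_integral_eq => [x|]; first by rewrite !z !addr0 cos0 mul1r.
by rewrite !z subrr !mul0r addr0 expR0 cos0 !mulr1.
Qed.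

End dot_algebra.

Lemma mehler_kernel_bound (R : realType) n (l u : R) : 0 < l -> 0 < u < 1 ->
  exists C delta : R, [/\ 0 <= C, 0 < delta & forall x y : 'rV[R]_n,
    `|mehler_kernel l u x y| <= C * expR (- delta * (dot x x + dot y y))].
Proof.
move=> l0 u01; have [C [delta [C0 d0 bd]]] := box_kernel_bound n l0 u01.
exists C, delta; split => // x y.
have u01' : 0 <= u < 1 by case/andP: u01 => /ltW ->.
apply: (cvgr_to_le (cvg_norm (@cvg_box_kernel R n l l0 u x y u01'))).
by apply: nearW => N; exact: bd.
Qed.

Lemma measurable_mehler_kernel (R : realType) n (l u : R) d
    (X : measurableType d) (f g : X -> 'rV[R]_n) :
  measurable_fun setT f -> measurable_fun setT g ->
  measurable_fun setT (fun z => mehler_kernel l u (f z) (g z)).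
Proof.
move=> mf mg; apply: measurable_funM => //; apply: measurable_expRT.
apply: measurable_funM => //; apply: measurable_funD.
  apply: measurable_funM => //.
  by apply: measurable_funD; exact: measurable_dot.
by apply: measurable_funM => //; exact: measurable_dot.
Qed.

Lemma measurable_rowD (R : realType) n d (X : measurableType d)
    (f g : X -> 'rV[R]_n) :
  measurable_fun setT f -> measurable_fun setT g ->
  measurable_fun setT (fun z => f z + g z).
Proof.
move=> mf mg; apply: measurable_fun_mxentryP => i j.
under eq_fun do rewrite mxE; apply: measurable_funD.
  exact: (measurableT_comp (measurable_mxentry i j) mf).
exact: (measurableT_comp (measurable_mxentry i j) mg).
Qed.

Section double_gaussian.
Context (R : realType) (n : nat).
Notation nu := (lebesgue_row R n).

Definition phase (lambda : R) (p : heis R n) (xi : 'rV[R]_n) : R :=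
  lambda * (p.2 + dot p.1.1 xi + dot p.1.1 p.1.2 / 2).

(** The product of two matrix coefficients, at [p] and [q], is an integral
    over [(xi, eta)]; summed over the Hermite indices with weights
    [u^|alpha| v^|beta|] its integrand becomes this one. *)
Definition trace_density (lambda u v : R) (p q : heis R n)
    (z : 'rV[R]_n * 'rV[R]_n) : R :=
  cos (phase lambda p z.1 - phase lambda q z.2) *
  (mehler_kernel `|lambda| u (z.1 + p.1.2) (z.2 + q.1.2) *
   mehler_kernel `|lambda| v z.1 z.2).

(** The Gaussian integral of [trace_density]. At [v = 1] it depends on [p]
    and [q] only through [q^-1 p], see [trace_value1]. *)
Definition trace_value (lambda u v : R) (p q : heis R n) : R :=
  let: (x, y, t) := p in let: (x', y', t') := q in
  (1 - u * v) ^- n *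
  expR (- (`|lambda| / 8 / (1 - u * v)) *
    ((1 - u) * (1 - v) * (dot (y + y') (y + y') + dot (x + x') (x + x')) +
     (1 + u) * (1 + v) * (dot (y - y') (y - y') + dot (x - x') (x - x')))) *
  cos (lambda * (t - t' + (dot x y - dot x' y') / 2 -
    ((1 - u) * (1 + v) * dot (x - x') (y + y') +
     (1 + u) * (1 - v) * dot (x + x') (y - y')) / (4 * (1 - u * v)))).

Context (lambda u v : R).
Hypothesis lambda_neq0 : lambda != 0.
Hypothesis u01 : 0 < u < 1.
Hypothesis v01 : 0 < v < 1.

Let l := `|lambda|.
Let l_gt0 : 0 < l. Proof. by rewrite normr_gt0. Qed.
Let lambda2 : lambda ^+ 2 = l ^+ 2. Proof. by rewrite real_normK ?num_real. Qed.

Let Pu := mehlerP u. Let Qu := mehlerQ u.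
Let Pv := mehlerP v. Let Qv := mehlerQ v.

Let u0 : 0 < u. Proof. by case/andP: u01. Qed.
Let u1 : u < 1. Proof. by case/andP: u01. Qed.
Let v0 : 0 < v. Proof. by case/andP: v01. Qed.
Let v1 : v < 1. Proof. by case/andP: v01. Qed.
Let uv1 : u * v < 1. Proof. by rewrite mulr_ilt1 ?ltW. Qed.
Let uv0 : 0 < 1 - u * v. Proof. by rewrite subr_gt0. Qed.
Let uvp : 0 < 1 + u * v. Proof. by rewrite addr_gt0 ?mulr_gt0. Qed.
Let u2 : 0 < 1 - u ^+ 2. Proof. by rewrite subr_gt0 expr_lt1 ?ltW. Qed.
Let v2 : 0 < 1 - v ^+ 2. Proof. by rewrite subr_gt0 expr_lt1 ?ltW. Qed.

Let P : R := (1 + u * v) * (1 - u * v) / ((1 - u ^+ 2) * (1 - v ^+ 2)).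
Let P_gt0 : 0 < P. Proof. by rewrite divr_gt0 ?mulr_gt0. Qed.
Let PE : Pu + Pv = P.
Proof. by rewrite /P /Pu /Pv /mehlerP; field; rewrite !gt_eqF. Qed.
Let r : R := (u + v) / (1 + u * v).
Let QE : Qu + Qv = 2 * P * r.
Proof. by rewrite /P /r /Qu /Qv /mehlerQ; field; rewrite !gt_eqF. Qed.

Variables p q : heis R n.
Let x := p.1.1. Let y := p.1.2. Let t := p.2.
Let x' := q.1.1. Let y' := q.1.2. Let t' := q.2.

Let A := l * P.
Let A_gt0 : 0 < A. Proof. exact: mulr_gt0. Qed.
Let B0 := (- (2 * l * Pu)) *: y' + (l * Qu) *: y.
Let B xi := B0 + (l * (Qu + Qv)) *: xi.
Let b := (- lambda) *: x'.
Let c xi := phase lambda p xi - lambda * (t' + dot x' y' / 2).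
Let s := Num.sqrt (l / (pi * (1 - u ^+ 2))) ^+ n *
         Num.sqrt (l / (pi * (1 - v ^+ 2))) ^+ n.
Let e xi := l * (- Pu * (dot (xi + y) (xi + y) + dot y' y') + Qu * dot (xi + y) y'
  - Pv * dot xi xi).

Let F xi := s * expR (e xi) * (Num.sqrt (pi / A) ^+ n *
  expR ((dot (B xi) (B xi) - dot b b) / (4 * A)) *
  cos (c xi + dot b (B xi) / (2 * A))).

(** The square is completed in [eta] first, and in [xi] below ([outer]). *)
Let inner xi : has_integral nu (fun eta => trace_density lambda u v p q (xi, eta)) (F xi).
Proof.
have := has_integralZ (s * expR (e xi)) (has_integral_gauss_row (c xi) (B xi) b A_gt0).
apply: has_integral_eq => // eta.
rewrite /trace_density /mehler_kernel -/l -/Pu -/Qu -/Pv -/Qv -/x -/y -/x' -/y' /=.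
rewrite [LHS]mulrCA; congr (cos _ * _).
  by rewrite /c /phase /b dotZl -/x -/t -/x' -/t' /=; ring.
rewrite mulrACA -expRD -[LHS]mulrA -expRD; congr (_ * expR _).
rewrite /e /A -PE /B /B0 !dotE (dotC y xi) (dotC eta y').
ring.
Qed.

Let A2 := l * (1 - u * v) / (1 + u * v).
Let A2_gt0 : 0 < A2. Proof. by rewrite divr_gt0 ?mulr_gt0. Qed.
Let B2 := (l * (u - v) / (1 + u * v)) *: y' - (l * (1 - u * v) / (1 + u * v)) *: y.
Let b2 := lambda *: x - (lambda * r) *: x'.
Let c2 := lambda * (t + dot x y / 2) - lambda * (t' + dot x' y' / 2) -
  lambda * dot x' B0 / (2 * A).
Let e2 := l * (- Pu * (dot y y + dot y' y') + Qu * dot y y') +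
  (dot B0 B0 - l ^+ 2 * dot x' x') / (4 * A).

Let outer : has_integral nu F (s * Num.sqrt (pi / A) ^+ n * expR e2 *
  (Num.sqrt (pi / A2) ^+ n * expR ((dot B2 B2 - dot b2 b2) / (4 * A2)) *
   cos (c2 + dot b2 B2 / (2 * A2)))).
Proof.
have := has_integralZ (s * Num.sqrt (pi / A) ^+ n * expR e2)
  (has_integral_gauss_row c2 B2 b2 A2_gt0).
apply: has_integral_eq => // xi.
transitivity (s * Num.sqrt (pi / A) ^+ n *
  (expR (e2 + (- A2 * dot xi xi + dot B2 xi)) * cos (c2 + dot b2 xi))).
  by rewrite (expRD e2); ring.
rewrite /F; transitivity (s * Num.sqrt (pi / A) ^+ n *
  (expR (e xi + (dot (B xi) (B xi) - dot b b) / (4 * A)) *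
   cos (c xi + dot b (B xi) / (2 * A)))); last first.
  by rewrite (expRD (e xi)); ring.
have nz : [/\ l != 0, 1 + u * v != 0, 1 - u * v != 0, 1 - u ^+ 2 != 0 & 1 - v ^+ 2 != 0].
  by rewrite !gt_eqF.
case: nz => l0 n1 n2 n3 n4.
congr (_ * (expR _ * cos _)).
  have bb : dot b b = l ^+ 2 * dot x' x'.
    by rewrite /b !dotE mulrA mulrNN -expr2 lambda2.
  rewrite /e /e2 /A bb /B QE !dotE.
  rewrite (dotC y xi) (dotC y' y) (dotC y' xi).
  move: (dot xi xi) (dot xi y) (dot xi y') (dot y y) (dot y y') (dot y' y')
    (dot x' x') => d1 d2 d3 d4 d5 d6 d7.
  by rewrite /A2 /P /r /Pu /Pv /Qu /mehlerP /mehlerQ; field; rewrite l0 n1 n2 n3 n4.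
rewrite /c /c2 /b /b2 /phase /B QE !dotE -/x -/y -/t /A /r.
by field; rewrite l0 n1 gt_eqF.
Qed.

Let value_eq : s * Num.sqrt (pi / A) ^+ n * expR e2 *
  (Num.sqrt (pi / A2) ^+ n * expR ((dot B2 B2 - dot b2 b2) / (4 * A2)) *
   cos (c2 + dot b2 B2 / (2 * A2))) = trace_value lambda u v p q.
Proof.
have nz : [/\ l != 0, 1 + u * v != 0, 1 - u * v != 0, 1 - u ^+ 2 != 0 & 1 - v ^+ 2 != 0].
  by rewrite !gt_eqF.
case: nz => l0 n1 n2 n3 n4.
transitivity (s * Num.sqrt (pi / A) ^+ n * Num.sqrt (pi / A2) ^+ n *
  expR (e2 + (dot B2 B2 - dot b2 b2) / (4 * A2)) * cos (c2 + dot b2 B2 / (2 * A2))).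
  by rewrite (expRD e2); ring.
rewrite (surjective_pairing p) (surjective_pairing p.1).
rewrite (surjective_pairing q) (surjective_pairing q.1) /trace_value.
rewrite -/x -/y -/t -/x' -/y' -/t' -/l.
congr (_ * expR _ * cos _).
- have pi0 := pi_gt0 R.
  rewrite /s -!exprMn -exprVn; congr (_ ^+ _).
  have k1 : 0 <= l / (pi * (1 - u ^+ 2)) by rewrite ltW// divr_gt0 ?mulr_gt0.
  have k2 : 0 <= l / (pi * (1 - v ^+ 2)) by rewrite ltW// divr_gt0 ?mulr_gt0.
  have k3 : 0 <= pi / A by rewrite ltW// divr_gt0.
  rewrite -(sqrtrM _ k1) -(sqrtrM _ (mulr_ge0 k1 k2)).
  rewrite -(sqrtrM _ (mulr_ge0 (mulr_ge0 k1 k2) k3)).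
  rewrite (_ : _ * _ = ((1 - u * v)^-1) ^+ 2).
    by rewrite sqrtr_sqr ger0_norm// invr_ge0 ltW.
  move: (pi : R) pi0 {k1 k2 k3} => w w0; rewrite /A /A2 /P; field.
  by rewrite n1 n2 n3 n4 l0 gt_eqF.
- have bb : dot b2 b2 = l ^+ 2 * (dot x x - 2 * r * dot x x' + r ^+ 2 * dot x' x').
    by rewrite /b2 !dotE (dotC x' x) -lambda2; ring.
  rewrite bb /e2 /B0 /B2 !dotE (dotC y' y) (dotC x' x).
  move: (dot x x) (dot x x') (dot x' x') (dot y y) (dot y y') (dot y' y') => d1 d2 d3 d4 d5 d6.
  by rewrite /A /A2 /P /r /Pu /Qu /mehlerP /mehlerQ; field; rewrite l0 n1 n2 n3 n4.
rewrite /c2 /B0 /b2 /B2 !dotE /A /A2 /P /r /Pu /Qu /mehlerP /mehlerQ.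
move: (dot x y) (dot x y') (dot x' y) (dot x' y') => d1 d2 d3 d4.
by field; rewrite l0 n1 n2 n3 n4.
Qed.

Lemma has_integral_trace_density :
  has_integral (nu \x nu)%E (trace_density lambda u v p q)
    (trace_value lambda u v p q).
Proof.
have [C1 [d1 [C10 d10 bd1]]] := mehler_kernel_bound n l_gt0 u01.
have [C2 [d2 [C20 d20 bd2]]] := mehler_kernel_bound n l_gt0 v01.
have hg := has_integral_row_gauss n d20.
pose g (z : 'rV[R]_n * 'rV[R]_n) :=
  (C1 * C2) * (expR (- d2 * dot z.1 z.1) * expR (- d2 * dot z.2 z.2)).
have mtr : measurable_fun setT (trace_density lambda u v p q).
  have m1 := @measurable_fst _ _ 'rV[R]_n 'rV[R]_n.
  have m2 := @measurable_snd _ _ 'rV[R]_n 'rV[R]_n.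
  apply: measurable_funM.
    apply: measurable_cosT; apply: measurable_funB; apply: measurable_funM => //.
      by do 2 (apply: measurable_funD => //); exact: measurable_dot.
    by do 2 (apply: measurable_funD => //); exact: measurable_dot.
  apply: measurable_funM; apply: measurable_mehler_kernel => //.
    by apply: measurable_rowD.
  by apply: measurable_rowD.
have mg : measurable_fun setT g.
  apply: measurable_funM => //.
  by apply: measurable_funM; apply: measurable_expRT; apply: measurable_funM => //;
    apply: measurable_dot.
have dom z : `|trace_density lambda u v p q z| <= g z.
  rewrite /trace_density 2!normrM (le_trans (ler_piMl _ _))//.
    by rewrite ler_norml cos_geN1 cos_le1.
  rewrite /g -mulrA; apply: ler_pM => //.
    apply: le_trans (bd1 _ _) _; rewrite ler_piMr// -[leRHS]expR0 ler_expR mulNr oppr_le0.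
    by rewrite mulr_ge0 ?(ltW d10)// addr_ge0 ?dot_ge0.
  by apply: le_trans (bd2 _ _) _; rewrite -expRD mulrDr.
have secg a : has_integral nu (fun b0 => g (a, b0))
    (C1 * C2 * Num.sqrt (pi / d2) ^+ n * expR (- d2 * dot a a)).
  have := has_integralZ (C1 * C2 * expR (- d2 * dot a a)) hg.
  by apply: has_integral_eq => [b0|]; rewrite /g/=; ring.
have [+ hF] := @has_integral_prod _ _ _ _ R nu nu (trace_density lambda u v p q)
  g F _ _ mtr mg dom secg (has_integralZ _ hg) inner.
by rewrite (has_integral_unique hF outer) value_eq.
Qed.

End double_gaussian.

(** * The trace formula for the Fourier transform of a measure *)

Lemma measurable_fun_Rintegral d1 d2 (X : measurableType d1)
    (Y : measurableType d2) (R : realType)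
    (m : {sigma_finite_measure set Y -> \bar R}) (f : X * Y -> R) :
  measurable_fun setT f ->
  measurable_fun setT (fun x => \int[m]_y f (x, y)).
Proof.
move=> mf; have mfE : measurable_fun setT (EFin \o f) by exact/measurable_EFinP.
have H (g : X * Y -> \bar R) : measurable_fun setT g -> (forall z, 0 <= g z)%E ->
    measurable_fun setT (fun x => \int[m]_y g (x, y))%E.
  by move=> mg g0; exact: measurable_fun_fubini_tonelli_F.
have Hp := H _ (measurable_funepos mfE) (funepos_ge0 _).
have Hn := H _ (measurable_funeneg mfE) (funeneg_ge0 _).
have Hpn := emeasurable_funB Hp Hn.
have mfine : measurable_fun [set: \bar R] (@fine R) by exact: fine_measurable.
have := measurableT_comp mfine Hpn.
rewrite (_ : fine \o _ = fun x => \int[m]_y f (x, y))//.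
apply/funext => x; rewrite /Rintegral/= [in RHS]integralE.
congr (fine (_ - _)%E); apply: eq_integral => y _.
  by rewrite !funeposE.
by rewrite !funenegE.
Qed.

Lemma scaled_hermite_bound (R : realType) n (l : R) (alpha : multi_index n) :
  0 < l -> exists C delta : R, [/\ 0 <= C, 0 < delta &
    forall x : 'rV[R]_n, `|scaled_hermite l alpha x| <= C * expR (- delta * dot x x)].
Proof.
move=> l0; have [|K [delta [K0 d0 bd]]] := @hermite_fun_bound R 2^-1.
  by lra.
exists (l `^ (n%:R / 4) * \prod_(j < n) (2 ^+ alpha j * K)), (delta * l); split.
- by rewrite mulr_ge0 ?powR_ge0// prodr_ge0// => j _; rewrite mulr_ge0 ?exprn_ge0.
- exact: mulr_gt0.
move=> x; rewrite /scaled_hermite normrM ger0_norm ?powR_ge0// -mulrA.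
rewrite ler_wpM2l ?powR_ge0// /hermite_multi normr_prod.
rewrite /dot mulr_sumr expR_sum -big_split/=; apply: ler_prod => j _.
rewrite normr_ge0/= !mxE; have := bd (alpha j) (l `^ 2^-1 * x 0 j).
rewrite exprVn ler_pdivrMl ?exprn_gt0// => /le_trans-> //.
rewrite mulrA (_ : - (delta * l) * _ = - delta * (l `^ 2^-1 * x 0 j) ^+ 2)//.
by rewrite exprMn powR12_sqrt ?ltW// sqr_sqrtr ?ltW//; ring.
Qed.

Lemma measurable_sinT (R : realType) d (X : measurableType d) (f : X -> R) :
  measurable_fun setT f -> measurable_fun setT (fun x => sin (f x)).
Proof.
move=> mf; apply: (measurableT_comp (f := sin)) => //.
by apply: continuous_measurable_fun; exact: continuous_sin.
Qed.

Section coefficient_integrands.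
Context (R : realType) (n : nat).
Notation nu := (lebesgue_row R n).
Implicit Types (lambda : R) (alpha beta : multi_index n) (p : heis R n).

Definition amplitude lambda alpha beta p (xi : 'rV[R]_n) : R :=
  scaled_hermite `|lambda| alpha (xi + p.1.2) * scaled_hermite `|lambda| beta xi.

Definition cos_coef lambda alpha beta p : R :=
  \int[nu]_xi (cos (phase lambda p xi) * amplitude lambda alpha beta p xi).

Definition sin_coef lambda alpha beta p : R :=
  \int[nu]_xi (sin (phase lambda p xi) * amplitude lambda alpha beta p xi).

Lemma measurable_amplitude d (X : measurableType d) alpha beta
    (l : X -> R) (f : X -> heis R n) (g : X -> 'rV[R]_n) :
  measurable_fun setT l -> measurable_fun setT f -> measurable_fun setT g ->
  measurable_fun setT (fun w => amplitude (l w) alpha beta (f w) (g w)).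
Proof.
move=> ml mf mg; have ml' : measurable_fun setT (fun w => `|l w|).
  exact: measurableT_comp.
apply: measurable_funM; last exact: measurable_scaled_hermite.
apply: measurable_scaled_hermite => //; apply: measurable_rowD => //.
exact: (measurableT_comp measurable_snd (measurableT_comp measurable_fst mf)).
Qed.

Lemma measurable_phase d (X : measurableType d)
    (l : X -> R) (f : X -> heis R n) (g : X -> 'rV[R]_n) :
  measurable_fun setT l -> measurable_fun setT f -> measurable_fun setT g ->
  measurable_fun setT (fun w => phase (l w) (f w) (g w)).
Proof.
move=> ml mf mg.
have m1 := measurableT_comp measurable_fst (measurableT_comp measurable_fst mf).
have m2 := measurableT_comp measurable_snd (measurableT_comp measurable_fst mf).
have m3 := measurableT_comp measurable_snd mf.
apply: measurable_funM => //; apply: measurable_funD.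
  by apply: measurable_funD => //; apply: measurable_dot.
by apply: measurable_funM => //; apply: measurable_dot.
Qed.

Lemma measurable_cos_coef d (X : measurableType d) alpha beta
    (l : X -> R) (f : X -> heis R n) :
  measurable_fun setT l -> measurable_fun setT f ->
  measurable_fun setT (fun w => cos_coef (l w) alpha beta (f w)).
Proof.
move=> ml mf; apply: (@measurable_fun_Rintegral _ _ _ _ R nu
  (fun z : X * 'rV[R]_n => cos (phase (l z.1) (f z.1) z.2) *
     amplitude (l z.1) alpha beta (f z.1) z.2)).
have ml1 := measurableT_comp ml (@measurable_fst _ _ X 'rV[R]_n).
have mf1 := measurableT_comp mf (@measurable_fst _ _ X 'rV[R]_n).
apply: measurable_funM; last first.
  by apply: (measurable_amplitude _ _ ml1 mf1).
by apply: measurable_cosT; apply: (measurable_phase ml1 mf1).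
Qed.

Lemma measurable_sin_coef d (X : measurableType d) alpha beta
    (l : X -> R) (f : X -> heis R n) :
  measurable_fun setT l -> measurable_fun setT f ->
  measurable_fun setT (fun w => sin_coef (l w) alpha beta (f w)).
Proof.
move=> ml mf; apply: (@measurable_fun_Rintegral _ _ _ _ R nu
  (fun z : X * 'rV[R]_n => sin (phase (l z.1) (f z.1) z.2) *
     amplitude (l z.1) alpha beta (f z.1) z.2)).
have ml1 := measurableT_comp ml (@measurable_fst _ _ X 'rV[R]_n).
have mf1 := measurableT_comp mf (@measurable_fst _ _ X 'rV[R]_n).
apply: measurable_funM; last first.
  by apply: (measurable_amplitude _ _ ml1 mf1).
by apply: measurable_sinT; apply: (measurable_phase ml1 mf1).
Qed.

Lemma Re_L2inner lambda alpha beta p :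
  complex.Re (L2inner (schrodinger lambda p (hermite_scaled alpha lambda))
    (hermite_scaled beta lambda)) = cos_coef lambda alpha beta p.
Proof.
case: p => [[x y] t]; rewrite /L2inner /Cintegral /cos_coef /=.
apply: eq_Rintegral => xi _.
rewrite /hermite_scaled /cexpi /amplitude /scaled_hermite /phase/=.
by rewrite !(mulr0, mul0r, addr0, subr0, oppr0) mulrA.
Qed.

Lemma Im_L2inner lambda alpha beta p :
  complex.Im (L2inner (schrodinger lambda p (hermite_scaled alpha lambda))
    (hermite_scaled beta lambda)) = sin_coef lambda alpha beta p.
Proof.
case: p => [[x y] t]; rewrite /L2inner /Cintegral /sin_coef /=.
apply: eq_Rintegral => xi _.
rewrite /hermite_scaled /cexpi /amplitude /scaled_hermite /phase/=.
by rewrite !(mulr0, mul0r, addr0, add0r, subr0, oppr0) mulrA.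
Qed.

Lemma cmod_sqr (z : R[i]) : cmod z ^+ 2 = complex.Re z ^+ 2 + complex.Im z ^+ 2.
Proof.
case: z => a b; rewrite /cmod normc_def/= sqr_sqrtr// addr_ge0 ?sqr_ge0//.
Qed.

Lemma cmod_fourier_sqr (mu : {measure set (heis R n) -> \bar R}) lambda alpha beta :
  cmod (fourier mu alpha beta lambda) ^+ 2 =
  (\int[mu]_p cos_coef lambda alpha beta p) ^+ 2 +
  (\int[mu]_p sin_coef lambda alpha beta p) ^+ 2.
Proof.
rewrite cmod_sqr; congr (_ ^+ 2 + _ ^+ 2); apply: eq_Rintegral => p _.
  by rewrite Re_L2inner.
by rewrite Im_L2inner.
Qed.

Lemma measurable_cmod_fourier_sqr
    (mu : {finite_measure set (heis R n) -> \bar R}) alpha beta :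
  measurable_fun setT (fun lambda : measurableTypeR R =>
    cmod (fourier mu alpha beta lambda) ^+ 2).
Proof.
under eq_fun do rewrite cmod_fourier_sqr.
apply: measurable_funD; apply: measurable_funX.
- apply: (@measurable_fun_Rintegral _ _ (measurableTypeR R) _ R mu
    (fun z => cos_coef z.1 alpha beta z.2)).
  by apply: measurable_cos_coef.
- apply: (@measurable_fun_Rintegral _ _ (measurableTypeR R) _ R mu
    (fun z => sin_coef z.1 alpha beta z.2)).
  by apply: measurable_sin_coef.
Qed.

End coefficient_integrands.

Section matrix_coefficients.
Context (R : realType) (n : nat).
Notation nu := (lebesgue_row R n).
Context (lambda : R).
Hypothesis lambda_neq0 : lambda != 0.
Let l_gt0 : 0 < `|lambda|. Proof. by rewrite normr_gt0. Qed.
Implicit Types (alpha beta : multi_index n) (p q : heis R n).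

Lemma amplitude_bound alpha beta : exists C delta : R, [/\ 0 <= C, 0 < delta &
  forall p xi, `|amplitude lambda alpha beta p xi| <= C * expR (- delta * dot xi xi)].
Proof.
have [C1 [d1 [C10 d10 bd1]]] := scaled_hermite_bound alpha l_gt0.
have [C2 [d2 [C20 d20 bd2]]] := scaled_hermite_bound beta l_gt0.
exists (C1 * C2), d2; split => //; first exact: mulr_ge0.
move=> p xi; rewrite normrM -mulrA; apply: ler_pM => //.
apply: le_trans (bd1 _) _; rewrite ler_piMr// -[leRHS]expR0 ler_expR mulNr oppr_le0.
by rewrite mulr_ge0 ?dot_ge0// ltW.
Qed.

Lemma coef_integrals alpha beta : exists M : R, forall p,
  [/\ has_integral nu (fun xi => cos (phase lambda p xi) * amplitude lambda alpha beta p xi)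
        (cos_coef lambda alpha beta p),
      has_integral nu (fun xi => sin (phase lambda p xi) * amplitude lambda alpha beta p xi)
        (sin_coef lambda alpha beta p),
      `|cos_coef lambda alpha beta p| <= M & `|sin_coef lambda alpha beta p| <= M].
Proof.
have [C [delta [C0 d0 bd]]] := amplitude_bound alpha beta.
have hg := has_integralZ C (has_integral_row_gauss n d0).
exists (C * Num.sqrt (pi / delta) ^+ n) => p.
have mp : measurable_fun setT (phase lambda p) by apply: (measurable_phase (l := cst _) (f := cst _)).
have ma : measurable_fun setT (amplitude lambda alpha beta p)
  by apply: (measurable_amplitude _ _ (l := cst _) (f := cst _)).
have b1 xi : `|cos (phase lambda p xi) * amplitude lambda alpha beta p xi| <=
    C * expR (- delta * dot xi xi).
  by rewrite normrM (le_trans (ler_piMl _ _) (bd p xi))// ler_norml cos_geN1 cos_le1.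
have b2 xi : `|sin (phase lambda p xi) * amplitude lambda alpha beta p xi| <=
    C * expR (- delta * dot xi xi).
  by rewrite normrM (le_trans (ler_piMl _ _) (bd p xi))// ler_norml sin_geN1 sin_le1.
have h1 := integrable_has_integral (has_integral_dominated
  (measurable_funM (measurable_cosT mp) ma) b1 hg).
have h2 := integrable_has_integral (has_integral_dominated
  (measurable_funM (measurable_sinT mp) ma) b2 hg).
by split => //; [exact: has_integral_norm_le b1 h1 hg|exact: has_integral_norm_le b2 h2 hg].
Qed.

(** The square of an integral over [mu] is an integral over [mu \x mu]; the
    cosine and sine parts together give [cos (phase p - phase q)]. *)
Lemma fourier_sqr (mu : {finite_measure set (heis R n) -> \bar R}) alpha beta :
  has_integral (mu \x mu)%E
    (fun z => cos_coef lambda alpha beta z.1 * cos_coef lambda alpha beta z.2 +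
              sin_coef lambda alpha beta z.1 * sin_coef lambda alpha beta z.2)
    (cmod (fourier mu alpha beta lambda) ^+ 2).
Proof.
have [M bM] := coef_integrals alpha beta.
have hM := integrable_has_integral (finite_measure_integrable_cst mu M measurableT).
have h1 : has_integral mu (cos_coef lambda alpha beta) (\int[mu]_p cos_coef lambda alpha beta p).
  apply: integrable_has_integral; apply: has_integral_dominated hM.
    by apply: measurable_cos_coef.
  by move=> p; have [] := bM p.
have h2 : has_integral mu (sin_coef lambda alpha beta) (\int[mu]_p sin_coef lambda alpha beta p).
  apply: integrable_has_integral; apply: has_integral_dominated hM.
    by apply: measurable_sin_coef.
  by move=> p; have [] := bM p.
rewrite cmod_fourier_sqr.
by rewrite !expr2; apply: has_integralD; exact: has_integral_mul.
Qed.

End matrix_coefficients.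

Lemma box_sum_le (R : realType) n N (F : multi_index n -> R) :
  (forall alpha, 0 <= F alpha) ->
  \sum_(f : {ffun 'I_n -> 'I_N}) F (box_index f) <=
  \sum_(f : {ffun 'I_n -> 'I_N.+1}) F (box_index f).
Proof.
move=> F0; pose h (f : {ffun 'I_n -> 'I_N}) : {ffun 'I_n -> 'I_N.+1} :=
  [ffun j => widen_ord (leqnSn N) (f j)].
have h_inj : injective h.
  by move=> f g /ffunP fg; apply/ffunP => j; have := fg j; rewrite !ffunE => -[/val_inj].
rewrite (eq_bigr (fun f => F (box_index (h f)))); last first.
  by move=> f _; congr F; apply/ffunP => j; rewrite !ffunE.
rewrite -(big_imset (fun g => F (box_index g)) (in2W h_inj))/=.
rewrite [leLHS]big_mkcond/=; apply: ler_sum => g _.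
by case: ifP.
Qed.

Lemma box_sum2_le (R : realType) n N (F : multi_index n -> multi_index n -> R) :
  (forall alpha beta, 0 <= F alpha beta) ->
  \sum_(f : {ffun 'I_n -> 'I_N}) \sum_(g : {ffun 'I_n -> 'I_N})
    F (box_index f) (box_index g) <=
  \sum_(f : {ffun 'I_n -> 'I_N.+1}) \sum_(g : {ffun 'I_n -> 'I_N.+1})
    F (box_index f) (box_index g).
Proof.
move=> F0; apply: (@le_trans _ _ (\sum_(f : {ffun 'I_n -> 'I_N})
    \sum_(g : {ffun 'I_n -> 'I_N.+1}) F (box_index f) (box_index g))).
  by apply: ler_sum => f _; exact: box_sum_le.
apply: (@box_sum_le _ _ _ (fun alpha => \sum_g F alpha (box_index g))) => alpha.
by apply: sumr_ge0 => g _.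
Qed.

Section trace_formula.
Context (R : realType) (n : nat).
Notation nu := (lebesgue_row R n).
Context (lambda : R).
Hypothesis lambda_neq0 : lambda != 0.
Let l_gt0 : 0 < `|lambda|. Proof. by rewrite normr_gt0. Qed.
Implicit Types (p q : heis R n) (z : heis R n * heis R n).

Let coef_pair (alpha beta : multi_index n) z : R :=
  cos_coef lambda alpha beta z.1 * cos_coef lambda alpha beta z.2 +
  sin_coef lambda alpha beta z.1 * sin_coef lambda alpha beta z.2.

Let coef_pair_integral alpha beta z : has_integral (nu \x nu)%E
  (fun w => cos (phase lambda z.1 w.1 - phase lambda z.2 w.2) *
    (amplitude lambda alpha beta z.1 w.1 * amplitude lambda alpha beta z.2 w.2))
  (coef_pair alpha beta z).
Proof.
have [M bM] := coef_integrals lambda_neq0 alpha beta.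
have [c1 s1 _ _] := bM z.1; have [c2 s2 _ _] := bM z.2.
have := has_integralD (has_integral_mul c1 c2) (has_integral_mul s1 s2).
by apply: has_integral_eq => // w; rewrite cosB; ring.
Qed.

(** The kernel on pairs of points whose integral against [mu \x mu] is
    [weighted_box_sum]. *)
Let D u v N z : R :=
  \sum_(f : {ffun 'I_n -> 'I_N}) \sum_(g : {ffun 'I_n -> 'I_N})
    u ^+ mi_abs (box_index f) * v ^+ mi_abs (box_index g) *
    coef_pair (box_index f) (box_index g) z.

Let box_density u v N z (w : 'rV[R]_n * 'rV[R]_n) : R :=
  cos (phase lambda z.1 w.1 - phase lambda z.2 w.2) *
  (box_kernel `|lambda| N u (w.1 + z.1.1.2) (w.2 + z.2.1.2) *
   box_kernel `|lambda| N v w.1 w.2).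

Let D_integral u v N z : has_integral (nu \x nu)%E (box_density u v N z) (D u v N z).
Proof.
have := has_integral_sum (index_enum {ffun 'I_n -> 'I_N}) (fun f =>
  has_integral_sum (index_enum {ffun 'I_n -> 'I_N}) (fun g =>
    has_integralZ (u ^+ mi_abs (box_index f) * v ^+ mi_abs (box_index g))
      (coef_pair_integral (box_index f) (box_index g) z))).
apply: has_integral_eq => // w.
rewrite /box_density /box_kernel big_distrlr/= mulr_sumr; apply: eq_bigr => f _.
rewrite mulr_sumr; apply: eq_bigr => g _.
rewrite /amplitude.
by move: (u ^+ _) (v ^+ _) => a b; ring.
Qed.

Let D_limit u v : 0 < u < 1 -> 0 < v < 1 ->
  (exists M : R, forall N z, `|D u v N z| <= M) /\
  (forall z, D u v N z @[N --> \oo] --> trace_value lambda u v z.1 z.2).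
Proof.
move=> u01 v01.
have u01' : 0 <= u < 1 by case/andP: u01 => /ltW ->.
have v01' : 0 <= v < 1 by case/andP: v01 => /ltW ->.
have [C1 [d1 [C10 d10 bd1]]] := box_kernel_bound n l_gt0 u01.
have [C2 [d2 [C20 d20 bd2]]] := box_kernel_bound n l_gt0 v01.
have hg := has_integral_row_gauss n d20.
have hgg := has_integralZ (C1 * C2) (has_integral_mul hg hg).
have dom N z w : `|box_density u v N z w| <=
    C1 * C2 * (expR (- d2 * dot w.1 w.1) * expR (- d2 * dot w.2 w.2)).
  rewrite /box_density 2!normrM (le_trans (ler_piMl _ _))//.
    by rewrite ler_norml cos_geN1 cos_le1.
  rewrite -mulrA; apply: ler_pM => //.
    apply: le_trans (bd1 _ _ _) _.
    rewrite ler_piMr// -[leRHS]expR0 ler_expR mulNr oppr_le0.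
    by rewrite mulr_ge0 ?(ltW d10)// addr_ge0 ?dot_ge0.
  by apply: le_trans (bd2 _ _ _) _; rewrite -expRD mulrDr.
split.
  eexists => N z; exact: has_integral_norm_le (dom N z) (D_integral u v N z) hgg.
move=> [p q].
have ptw w : box_density u v N (p, q) w @[N --> \oo] --> trace_density lambda u v p q w.
  apply: cvgM; first exact: cvg_cst.
  by apply: cvgM; exact: cvg_box_kernel.
have [h1 cv] := has_integral_cvg (fun N => D_integral u v N (p, q)) hgg
  (fun N => dom N (p, q)) ptw.
by rewrite (has_integral_unique h1
  (has_integral_trace_density lambda_neq0 u01 v01 p q)) in cv.
Qed.

Variable mu : {finite_measure set (heis R n) -> \bar R}.

Definition weighted_box_sum u v N : R :=
  \sum_(f : {ffun 'I_n -> 'I_N}) \sum_(g : {ffun 'I_n -> 'I_N})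
    u ^+ mi_abs (box_index f) * v ^+ mi_abs (box_index g) *
    cmod (fourier mu (box_index f) (box_index g) lambda) ^+ 2.

Lemma has_integral_cst_prod M :
  has_integral (mu \x mu)%E (fun=> M) (\int[(mu \x mu)%E]_z M).
Proof.
apply: integrable_has_integral.
have h := has_integral_mul
  (integrable_has_integral (finite_measure_integrable_cst mu M measurableT))
  (integrable_has_integral (finite_measure_integrable_cst mu 1 measurableT)).
by have := h.1; apply: eq_integrable => // z _; rewrite /= mulr1.
Qed.

Let cvg_weighted_box_sum u v : 0 < u < 1 -> 0 < v < 1 ->
  has_integral (mu \x mu)%E (fun z => trace_value lambda u v z.1 z.2)
    (\int[(mu \x mu)%E]_z trace_value lambda u v z.1 z.2) /\
  weighted_box_sum u v N @[N --> \oo] -->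
    \int[(mu \x mu)%E]_z trace_value lambda u v z.1 z.2.
Proof.
move=> u01 v01; have [[M bM] Dl] := D_limit u01 v01.
have hD N : has_integral (mu \x mu)%E (D u v N) (weighted_box_sum u v N).
  apply: (has_integral_sum (index_enum {ffun 'I_n -> 'I_N}) (fun f =>
    has_integral_sum (index_enum {ffun 'I_n -> 'I_N}) (fun g =>
    has_integralZ (u ^+ mi_abs (box_index f) * v ^+ mi_abs (box_index g))
      (fourier_sqr lambda_neq0 mu (box_index f) (box_index g))))).
exact: has_integral_cvg hD (has_integral_cst_prod M) bM Dl.
Qed.

(** The bound is uniform in [v], for the limit [v -> 1]. *)
Lemma trace_value_bound u v p q : 0 < u < 1 -> 0 < v < 1 ->
  `|trace_value lambda u v p q| <= (1 - u) ^- n.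
Proof.
move=> /andP[u0 u1] /andP[v0 v1]; case: p => -[x y] t; case: q => -[x' y'] t'.
have uv : 1 - u <= 1 - u * v by rewrite lerB// ler_piMr// ltW.
have u1' : 0 < 1 - u by rewrite subr_gt0.
have uv' : 0 < 1 - u * v by exact: lt_le_trans uv.
rewrite /trace_value normrM (le_trans (ler_piMr _ _))//.
  by rewrite ler_norml cos_geN1 cos_le1.
rewrite normrM ger0_norm ?invr_ge0 ?exprn_ge0 ?(ltW uv')// (ger0_norm (expR_ge0 _)).
apply: (@le_trans _ _ ((1 - u * v) ^- n)).
  rewrite ler_piMr ?invr_ge0 ?exprn_ge0 ?(ltW uv')// -[leRHS]expR0 ler_expR.
  rewrite mulNr oppr_le0 mulr_ge0 ?divr_ge0 ?(ltW uv')//.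
  have a1 : 0 <= (1 - u) * (1 - v) by rewrite mulr_ge0 ?subr_ge0 ?ltW.
  have a2 : 0 <= (1 + u) * (1 + v) by rewrite mulr_ge0 ?addr_ge0 ?ltW.
  by rewrite addr_ge0// mulr_ge0// addr_ge0 ?dot_ge0.
by rewrite lef_pV2 ?posrE ?exprn_gt0// lerXn2r ?nnegrE ?(ltW u1') ?(ltW uv').
Qed.

(** Left multiplication by [q^-1] as seen by the vertical coordinate and by the
    horizontal distance. *)
Definition vertical p q : R := (heis_mul (heis_inv q) p).2.

Definition hdist2 p q : R :=
  let w := (heis_mul (heis_inv q) p).1 in dot w.1 w.1 + dot w.2 w.2.

Lemma trace_value1 u p q : u < 1 -> trace_value lambda u 1 p q =
  (1 - u) ^- n *
  expR (- (`|lambda| * (1 + u) / (1 - u) / 4) * hdist2 p q) *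
  cos (lambda * vertical p q).
Proof.
move=> u1; case: p => -[x y] t; case: q => -[x' y'] t'.
have u1' : 1 - u != 0 by rewrite subr_eq0 eq_sym lt_eqF.
rewrite /trace_value mulr1 /hdist2 /vertical /heis_mul /heis_inv /omega/=.
congr (_ * expR _ * cos _).
  rewrite !dotE (dotC x x') (dotC y y').
  move: (dot x x) (dot x' x) (dot x' x') (dot y y) (dot y' y) (dot y' y') => d1 d2 d3 d4 d5 d6.
  by field; rewrite u1'.
rewrite !dotE ?(dotC y' x) ?(dotC y' x') ?(dotC y x').
move: (dot x y) (dot x' y) (dot x y') (dot x' y') => d1 d2 d3 d4.
by field; rewrite u1'.
Qed.

Let vseq (m : nat) : R := 1 - harmonic m / 2.

Let vseq01 m : 0 < vseq m < 1.
Proof.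
have h0 : 0 < harmonic m :> R by exact: harmonic_gt0.
have h1 : harmonic m <= 1 :> R by rewrite /= invf_le1 ?ler1n.
by rewrite /vseq; apply/andP; split; lra.
Qed.

Let cvg_vseq : vseq m @[m --> \oo] --> (1 : R).
Proof.
suff : vseq m @[m --> \oo] --> (1 - 0 / 2 : R) by rewrite mul0r subr0.
apply: (@cvgB _ R^o); first exact: cvg_cst.
by apply: cvgM; [exact: cvg_harmonic|exact: cvg_cst].
Qed.

Let cvg_trace_value u p q : u < 1 ->
  trace_value lambda u (vseq m) p q @[m --> \oo] --> trace_value lambda u 1 p q.
Proof.
move=> u1; have u1' : 1 - u != 0 by rewrite subr_eq0 eq_sym lt_eqF.
case: p => -[x y] t; case: q => -[x' y'] t'; rewrite /trace_value.
have cu : 1 - u * vseq m @[m --> \oo] --> (1 - u * 1 : R).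
  by apply: (@cvgB _ R^o); [exact: cvg_cst|apply: cvgM => //; exact: cvg_cst].
have c1 : 1 - vseq m @[m --> \oo] --> (1 - 1 : R).
  by apply: (@cvgB _ R^o) => //; exact: cvg_cst.
have c2 : 1 + vseq m @[m --> \oo] --> (1 + 1 : R).
  by apply: (@cvgD _ R^o) => //; exact: cvg_cst.
have cM (a b : nat -> R) (a0 b0 : R) : a @ \oo --> a0 -> b @ \oo --> b0 ->
    a m * b m @[m --> \oo] --> a0 * b0 by move=> *; exact: cvgM.
have cc (r : R) : (fun=> r) @ \oo --> r by exact: cvg_cst.
have cD (a b : nat -> R) (a0 b0 : R) : a @ \oo --> a0 -> b @ \oo --> b0 ->
    a m + b m @[m --> \oo] --> a0 + b0 by move=> *; exact: (@cvgD _ R^o).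
have cN (a : nat -> R) (a0 : R) : a @ \oo --> a0 ->
    - a m @[m --> \oo] --> - a0 by move=> *; exact: (@cvgN _ R^o).
have nz : 1 - u * 1 != 0 by rewrite mulr1.
have ci : (1 - u * vseq m)^-1 @[m --> \oo] --> (1 - u * 1)^-1 by exact: cvgV.
have cX : (1 - u * vseq m) ^- n @[m --> \oo] --> (1 - u * 1) ^- n.
  by apply: cvgV; [rewrite expf_neq0|apply: (cvg_comp _ (fun r : R => r ^+ n) cu); exact: exprn_continuous].
apply: (cM); [apply: (cM) => //|].
  apply: (cvg_comp _ expR); last exact: continuous_expR.
  apply: (cM) => //; first by apply: (cN); apply: (cM).
  by apply: (cD); apply: (cM) => //; apply: (cM) => //.
apply: (cvg_comp _ cos); last exact: continuous_cos.
apply: (cM) => //; apply: (cD) => //; apply: (cN); apply: (cM).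
  by apply: (cD); apply: (cM) => //; apply: (cM) => //.
by apply: cvgV; [rewrite mulf_neq0|apply: (cM)].
Qed.

(** Letting [v] tend to 1 replaces completeness of the Hermite functions: the
    box sums increase in both [N] and [v], so the two limits commute. *)
Lemma trace_formula u : 0 < u < 1 ->
  has_integral (mu \x mu)%E (fun z => trace_value lambda u 1 z.1 z.2)
    (\int[(mu \x mu)%E]_z trace_value lambda u 1 z.1 z.2) /\
  weighted_box_sum u 1 N @[N --> \oo] -->
    \int[(mu \x mu)%E]_z trace_value lambda u 1 z.1 z.2.
Proof.
move=> u01; have /andP[u0 u1] := u01.
have [h1 cv1] := has_integral_cvg (fun m => (cvg_weighted_box_sum u01 (vseq01 m)).1)
  (has_integral_cst_prod ((1 - u) ^- n))
  (fun m z => trace_value_bound z.1 z.2 u01 (vseq01 m))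
  (fun z => @cvg_trace_value u z.1 z.2 u1).
split => //; set L := \int[_]_z _ in cv1 *.
pose S v N := weighted_box_sum u v N.
have S_nd v : 0 <= v -> nondecreasing_seq (S v).
  move=> v0; have t0 (alpha beta : multi_index n) :
      0 <= u ^+ mi_abs alpha * v ^+ mi_abs beta *
        cmod (fourier mu alpha beta lambda) ^+ 2.
    by rewrite mulr_ge0 ?sqr_ge0// mulr_ge0 ?exprn_ge0 ?(ltW u0).
  apply/nondecreasing_seqP => N.
  exact: (@box_sum2_le R n N (fun alpha beta => u ^+ mi_abs alpha *
    v ^+ mi_abs beta * cmod (fourier mu alpha beta lambda) ^+ 2) t0).
have vge0 m : 0 <= vseq m by case/andP: (vseq01 m) => /ltW.
have S_le1 m N : S (vseq m) N <= S 1 N.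
  apply: ler_sum => f _; apply: ler_sum => g _.
  rewrite ler_wpM2r ?sqr_ge0// ler_wpM2l ?exprn_ge0 ?(ltW u0)//.
  by rewrite expr1n exprn_ile1//; case/andP: (vseq01 m) => _ /ltW.
have S_T m N : S (vseq m) N <= \int[(mu \x mu)%E]_z trace_value lambda u (vseq m) z.1 z.2.
  have [_ cS] := cvg_weighted_box_sum u01 (vseq01 m).
  rewrite -(cvg_lim _ cS)//; apply: nondecreasing_cvgn_le; first exact: S_nd.
  by apply/cvg_ex; eexists; exact: cS.
have S_cvg N : S (vseq m) N @[m --> \oo] --> S 1 N.
  apply: cvg_big => [|f _]; first exact: add_continuous.
  apply: cvg_big => [|g _]; first exact: add_continuous.
  apply: cvgM; last exact: cvg_cst.
  apply: cvgM; first exact: cvg_cst.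
  by apply: (cvg_comp _ (fun r : R => r ^+ _) cvg_vseq); exact: exprn_continuous.
have S_L N : S 1 N <= L.
  by apply: (ler_cvg_to (S_cvg N) cv1); apply: nearW => m; exact: S_T.
have cS1 : cvgn (S 1).
  apply: nondecreasing_is_cvgn; first exact: S_nd.
  by exists L => _ [N _ <-].
(* Both limits are suprema of the same increasing double sequence. *)
suff -> : L = limn (S 1) by [].
apply/eqP; rewrite eq_le; apply/andP; split; last first.
  by apply: limr_le => //; apply: nearW => N; exact: S_L.
apply: (cvgr_to_le cv1); apply: nearW => m.
have [_ cS] := cvg_weighted_box_sum u01 (vseq01 m).
apply: (cvgr_to_le cS); apply: nearW => N.
apply: le_trans (S_le1 m N) _; apply: nondecreasing_cvgn_le => //.
exact: S_nd.
Qed.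

End trace_formula.

(** * The Gamma function *)

Section gamma.
Context (R : realType).
Notation leb := (@lebesgue_measure R).
Implicit Types (a c p : R).

(** The density [p^(a-1)] of the half line, extended by zero, so that all
    integrals are over the whole line. *)
Definition pospow a p : R := if 0 < p then p `^ (a - 1) else 0.

Lemma pospow_ge0 a p : 0 <= pospow a p.
Proof. by rewrite /pospow; case: ifP => // _; exact: powR_ge0. Qed.

Lemma measurable_pospow a : measurable_fun setT (pospow a).
Proof.
rewrite (_ : pospow a = fun p => \1_(`]0, +oo[%classic : set R) p * p `^ (a - 1)).
  by apply: measurable_funM; [exact: measurable_indic|exact: measurable_powR].
apply/funext => p; rewrite /pospow indicE; case: ifPn => p0.
  by rewrite mem_set ?mul1r//= in_itv/= p0.
by rewrite memNset ?mul0r//= in_itv/= andbT; exact/negP.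
Qed.

Lemma powR_add p (b c : R) : 0 < p -> p `^ (b + c) = p `^ b * p `^ c.
Proof. by move=> p0; rewrite powRD// (gt_eqF p0) implybT. Qed.

Lemma powR_mulr p (b : R) : 0 < p -> p * p `^ b = p `^ (b + 1).
Proof. by move=> p0; rewrite powR_add// powRr1 ?ltW// mulrC. Qed.

Lemma pospow_mulX a p : p * pospow a p = pospow (a + 1) p.
Proof.
rewrite /pospow; case: ifPn => p0; last by rewrite mulr0.
by rewrite powR_mulr//; congr (_ `^ _); ring.
Qed.

Lemma continuous_powR_gt0 (b : R) p : 0 < p -> {for p, continuous (fun s : R => s `^ b)}.
Proof.
move=> p0; apply/differentiable_continuous/derivable1_diffP.
by have [] := is_derive1_powR b p0.
Qed.

Lemma is_derive_expR_lin c p :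
  is_derive p (1 : R) (fun s : R => expR (- c * s)) (- c * expR (- c * p)).
Proof.
have d3 : is_derive p (1 : R) (fun s : R => - c * s) (- c).
  by apply: is_derive_eq; rewrite /GRing.scale/= mulr1.
have d := is_derive1_comp (is_derive_expR (- c * p)) d3.
by rewrite mulrC; exact: d.
Qed.

(** Intervals exhausting the open half line, so that powers of [p] with a
    singularity at the origin can be integrated by [has_integral_derivative]. *)
Lemma exhaustion_lt (N : nat) : (N.+2%:R)^-1 < N.+2%:R :> R.
Proof. by rewrite (@lt_trans _ _ 1) ?invf_lt1 ?ltr1n// ltr0n. Qed.

Lemma exhaustion_sub (N : nat) :
  `[(N.+2%:R)^-1, N.+2%:R] `<=` [set p : R | 0 < p].
Proof.
move=> p; rewrite /= in_itv/= => /andP[+ _]; apply: lt_le_trans.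
by rewrite invr_gt0 ltr0n.
Qed.

Lemma exhaustion_near p : 0 < p -> \forall N \near \oo, p \in `[(N.+2%:R)^-1, N.+2%:R].
Proof.
move=> p0; near=> N; rewrite in_itv/=; apply/andP; split.
  rewrite invf_ple ?posrE//; apply: (@le_trans _ _ N%:R); last by rewrite ler_nat ltnW.
  by near: N; exact: nbhs_infty_ger.
apply: (@le_trans _ _ N%:R); last by rewrite ler_nat ltnW.
by near: N; exact: nbhs_infty_ger.
Unshelve. all: by end_near. Qed.

Lemma cvg_inv2 : (N.+2%:R)^-1 @[N --> \oo] --> (0 : R).
Proof.
rewrite (cvg_shiftS (fun n : nat => (n.+1%:R)^-1 : R)).
exact: cvg_harmonic.
Qed.

Lemma cvg_powR_inv2 a : 0 < a -> (N.+2%:R)^-1 `^ a @[N --> \oo] --> (0 : R).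
Proof.
move=> a0; move/cvg_at_rightP : (@powR_cvg0 R a a0); apply.
by split=> [N|]; [rewrite invr_gt0 ltr0n|exact: cvg_inv2].
Qed.

(** [p^(a-1) (1+p)^(-a-1)] is the derivative of [(p/(1+p))^a / a], which is
    bounded: this is the integrability of [p^(a-1)] at the origin. *)
Let dominating a p := pospow a p * (1 + p) `^ (- a - 1).

Let has_integral_dominating a : 0 < a -> has_integral leb (dominating a) a^-1.
Proof.
move=> a0; pose f (p : R) := a^-1 * (p `^ a * (1 + p) `^ (- a)).
have a0' : a != 0 by rewrite gt_eqF.
have df p : 0 < p -> is_derive p 1 f (p `^ (a - 1) * (1 + p) `^ (- a - 1)).
  move=> p0; have p1 : 0 < 1 + p by rewrite addr_gt0.
  have d1 := is_derive1_powR a p0.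
  have d2 := is_derive1_powR (- a) p1.
  have d3 : is_derive p (1 : R) (fun s : R => 1 + s) 1.
    by apply: is_derive_eq; rewrite add0r mulr1.
  have d4 := is_derive1_comp d2 d3.
  apply: is_derive_eq.
  rewrite /GRing.scale/=.
  have -> : p `^ a = p * p `^ (a - 1) by rewrite powR_mulr// subrK.
  have -> : (1 + p) `^ (- a) = (1 + p) * (1 + p) `^ (- a - 1).
    by rewrite powR_mulr// subrK.
  by field.
apply: (@ge0_has_integral_derivative R [set p | 0 < p] (fun N => N.+2%:R^-1)
  (fun N => N.+2%:R) f (fun p => p `^ (a - 1) * (1 + p) `^ (- a - 1))
  _ _ exhaustion_lt exhaustion_sub exhaustion_near df) => //.
- move=> p p0; have p1 : 0 < 1 + p by rewrite addr_gt0.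
  apply: cvgM; first exact: continuous_powR_gt0.
  apply: (cvg_comp (fun s : R => 1 + s) (fun s => s `^ (- a - 1))).
    by apply: (@cvgD _ R^o); [exact: cvg_cst|exact: cvg_id].
  exact: continuous_powR_gt0.
- by move=> p p0; rewrite /dominating /pospow p0.
- by move=> p /negP p0; rewrite /dominating /pospow (negbTE p0) mul0r.
- have c1 : 1 + (N.+2%:R)^-1 @[N --> \oo] --> (1 + 0 : R).
    by apply: (@cvgD _ R^o); [exact: cvg_cst|exact: cvg_inv2].
  have c2 : (1 + (N.+2%:R)^-1) `^ (- a) @[N --> \oo] --> (1 : R).
    have := cvg_comp _ _ c1 (@continuous_powR_gt0 (- a) (1 + 0) _).
    by rewrite addr0 powR1; apply.
  have fb N : f N.+2%:R = a^-1 * (1 + (N.+2%:R)^-1) `^ (- a).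
    have N0 : (0 : R) < N.+2%:R by rewrite ltr0n.
    rewrite /f (_ : 1 + N.+2%:R = N.+2%:R * (1 + (N.+2%:R)^-1)); last first.
      by rewrite mulrDr mulr1 divff ?gt_eqF// addrC.
    rewrite powRM ?ltW ?addr_gt0 ?invr_gt0// (mulrA (_ `^ a)) -powR_add//.
    by rewrite subrr powRr0 mul1r.
  under eq_fun do rewrite fb.
  have cA : a^-1 * (1 + (N.+2%:R)^-1) `^ (- a) @[N --> \oo] --> (a^-1 * 1 : R).
    by apply: cvgM; [exact: cvg_cst|exact: c2].
  have cB : f (N.+2%:R)^-1 @[N --> \oo] --> (a^-1 * (0 * 1) : R).
    apply: cvgM; first exact: cvg_cst.
    by apply: cvgM; [exact: cvg_powR_inv2|exact: c2].
  by have := cvgB cA cB; rewrite mul0r mulr0 subr0 mulr1; apply.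
- by move=> p; rewrite mulr_ge0 ?pospow_ge0 ?powR_ge0.
Qed.

(** Exponential decay dominates the power that [has_integral_dominating]
    needs at infinity. *)
Lemma expRN_le a : 0 < a -> exists2 C : R, 0 <= C &
  forall p, 0 < p -> expR (- p) <= C * (1 + p) `^ (- a - 1).
Proof.
move=> a0; pose m := Num.truncn (a + 1).
have am : a + 1 <= m.+1%:R by rewrite ltW// truncnS_gt.
exists (expR 1 * m.+1`!%:R); first by rewrite mulr_ge0 ?expR_ge0.
move=> p p0; have p1 : 0 < 1 + p by rewrite addr_gt0.
have p1' : 1 <= 1 + p by rewrite lerDl ltW.
rewrite (_ : - a - 1 = - (a + 1)); last by ring.
rewrite powRN ler_pdivlMr ?powR_gt0//.
apply: (@le_trans _ _ (expR (- p) * (1 + p) ^+ m.+1)).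
  by rewrite ler_wpM2l ?expR_ge0// -powR_mulrn ?(ltW p1)// ler_powR.
have := expR_ge1Dxn m (ltW p1) => H.
have {}H : (1 + p) ^+ m.+1 / m.+1`!%:R <= expR (1 + p).
  by apply: le_trans H; rewrite lerDr.
rewrite ler_pdivrMr ?ltr0n ?fact_gt0// in H.
apply: (le_trans (ler_wpM2l (expR_ge0 _) H)).
by rewrite mulrA -expRD (_ : - p + (1 + p) = 1)//; ring.
Qed.

Lemma integrable_gamma a : 0 < a ->
  leb.-integrable setT (EFin \o (fun p => pospow a p * expR (- p))).
Proof.
move=> a0; have [C C0 bd] := expRN_le a0.
apply: (@has_integral_dominated _ _ _ leb _ _ _ _ _
  (has_integralZ C (has_integral_dominating a0))).
  apply: measurable_funM; first exact: measurable_pospow.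
  by apply: measurable_expRT; exact: measurable_funN.
move=> p; rewrite ger0_norm ?mulr_ge0 ?pospow_ge0 ?expR_ge0// /dominating mulrCA.
have [p0|p0] := ltP 0 p; first by rewrite ler_wpM2l ?pospow_ge0//; exact: bd.
by rewrite /pospow ltNge p0/= !mul0r.
Qed.

Lemma has_integral_gamma a : 0 < a ->
  has_integral leb (fun p => pospow a p * expR (- p)) (Gamma a).
Proof.
move=> a0; have := integrable_has_integral (integrable_gamma a0).
rewrite (_ : \int[_]_p _ = Gamma a)//.
rewrite /Gamma [RHS]Rintegral_mkcond; apply: eq_Rintegral => p _.
rewrite patchE /pospow; case: ifPn => p0.
  by rewrite mem_set//= in_itv/= p0.
by rewrite memNset ?mul0r//= in_itv/= andbT; exact/negP.
Qed.

Lemma Gamma_gt0 a : 0 < a -> 0 < Gamma a.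
Proof.
move=> a0; have h := has_integral_gamma a0.
(* [C] is a lower bound for the integrand on [1, 2]. *)
pose K := `[1, 2]%classic : set R.
pose C := expR (- (`|a - 1| * ln 2)) * expR (- 2).
have C0 : 0 < C by rewrite mulr_gt0 ?expR_gt0.
suff : C <= Gamma a by exact: lt_le_trans.
have h1 : has_integral leb (fun p => C * \1_K p) (C * 1).
  apply: has_integralZ; apply: has_integral_ge0 => //.
    by apply: measurable_indic; exact: measurable_itv.
  have mK : measurable (K : set (measurableTypeR R)) by exact: measurable_itv.
  rewrite (integral_indic lebesgue_measure measurableT mK) setIT.
  transitivity (@lebesgue_measure R `[1, 2]%classic) => //.
  rewrite lebesgue_measure_itv/= lte_fin ltr1n.
  by rewrite -EFinB; congr EFin; ring.
rewrite -[C]mulr1; apply: has_integral_le h1 h => p.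
rewrite indicE; have [pK|pK] := boolP (p \in K); last first.
  by rewrite mulr0 mulr_ge0 ?pospow_ge0 ?expR_ge0.
move: pK; rewrite inE /K/= in_itv/= => /andP[p1 p2]; rewrite mulr1.
have p0 : 0 < p by exact: lt_le_trans p1.
rewrite /pospow p0; apply: ler_pM; rewrite ?expR_ge0 ?ler_expR ?lerN2//.
rewrite /powR gt_eqF// ler_expR lerNl -mulNr.
apply: (@le_trans _ _ (`|a - 1| * ln p)).
  by rewrite ler_wpM2r ?ln_ge0// -normrN ler_norm.
by rewrite ler_wpM2l// ler_ln ?posrE.
Qed.

Lemma has_integral_gamma_scale a c : 0 < a -> 0 < c ->
  has_integral leb (fun p => pospow a p * expR (- c * p)) (Gamma a * c `^ (- a)).
Proof.
move=> a0 c0; have := has_integral_affine 0 c0 (has_integral_gamma a0).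
move=> /(has_integralZ (c `^ (1 - a))); apply: has_integral_eq => [p|].
  rewrite addr0 mulrA mulNr /pospow pmulr_rgt0//; case: ifPn => p0; last by rewrite mulr0 !mul0r.
  rewrite powRM ?ltW// mulrA -powR_add//.
  by rewrite (_ : 1 - a + (a - 1) = 0) ?powRr0 ?mul1r//; ring.
rewrite mulrCA; congr (_ * _).
rewrite (_ : 1 - a = - a + 1); last by ring.
by rewrite -powR_mulr// mulrC mulKf ?gt_eqF.
Qed.

End gamma.

Lemma has_integral0 d (T : measurableType d) (R : realType)
    (mu : {measure set T -> \bar R}) : has_integral mu (fun=> 0) 0.
Proof. by apply: has_integral_ge0 => //; rewrite integral0. Qed.

Section gamma_integrals.
Context (R : realType).
Notation leb := (@lebesgue_measure R).

(** Writing the negative power of [p + c] as a Gamma integral and exchanging the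
    two integrations. *)
Lemma has_integral_beta (x y c : R) : 0 < x -> 0 < y -> 0 < c ->
  has_integral leb (fun p => pospow x p * (p + c) `^ (- (x + y)))
    (Gamma x * Gamma y / Gamma (x + y) * c `^ (- y)).
Proof.
move=> x0 y0 c0; have xy0 : 0 < x + y by rewrite addr_gt0.
pose K (z : measurableTypeR R * measurableTypeR R) : R :=
  pospow (x + y) z.1 * expR (- c * z.1) * (pospow x z.2 * expR (- z.1 * z.2)).
have mK : measurable_fun setT K.
  have m1 := @measurable_fst _ _ (measurableTypeR R) (measurableTypeR R).
  have m2 := @measurable_snd _ _ (measurableTypeR R) (measurableTypeR R).
  have mp a : @measurable_fun _ _ (measurableTypeR R) R setT (pospow a).
    exact: measurable_pospow.
  apply: measurable_funM.
    apply: measurable_funM; first exact: (measurableT_comp (mp _) m1).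
    by apply: measurable_expRT; apply: measurable_funM.
  apply: measurable_funM; first exact: (measurableT_comp (mp _) m2).
  by apply: measurable_expRT; apply: measurable_funM => //; exact: measurable_funN.
have K0 z : 0 <= K z by rewrite !mulr_ge0 ?pospow_ge0 ?expR_ge0.
have domK z : `|K z| <= K z by rewrite ger0_norm.
have inner v : has_integral leb (fun p => K (v, p))
    (Gamma x * (pospow y v * expR (- c * v))).
  have [v0|v0] := ltP 0 v; last first.
    have pv a : pospow a v = 0 by rewrite /pospow ltNge v0.
    apply: has_integral_eq (has_integral0 leb) => [p|]; rewrite /K/= pv.
      by rewrite !mul0r.
    by rewrite mul0r mulr0.
  have := has_integralZ (pospow (x + y) v * expR (- c * v))
    (has_integral_gamma_scale x0 v0).
  apply: has_integral_eq => //; rewrite /pospow v0.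
  rewrite (_ : x + y - 1 = x + (y - 1)); last by ring.
  rewrite powR_add// powRN; field.
  by rewrite gt_eqF// powR_gt0.
have outer := has_integralZ (Gamma x) (has_integral_gamma_scale y0 c0).
have [hK hF] := @has_integral_prod _ _ _ _ R leb leb K K _ _ _ mK mK domK inner
  outer inner.
rewrite (has_integral_unique hF outer) in hK.
have swap : has_integral leb (fun p => pospow x p * (Gamma (x + y) * (p + c) `^ (- (x + y))))
    (Gamma x * (Gamma y * c `^ (- y))).
  apply: (has_integral_swap hK) => p.
  have [p0|p0] := ltP 0 p; last first.
    have pp : pospow x p = 0 by rewrite /pospow ltNge p0.
    apply: has_integral_eq (has_integral0 leb) => [v|]; rewrite ?/K/= pp.
      by rewrite mul0r mulr0.
    by rewrite mul0r.
  have pc : 0 < p + c by rewrite addr_gt0.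
  have := has_integralZ (pospow x p) (has_integral_gamma_scale xy0 pc).
  apply: has_integral_eq => // v; rewrite /K/=.
  rewrite (_ : - (p + c) * v = - c * v + - v * p); last by ring.
  by rewrite expRD; ring.
have G0 := Gamma_gt0 xy0.
have := has_integralZ (Gamma (x + y))^-1 swap.
apply: has_integral_eq => [p|]; last by ring.
by field; rewrite gt_eqF.
Qed.

Section laplace.
Variables (a A : R).
Hypotheses (a_gt0 : 0 < a) (A_gt0 : 0 < A).

Definition laplace_weight (p : R) : R := pospow a p * expR (- A * p).

Lemma laplace_weightP : has_integral leb laplace_weight (Gamma a * A `^ (- a)).
Proof. exact: has_integral_gamma_scale. Qed.

Let h := laplace_weight.
Let G (phi t : R) := cos_integral (fun p => p * h p) phi t.

Let hi : leb.-integrable setT (EFin \o h).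
Proof. exact: laplace_weightP.1. Qed.

Let phE : (fun p => p * h p) = fun p => pospow (a + 1) p * expR (- A * p).
Proof. by apply/funext => p; rewrite /h /laplace_weight mulrA pospow_mulX. Qed.

Let phi_ : leb.-integrable setT (EFin \o (fun p => p * h p)).
Proof.
by rewrite phE; apply: (has_integral_gamma_scale _ A_gt0).1; rewrite addr_gt0.
Qed.

(** The derivative of [p^a exp (- A p) cos (t p + phi)] has integral zero. *)
Let by_parts (phi t : R) :
  a * cos_integral h phi t - A * G phi t + t * G (phi + pi / 2) t = 0.
Proof.
have h1 := has_integralZ a (cos_integralP phi t hi).
have h2 := has_integralZ A (cos_integralP phi t phi_).
have h3 := has_integralZ t (cos_integralP (phi + pi / 2) t phi_).
have H := has_integralD (has_integralB h1 h2) h3.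
apply: (has_integral_unique H).
pose g (p : R) := p `^ a * expR (- A * p).
have g0 p : 0 <= g p by rewrite mulr_ge0 ?powR_ge0 ?expR_ge0.
have pa p : 0 < p -> p `^ a = p * p `^ (a - 1).
  by move=> p0; rewrite powR_mulr// subrK.
have gcos (e : nat -> R) (th : nat -> R) : g (e N) @[N --> \oo] --> (0 : R) ->
    g (e N) * cos (th N) @[N --> \oo] --> (0 : R).
  move=> ge; apply/norm_cvg0P; apply: (squeeze_cvgr _ (@cvg_cst _ (0 : R) _ _ _) ge).
  apply: nearW => N; rewrite normr_ge0/= normrM ger0_norm// ler_piMr//.
  by rewrite ler_norml cos_geN1 cos_le1.
have glow : g (N.+2%:R)^-1 @[N --> \oo] --> (0 : R).
  apply: (squeeze_cvgr _ (@cvg_cst _ (0 : R) _ _ _) (@cvg_powR_inv2 R a a_gt0)).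
  apply: nearW => N; rewrite g0/= /g ler_piMr ?powR_ge0// -[leRHS]expR0 ler_expR.
  by rewrite mulNr oppr_le0 mulr_ge0 ?(ltW A_gt0) ?invr_ge0.
have ghigh : g N.+2%:R @[N --> \oo] --> (0 : R).
  (* [expRN_le] at [A p] leaves a bound of order [1 / p]. *)
  have [C C0 bd] := expRN_le a_gt0.
  have cz : A `^ (- a) * C / A * (N.+2%:R)^-1 @[N --> \oo] --> (A `^ (- a) * C / A * 0 : R).
    by apply: cvgM; [exact: cvg_cst|exact: cvg_inv2].
  rewrite mulr0 in cz; apply: (squeeze_cvgr _ (@cvg_cst _ (0 : R) _ _ _) cz).
  apply: nearW => N; rewrite g0/=; set p : R := N.+2%:R.
  have p0 : 0 < p by rewrite ltr0n.
  have q0 : 0 < A * p by rewrite mulr_gt0.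
  have q1 : 0 < 1 + A * p by rewrite addr_gt0.
  rewrite /g mulNr; apply: (le_trans (ler_wpM2l (powR_ge0 _ _) (bd _ q0))).
  have -> : p `^ a = A `^ (- a) * (A * p) `^ a.
    rewrite powRM ?ltW// mulrA -powR_add// addNr powRr0 mul1r//.
  have key : (A * p) `^ a * (1 + A * p) `^ (- a - 1) <= (A * p)^-1.
    rewrite (_ : - a - 1 = - (a + 1)); last by ring.
    rewrite powRN ler_pdivrMr ?powR_gt0//.
    have -> : (A * p) `^ a = (A * p)^-1 * (A * p) `^ (a + 1).
      by rewrite -powR_mulr// mulKf ?gt_eqF.
    rewrite ler_wpM2l ?invr_ge0 ?(ltW q0)// ge0_ler_powR ?nnegrE ?(ltW q0) ?(ltW q1)//.
      by rewrite addr_ge0 ?(ltW a_gt0).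
    by rewrite lerDr.
  have k0 : 0 <= A `^ (- a) * C by rewrite mulr_ge0 ?powR_ge0.
  apply: le_trans (_ : _ <= A `^ (- a) * C * (A * p)^-1) _; last first.
    by rewrite invfM !mulrA.
  rewrite (_ : _ * (C * _) = A `^ (- a) * C *
    ((A * p) `^ a * (1 + A * p) `^ (- a - 1))); last by ring.
  by rewrite ler_wpM2l.
have limA := gcos _ (fun N => t * (N.+2%:R)^-1 + phi) glow.
have limB := gcos _ (fun N => t * N.+2%:R + phi) ghigh.
apply: (@has_integral_derivative R [set p | 0 < p] (fun N => N.+2%:R^-1)
  (fun N => N.+2%:R) (fun p => g p * cos (t * p + phi))
  (fun p => a * (p `^ (a - 1) * expR (- A * p) * cos (t * p + phi)) -
    A * (p * (p `^ (a - 1) * expR (- A * p)) * cos (t * p + phi)) +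
    t * (p * (p `^ (a - 1) * expR (- A * p)) * cos (t * p + (phi + pi / 2))))
  _ _ (@exhaustion_lt R) (@exhaustion_sub R) (@exhaustion_near R) _ _ _ _ _ H.1).
- move=> p p0; rewrite addrA cosDpihalf.
  have d1 := is_derive1_powR a p0.
  have d2 := is_derive_expR_lin A p.
  have d3 : is_derive p (1 : R) (fun s : R => cos (t * s + phi))
      (- (t * sin (t * p + phi))).
    apply: is_derive_eq.
    by rewrite /GRing.scale/= !(mulr0, mul0r, add0r, addr0, mulr1); ring.
  have d4 := is_deriveM (is_deriveM d1 d2) d3.
  apply: (is_derive_eq d4); rewrite /GRing.scale/= -[X in X * - _]/(g p) /g pa//.
  by ring.
- move=> p p0.
  have cp := @continuous_powR_gt0 R (a - 1) p p0.
  have ce : {for p, continuous (fun s : R => expR (- A * s))}.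
    apply/differentiable_continuous/derivable1_diffP.
    by have [] := is_derive_expR_lin A p.
  have cc psi : {for p, continuous (fun s : R => cos (t * s + psi))}.
    exact: continuous_cos_affine.
  have ci : {for p, continuous (fun s : R => s)} by exact: cvg_id.
  apply: (@cvgD _ R^o).
    apply: (@cvgB _ R^o); (apply: cvgM; first exact: cvg_cst);
      (apply: cvgM; last exact: cc).
      by apply: cvgM; [exact: cp|exact: ce].
    by apply: cvgM => //; apply: cvgM; [exact: cp|exact: ce].
  apply: cvgM; first exact: cvg_cst.
  apply: cvgM; last exact: cc.
  by apply: cvgM => //; apply: cvgM; [exact: cp|exact: ce].
- by move=> p p0; rewrite /h /laplace_weight /pospow p0.
- move=> p /negP p0; rewrite /h /laplace_weight /pospow (negbTE p0).
  by rewrite !(mul0r, mulr0) subrr addr0.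
- by have := cvgB limB limA; rewrite subrr; apply.
Qed.

Let C := cos_integral h 0.
Let S := cos_integral h (- (pi / 2)).

Let G_pi (t : R) : G (0 + pi / 2) t = - G (- (pi / 2)) t.
Proof.
have h1 := cos_integralP (- (pi / 2)) t phi_.
have h2 := cos_integralP (0 + pi / 2) t phi_.
have h3 := has_integralZ (-1) h1.
rewrite -mulN1r; apply: has_integral_unique h2 _.
apply: has_integral_eq h3 => // p.
by rewrite add0r cosBpihalf cosDpihalf; ring.
Qed.

(** The logarithmic derivative in [t] of the squared modulus of the Laplace
    transform at [A - i t] is [- 2 a t / (A^2 + t^2)]. *)
Lemma laplace_modulus (t : R) :
  C t ^+ 2 + S t ^+ 2 = Gamma a ^+ 2 * (A ^+ 2 + t ^+ 2) `^ (- a).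
Proof.
have pos s : 0 < A ^+ 2 + s ^+ 2 by rewrite ltr_wpDr ?sqr_ge0 ?exprn_gt0.
pose N (s : R) := (C s ^+ 2 + S s ^+ 2) * (A ^+ 2 + s ^+ 2) `^ a.
have dN s : is_derive s (1 : R) N 0.
  have dC : is_derive s (1 : R) C (- G (- (pi / 2)) s).
    by rewrite -G_pi; exact: is_derive_cos_integral.
  have dS : is_derive s (1 : R) S (G 0 s).
    rewrite -[0](addNr (pi / 2)); exact: is_derive_cos_integral.
  have e1 := by_parts 0 s; have e2 := by_parts (- (pi / 2)) s.
  rewrite G_pi -/(C s) in e1; rewrite addNr -/(S s) in e2.
  have dp := is_derive1_powR a (pos s).
  have dq : is_derive s (1 : R) (fun y : R => A ^+ 2 + y ^+ 2) (2 * s).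
    by apply: is_derive_eq; rewrite /GRing.scale/=; ring.
  have dr := @is_derive1_comp R (fun y => y `^ a) (fun y => A ^+ 2 + y ^+ 2)
    s _ _ dp dq.
  have dCS : is_derive s (1 : R) (fun y : R => C y ^+ 2 + S y ^+ 2)
      (2 * (S s * G 0 s - C s * G (- (pi / 2)) s)).
    by apply: is_derive_eq; rewrite /GRing.scale/=; ring.
  apply: (is_derive_eq (is_deriveM dCS dr)); rewrite /GRing.scale/=.
  have -> : (A ^+ 2 + s ^+ 2) `^ a = (A ^+ 2 + s ^+ 2) * (A ^+ 2 + s ^+ 2) `^ (a - 1).
    by rewrite powR_mulr// subrK.
  set Pw := (_ `^ (a - 1)); set Gc := G 0 s in e1 e2 *.
  set Gs := G _ s in e1 e2 *.
  transitivity (2 * Pw * ((a * C s - A * Gc + s * - Gs) * (s * C s - A * S s) +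
    (a * S s - A * Gs + s * Gc) * (s * S s + A * C s))); first by ring.
  by rewrite e1 e2; ring.
have C0 : C 0 = Gamma a * A `^ (- a).
  apply: has_integral_unique (cos_integralP 0 0 hi) _.
  by apply: has_integral_eq laplace_weightP => // p; rewrite mul0r addr0 cos0 mulr1.
have S0 : S 0 = 0.
  apply: has_integral_unique (cos_integralP (- (pi / 2)) 0 hi) _.
  apply: has_integral_eq (has_integral0 leb) => // p.
  by rewrite mul0r cosBpihalf sin0 mulr0.
have := is_derive_0_is_cst t 0 dN; rewrite /N C0 S0 !expr0n/= !addr0 => E.
rewrite powRN -[LHS](mulfK (lt0r_neq0 (powR_gt0 a (pos t)))) E; congr (_ / _).
rewrite exprMn -mulrA -[RHS]mulr1; congr (_ * _).
rewrite !expr2 powRM ?ltW// powRN; field.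
by rewrite gt_eqF// powR_gt0.
Qed.

End laplace.
End gamma_integrals.

(** * The Laplace representation of the gauge kernel *)

(** The integrable case reduces to the nonnegative one, on the positive and
    negative parts. *)
Lemma has_integral_comp d1 d2 (X : measurableType d1) (Y : measurableType d2)
    (R : realType) (phi : X -> Y) (mu : {measure set X -> \bar R})
    (nu : {measure set Y -> \bar R}) (c : R) (f : Y -> R) (v : R) :
  0 < c -> measurable_fun setT phi ->
  (forall F : Y -> \bar R, measurable_fun setT F -> (forall y, 0 <= F y)%E ->
    (\int[mu]_x F (phi x) = c%:E * \int[nu]_y F y)%E) ->
  has_integral nu f v -> has_integral mu (f \o phi) (c * v).
Proof.
move=> c0 mphi phiE hf; have mf := has_integral_measurable hf.
have mfE : measurable_fun setT (EFin \o f) by exact/measurable_EFinP.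
split.
  apply/integrableP; split; first exact/measurable_EFinP/measurableT_comp.
  rewrite (phiE (fun y => `|(f y)%:E|%E))//; last exact: measurableT_comp.
  rewrite lte_mul_pinfty ?lee_fin ?(ltW c0)//.
  by case: hf => /integrableP[].
rewrite -[LHS]/(\int[mu]_x ((EFin \o f) \o phi) x)%E.
rewrite integralE funepos_comp funeneg_comp.
rewrite (phiE ((EFin \o f)^\+)%E)//; last exact: measurable_funepos.
rewrite (phiE ((EFin \o f)^\-)%E)//; last exact: measurable_funeneg.
rewrite -muleBr//; last first.
  apply: fin_num_adde_defl; rewrite fin_numN.
  exact: (@integrable_neg_fin_num _ _ _ _ _ measurableT _ hf.1).
by rewrite -integralE hf.2 -EFinM.
Qed.

Section gauge_kernel.
Context (R : realType).
Notation leb := (@lebesgue_measure R).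
Notation RR := (measurableTypeR R * measurableTypeR R)%type.

(** The map to the light-cone coordinates: [(lambda, p)] goes to [(p, p + 2
    lambda)] when [lambda >= 0] and to [(p + 2 |lambda|, p)] otherwise. The
    two coordinates differ by [2 lambda], and the half plane [p > 0] is
    mapped onto the quadrant. *)
Let shear (z : RR) : RR :=
  (z.2 + Num.max 0 (- (2 * z.1)), z.2 + Num.max 0 (- (2 * z.1)) + 2 * z.1).

Let m1 := @measurable_fst _ _ (measurableTypeR R) (measurableTypeR R).
Let m2 := @measurable_snd _ _ (measurableTypeR R) (measurableTypeR R).

Let measurable_shear : measurable_fun setT shear.
Proof.
have mmax : measurable_fun setT (fun z : RR => Num.max 0 (- (2 * z.1)) : R).
  by apply: measurable_maxr => //; apply: measurable_funN; apply: measurable_funM.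
have mD : measurable_fun setT (fun z : RR => z.2 + Num.max 0 (- (2 * z.1)) : R).
  by apply: measurable_funD.
apply/measurable_fun_pair; first exact: mD.
by apply: measurable_funD; [exact: mD|apply: measurable_funM].
Qed.

Let shear_integral (F : RR -> \bar R) :
  measurable_fun setT F -> (forall y, 0 <= F y)%E ->
  (\int[leb \x leb]_z F (shear z) = (2^-1)%:E * \int[leb \x leb]_z F z)%E.
Proof.
move=> mF F0.
pose F1 (z : RR) := F (z.2, z.2 + 2 * z.1).
have mF1 : measurable_fun setT F1.
  apply: (measurableT_comp mF); apply/measurable_fun_pair; first exact: m2.
  by apply: measurable_funD => //; apply: measurable_funM.
rewrite (fubini_tonelli1 (F \o shear) (measurableT_comp mF measurable_shear) (fun=> F0 _)).
transitivity (\int[leb]_x \int[leb]_y F1 (x, y))%E.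
  apply: eq_integral => x _; rewrite /fubini_F/=.
  have := ge0_integral_affine (Num.max 0 (- (2 * x))) (ltr01 : 0 < 1 :> R)
    (f := fun y => F1 (x, y)) (measurableT_comp mF1 (measurable_pair1 x)) (fun=> F0 _).
  rewrite invr1 mul1e => <-; apply: eq_integral => y _.
  by rewrite /F1/= mul1r.
rewrite (fubini_tonelli F1 mF1 (fun=> F0 _)) (fubini_tonelli1 F mF F0).
rewrite -ge0_integralZl//; last 2 first.
  exact: measurable_fun_fubini_tonelli_F.
  by move=> x _; apply: integral_ge0.
apply: eq_integral => y _; rewrite /F1/=.
rewrite -(ge0_integral_affine y (ltr0n R 2 : 0 < 2 :> R) (f := fun x => F (y, x)))//.
  by apply: eq_integral => x _; rewrite addrC.
exact: (measurableT_comp mF (measurable_pair1 y)).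
Qed.

Definition cone_weight (a : R) (z : RR) : R :=
  pospow a z.2 * (z.2 + 2 * `|z.1|) `^ (a - 1).

Lemma measurable_cone_weight a : measurable_fun setT (cone_weight a).
Proof.
apply: measurable_funM.
  by apply: (measurableT_comp (f := pospow a)); [exact: measurable_pospow|exact: measurable_snd].
apply: (measurableT_comp (f := fun c : R => c `^ (a - 1))); first exact: measurable_powR.
apply: measurable_funD; first exact: measurable_snd.
by apply: measurable_funM => //; apply: measurableT_comp => //; exact: measurable_fst.
Qed.

(** In the light-cone coordinates [p] and [q = p + 2 |lambda|] the weight is
    [(p q)^(a-1)], and [p + |lambda|] and [|lambda|] are half the sum and
    half the difference of [p] and [q]: the double integral is half the
    squared modulus of the Laplace transform of [p^(a-1)] at [(A + i tau) / 2]. *)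
Lemma has_integral_cone (a A tau : R) : 0 < a -> 0 < A ->
  has_integral (leb \x leb)%E
    (fun z => cone_weight a z * (expR (- (z.2 + `|z.1|) * A) * cos (z.1 * tau)))
    (2^-1 * (Gamma a ^+ 2 * ((A ^+ 2 + tau ^+ 2) / 4) `^ (- a))).
Proof.
move=> a0 A0; have A20 : 0 < A / 2 by rewrite divr_gt0.
have hi := (laplace_weightP a0 A20).1.
have c1 := cos_integralP 0 (tau / 2) hi.
have s1 := cos_integralP (- (pi / 2)) (tau / 2) hi.
have h := has_integralD (has_integral_mul c1 c1) (has_integral_mul s1 s1).
have i2 : (0 : R) < 2^-1 by rewrite invr_gt0.
have := has_integral_comp i2 measurable_shear shear_integral h.
rewrite -!expr2 laplace_modulus//.
have -> : (A / 2) ^+ 2 + (tau / 2) ^+ 2 = (A ^+ 2 + tau ^+ 2) / 4 by field.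
apply: has_integral_eq => // z; rewrite /= !addr0 !cosBpihalf.
set p := z.2 + Num.max 0 _; set q := p + _.
have pair (b c : R) : laplace_weight a (A / 2) b * laplace_weight a (A / 2) c *
    cos (tau / 2 * (b - c)) =
  pospow a b * pospow a c * (expR (- (b + c) * (A / 2)) * cos (tau / 2 * (b - c))).
  have -> : - (b + c) * (A / 2) = - (A / 2) * b + - (A / 2) * c by ring.
  by rewrite /laplace_weight mulrACA -expRD !mulrA.
have weight (l : R) : 0 <= l -> pospow a z.2 * pospow a (z.2 + 2 * l) =
    pospow a z.2 * (z.2 + 2 * l) `^ (a - 1).
  move=> l0; rewrite {1 3}/pospow; case: ifPn => z20; last by rewrite !mul0r.
  by rewrite /pospow ltr_wpDr// mulr_ge0.
rewrite [LHS](_ : _ = laplace_weight a (A / 2) p * laplace_weight a (A / 2) q *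
    cos (tau / 2 * (p - q))); last by rewrite mulrBr cosB; ring.
rewrite pair /cone_weight /q /p.
(* [p] and [q] are [z.2] and [z.2 + 2 |z.1|], in the order given by the sign
   of [z.1]; the weight is symmetric in them. *)
have [l0|l0] := lerP 0 z.1.
  rewrite max_l ?oppr_le0 ?mulr_ge0// addr0 ger0_norm// weight//.
  congr (_ * (expR _ * _)); first by field.
  by rewrite -cosN; congr cos; field.
rewrite max_r ?oppr_ge0; last by rewrite pmulr_rle0 ?(ltW l0).
rewrite ltr0_norm// mulrN subrK (mulrC (pospow a _)) -mulrN weight ?oppr_ge0 ?(ltW l0)//.
congr (_ * (expR _ * _)); first by field.
by rewrite -cosN; congr cos; field.
Qed.

End gauge_kernel.

(** * Summation over the frequency space *)

(** Every finite set of pairs of multi-indices lies in a box, so the iterated sum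
    over all pairs is the limit of the sums over the boxes. *)
Lemma cvg_box_sum (R : realType) n (F : multi_index n -> multi_index n -> \bar R) :
  (forall alpha beta, 0 <= F alpha beta)%E ->
  (\sum_(f : {ffun 'I_n -> 'I_N}) \sum_(g : {ffun 'I_n -> 'I_N})
     F (box_index f) (box_index g) @[N --> \oo] -->
   \esum_(alpha in setT) \esum_(beta in setT) F alpha beta)%E.
Proof.
move=> F0; rewrite esum_esum//.
pose box N : set (multi_index n * multi_index n) :=
  range (fun fg : {ffun 'I_n -> 'I_N} * {ffun 'I_n -> 'I_N} =>
    (box_index fg.1, box_index fg.2)).
have box_index_inj N : injective (@box_index n N).
  by move=> f g /ffunP fg; apply/ffunP => j; have := fg j; rewrite !ffunE => /val_inj.
have boxE N : (\sum_(f : {ffun 'I_n -> 'I_N}) \sum_(g : {ffun 'I_n -> 'I_N})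
    F (box_index f) (box_index g) = \esum_(k in box N) F k.1 k.2)%E.
  rewrite esum_image; last by move=> [f g] [f' g'] _ _ [/box_index_inj -> /box_index_inj ->].
  rewrite esum_fset//; last exact: finite_finset.
  rewrite pair_bigA/= (fsbigE (index_enum _))//=; last 2 first.
  - exact: index_enum_uniq.
  - by move=> fg _; rewrite mem_index_enum.
  by apply: eq_bigl => fg; rewrite in_setT.
have boxP N k : box N k <-> forall j, (k.1 j < N)%N && (k.2 j < N)%N.
  split=> [[[f g] _ <-] j|kN]; first by rewrite /= !ffunE !ltn_ord.
  have k1 j : (k.1 j < N)%N by case/andP: (kN j).
  have k2 j : (k.2 j < N)%N by case/andP: (kN j).
  exists ([ffun j => Ordinal (k1 j)], [ffun j => Ordinal (k2 j)]) => //.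
  case: k {kN} k1 k2 => a b k1 k2; congr pair; apply/ffunP => j; by rewrite /= !ffunE.
have box_le N M : (N <= M)%N -> box N `<=` box M.
  move=> NM k /boxP kN; apply/boxP => j; have /andP[k1 k2] := kN j.
  by rewrite !(leq_trans _ NM).
have esum_sub (A B : set (multi_index n * multi_index n)) : A `<=` B ->
    (\esum_(k in A) F k.1 k.2 <= \esum_(k in B) F k.1 k.2)%E.
  move=> AB; apply: ge_ereal_sup => _ [X [fX XA] <-]; apply: esum_ge; exists X => //.
  by split=> //; exact: subset_trans AB.
under eq_fun do rewrite boxE.
have nd : nondecreasing_seq (fun N => \esum_(k in box N) F k.1 k.2)%E.
  by move=> N M NM; exact/esum_sub/box_le.
have := ereal_nondecreasing_cvgn nd; congr (_ --> _).
rewrite (_ : setT `*`` (fun=> setT) = setT); last by apply/seteqP; split.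
apply/eqP; rewrite eq_le; apply/andP; split.
  by apply: ge_ereal_sup => _ [N _ <-]; apply: esum_sub => k _.
apply: ge_ereal_sup => _ [X [fX _] <-].
have /finite_seqP[r Xr] := fX.
rewrite -esum_fset//; pose bnd (k : multi_index n * multi_index n) :=
  (\max_(j < n) maxn (k.1 j) (k.2 j))%N.
pose N := (\max_(k <- r) bnd k)%N.
apply: (@le_trans _ _ (\esum_(k in box N.+1) F k.1 k.2)%E); last first.
  by apply: ereal_sup_ubound; exists N.+1.
apply: esum_sub => k Xk; apply/boxP => j; rewrite !ltnS.
have kN : (maxn (k.1 j) (k.2 j) <= N)%N.
  apply: (@leq_trans (bnd k)); first exact: (@leq_bigmax _ (fun j => maxn (k.1 j) (k.2 j))).
  by apply: leq_bigmax_seq => //; move: Xk; rewrite Xr.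
by rewrite !(leq_trans _ kN)// ?leq_maxl ?leq_maxr.
Qed.

Lemma ge0_cvg_integral d (T : measurableType d) (R : realType)
    (mu : {measure set T -> \bar R}) (D : set T) (g : nat -> T -> \bar R)
    (f : T -> \bar R) : measurable D ->
  (forall N, measurable_fun D (g N)) -> (forall N x, D x -> 0 <= g N x)%E ->
  (forall N x, D x -> g N x <= g N.+1 x)%E ->
  (forall x, D x -> g N x @[N --> \oo] --> f x) ->
  (\int[mu]_(x in D) g N x @[N --> \oo] --> \int[mu]_(x in D) f x)%E.
Proof.
move=> mD mg g0 gS gf.
rewrite (_ : (\int[mu]_(x in D) f x = \int[mu]_(x in D) limn (g ^~ x))%E).
  apply: cvg_monotone_convergence => // x Dx.
  by apply/nondecreasing_seqP => N; exact: gS.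
by apply: eq_integral => x /set_mem Dx; apply/esym/cvg_lim => //; exact: gf.
Qed.

(** * The Riesz symbol as a superposition of geometric weights *)

Section riesz_symbol.
Context (R : realType) (n : nat).
Notation leb := (@lebesgue_measure R).

Lemma riesz_symbol_ge0 (s : R) (alpha : multi_index n) lambda :
  0 < s < hdim R n -> 0 <= riesz_symbol s alpha lambda.
Proof.
move=> /andP[s0 sQ]; rewrite /riesz_symbol mulr_ge0 ?powR_ge0// divr_ge0// ltW// Gamma_gt0//.
  by rewrite ltr_wpDl ?ler0n// divr_gt0// subr_gt0.
by rewrite ltr_wpDl ?ler0n// divr_gt0// addr_gt0// (lt_trans s0).
Qed.

Lemma measurable_riesz_symbol (s : R) (alpha : multi_index n) :
  measurable_fun setT (riesz_symbol s alpha : measurableTypeR R -> R).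
Proof.
apply: measurable_funM => //.
apply: (measurableT_comp (f := fun c : R => c `^ (- s / 2))); first exact: measurable_powR.
by apply: measurable_funM => //; exact: measurableT_comp.
Qed.

(** With [u = p / (p + 2 |lambda|)] the Beta integral writes the quotient of
    Gamma functions as a superposition of the geometric weights [u ^ |alpha|],
    which are the ones summed by the trace formula. *)
Lemma has_integral_riesz_symbol (sigma lambda : R) (alpha : multi_index n) :
  0 < sigma < hdim R n -> lambda != 0 ->
  let l := 2 * `|lambda| in let y := n.+1%:R - sigma / 2 in
  has_integral leb
    (fun p => cone_weight (sigma / 4) (lambda, p) *
       ((1 - p / (p + l)) ^+ n * (p / (p + l)) ^+ mi_abs alpha))
    (Gamma y * 2 ^+ n * (riesz_symbol (hdim R n - sigma) alpha lambda * `|lambda| ^+ n)).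
Proof.
move=> /andP[s0 sQ] ln0 l y; set a := sigma / 4; set k := mi_abs alpha.
have hQ : hdim R n = 2 * n.+1%:R by rewrite /hdim -natrM; rewrite mulnS addnC.
have l0 : 0 < l by rewrite mulr_gt0 ?normr_gt0.
have y0 : 0 < y by move: sQ; rewrite hQ /y; lra.
have a0 : 0 < a by rewrite divr_gt0.
have x0 : 0 < k%:R + a by rewrite ltr_wpDl.
have xyE : k%:R + a + y = k%:R + n%:R + 1 - a.
  by rewrite /y /a -natr1; field.
have := has_integralZ (l ^+ n) (has_integral_beta x0 y0 l0).
apply: has_integral_eq => [p|].
  rewrite /cone_weight/= -/l /pospow; case: ifPn => p0; last by rewrite !mul0r mulr0.
  have q0 : 0 < p + l by rewrite addr_gt0.
  have -> : k%:R + a - 1 = k%:R + (a - 1) :> R by rewrite addrA.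
  have -> : - (k%:R + a + y) = (a - 1) + - (k + n)%:R :> R.
    by rewrite xyE natrD; ring.
  move: (a - 1) => c; rewrite !powR_add// powRN !powR_mulrn ?(ltW q0) ?(ltW p0)//.
  have -> : 1 - p / (p + l) = l / (p + l) by field; rewrite gt_eqF.
  move: (p `^ _) ((p + l) `^ _) => P S.
  rewrite exprD !expr_div_n; move: (l ^+ n) (p ^+ k) => L P'.
  have : (p + l) ^+ k != 0 by rewrite expf_neq0// gt_eqF.
  have : (p + l) ^+ n != 0 by rewrite expf_neq0// gt_eqF.
  by move: ((p + l) ^+ k) ((p + l) ^+ n) => K N N0 K0; field; rewrite N0 K0.
rewrite /riesz_symbol -/l -/k.
have -> : - (hdim R n - sigma) / 2 = - y by rewrite hQ /y; field.
have -> : k%:R + (hdim R n - (hdim R n - sigma)) / 4 = k%:R + a.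
  by rewrite /a; field.
have -> : k%:R + (hdim R n + (hdim R n - sigma)) / 4 = k%:R + a + y.
  by rewrite hQ /y /a; field.
by rewrite /l exprMn; ring.
Qed.

End riesz_symbol.

(** * Averages over pairs of points *)

(** The sigma-finite structure on a product makes it a factor in a further
    product, as in the integrals over frequencies and pairs of points together. *)
Section sigma_finite_product.
Context d1 d2 (T1 : measurableType d1) (T2 : measurableType d2) (R : realType).
Variables (m1 : {sigma_finite_measure set T1 -> \bar R})
  (m2 : {sigma_finite_measure set T2 -> \bar R}).

Definition sigma_finite_product : set (T1 * T2) -> \bar R := (m1 \x m2)%E.

HB.instance Definition _ := Measure.copy sigma_finite_product (m1 \x m2)%E.

Let sigma_finite_productP : sigma_finite setT sigma_finite_product.
Proof.
have /sigma_finiteP[F [FT ndF Foo]] := sigma_finiteT m1.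
have /sigma_finiteP[G [GT ndG Goo]] := sigma_finiteT m2.
exists (fun k => F k `*` G k) => [|k].
  apply/seteqP; split => // -[x y] _.
  have [k _ Fx] : (\bigcup_i F i) x by rewrite -FT.
  have [l _ Gy] : (\bigcup_i G i) y by rewrite -GT.
  exists (maxn k l) => //; split => /=.
    by move: x Fx; exact/subsetPset/ndF/leq_maxl.
  by move: y Gy; exact/subsetPset/ndG/leq_maxr.
have [mF Fk] := Foo k; have [mG Gk] := Goo k; split; first exact: measurableX.
by rewrite [ltLHS]product_measure1E// lte_mul_pinfty// ge0_fin_numE.
Qed.

HB.instance Definition _ := Measure_isSigmaFinite.Build _ _ _ sigma_finite_product
  sigma_finite_productP.

End sigma_finite_product.

Section pair_average.
Context (R : realType) (n : nat).
Notation leb := (@lebesgue_measure R).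
Notation RR := (measurableTypeR R * measurableTypeR R)%type.
Notation HH := (heis R n * heis R n)%type.
Variable mu : {finite_measure set (heis R n) -> \bar R}.

Lemma measurable_vertical : measurable_fun setT (fun z : HH => vertical z.1 z.2).
Proof.
have m11 := measurableT_comp (@measurable_fst _ _ 'rV[R]_n 'rV[R]_n)
  (@measurable_fst _ _ ('rV[R]_n * 'rV[R]_n)%type R).
have m12 := measurableT_comp (@measurable_snd _ _ 'rV[R]_n 'rV[R]_n)
  (@measurable_fst _ _ ('rV[R]_n * 'rV[R]_n)%type R).
have m2 := @measurable_snd _ _ ('rV[R]_n * 'rV[R]_n)%type R.
have f1 := @measurable_fst _ _ (heis R n) (heis R n).
have f2 := @measurable_snd _ _ (heis R n) (heis R n).
rewrite (_ : (fun z => _) = fun z : HH => - z.2.2 + z.1.2 +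
    2^-1 * (dot z.2.1.1 z.1.1.2 - dot z.2.1.2 z.1.1.1)); last first.
  apply/funext => -[[[x y] t] [[x' y'] t']].
  by rewrite /vertical /heis_mul /heis_inv /omega/= !dotNl; ring.
apply: measurable_funD.
  apply: measurable_funD; last exact: measurableT_comp m2 f1.
  by apply: measurable_funN; exact: measurableT_comp m2 f2.
apply: measurable_funM => //; apply: measurable_funB; apply: measurable_dot.
- exact: measurableT_comp m11 f2.
- exact: measurableT_comp m12 f1.
- exact: measurableT_comp m12 f2.
- exact: measurableT_comp m11 f1.
Qed.

Lemma measurable_hdist2 : measurable_fun setT (fun z : HH => hdist2 z.1 z.2).
Proof.
have m11 := measurableT_comp (@measurable_fst _ _ 'rV[R]_n 'rV[R]_n)
  (@measurable_fst _ _ ('rV[R]_n * 'rV[R]_n)%type R).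
have m12 := measurableT_comp (@measurable_snd _ _ 'rV[R]_n 'rV[R]_n)
  (@measurable_fst _ _ ('rV[R]_n * 'rV[R]_n)%type R).
have f1 := @measurable_fst _ _ (heis R n) (heis R n).
have f2 := @measurable_snd _ _ (heis R n) (heis R n).
have mx (m : heis R n -> 'rV[R]_n) : measurable_fun setT m ->
    measurable_fun setT (fun z : HH => - m z.2 + m z.1).
  move=> mm; apply: measurable_rowD; last exact: measurableT_comp mm f1.
  apply: measurable_fun_mxentryP => i j; under eq_fun do rewrite mxE.
  apply: measurable_funN.
  exact: (measurableT_comp (measurable_mxentry i j) (measurableT_comp mm f2)).
by apply: measurable_funD; apply: measurable_dot; do ?[exact: (mx _ m11)|exact: (mx _ m12)].
Qed.

Lemma hdist2_ge0 (p q : heis R n) : 0 <= hdist2 p q.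
Proof. by rewrite addr_ge0 ?dot_ge0. Qed.

Definition displacement_wave (z : RR) (w : HH) : R :=
  expR (- (z.2 + `|z.1|) * (hdist2 w.1 w.2 / 4)) * cos (z.1 * vertical w.1 w.2).

(** The Laplace-Fourier transform of the law under [mu \x mu] of the horizontal
    and vertical displacements. *)
Definition pair_average (z : RR) : R :=
  \int[(mu \x mu)%E]_w displacement_wave z w.

Lemma measurable_displacement_wave :
  measurable_fun setT (fun zw : RR * HH => displacement_wave zw.1 zw.2).
Proof.
have z1 := measurableT_comp (@measurable_fst _ _ (measurableTypeR R) (measurableTypeR R))
  (@measurable_fst _ _ RR HH).
have z2 := measurableT_comp (@measurable_snd _ _ (measurableTypeR R) (measurableTypeR R))
  (@measurable_fst _ _ RR HH).
have mv := measurableT_comp measurable_vertical (@measurable_snd _ _ RR HH).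
have mh := measurableT_comp measurable_hdist2 (@measurable_snd _ _ RR HH).
apply: measurable_funM; last by apply: measurable_cosT; apply: measurable_funM.
apply: measurable_expRT; apply: measurable_funM; last exact: measurable_funM.
by apply: measurable_funN; apply: measurable_funD => //; exact: measurableT_comp.
Qed.

Lemma measurable_pair_average : measurable_fun setT pair_average.
Proof. exact: (@measurable_fun_Rintegral _ _ RR HH R (sigma_finite_product mu mu)
  (fun zw => displacement_wave zw.1 zw.2) measurable_displacement_wave).
Qed.

Lemma displacement_wave_le1 (z : RR) w : 0 <= z.2 -> `|displacement_wave z w| <= 1.
Proof.
move=> z20; rewrite normrM -[leRHS]mulr1; apply: ler_pM => //.
  rewrite ger0_norm ?expR_ge0// -expR0 ler_expR mulNr oppr_le0.
  by rewrite mulr_ge0 ?addr_ge0// divr_ge0 ?hdist2_ge0.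
by rewrite ler_norml cos_geN1 cos_le1.
Qed.

Lemma has_integral_pair_average (z : RR) : 0 <= z.2 ->
  has_integral (mu \x mu)%E (displacement_wave z) (pair_average z).
Proof.
move=> z20; apply: integrable_has_integral.
apply: has_integral_dominated (has_integral_cst_prod mu 1).
  exact: (measurableT_comp measurable_displacement_wave (measurable_pair1 z)).
by move=> w; exact: displacement_wave_le1.
Qed.

(** The trace formula read at [u = p / (p + 2 |lambda|)]. *)
Lemma cvg_pair_average (lambda p : R) : lambda != 0 -> 0 < p ->
  (1 - p / (p + 2 * `|lambda|)) ^+ n *
    weighted_box_sum lambda mu (p / (p + 2 * `|lambda|)) 1 N @[N --> \oo] -->
  (pair_average (lambda, p) : R).
Proof.
move=> ln0 p0; set u := p / _.
have l0 : 0 < `|lambda| by rewrite normr_gt0.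
have q0 : 0 < p + 2 * `|lambda| by rewrite addr_gt0 ?mulr_gt0.
have u01 : 0 < u < 1.
  by rewrite divr_gt0//= ltr_pdivrMr// mul1r ltrDl mulr_gt0.
have [h c] := trace_formula ln0 mu u01.
have /andP[u0 u1] := u01.
have u1' : (1 - u) ^+ n != 0 by rewrite expf_neq0// subr_eq0 gt_eqF.
rewrite (_ : pair_average _ = (1 - u) ^+ n * \int[(mu \x mu)%E]_z trace_value lambda u 1 z.1 z.2).
  by apply: cvgM => //; exact: cvg_cst.
apply: has_integral_unique (has_integral_pair_average (z := (lambda, p)) (ltW p0)) _.
have E : `|lambda| * (1 + u) / (1 - u) = p + `|lambda|.
  have -> : 1 + u = 2 * (p + `|lambda|) / (p + 2 * `|lambda|).
    by rewrite /u; field; rewrite gt_eqF.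
  have -> : 1 - u = 2 * `|lambda| / (p + 2 * `|lambda|).
    by rewrite /u; field; rewrite gt_eqF.
  by field; rewrite !gt_eqF.
apply: has_integral_eq (has_integralZ ((1 - u) ^+ n) h) => [w|//].
rewrite trace_value1// E [LHS]mulrA [X in X * _]mulrA mulfV// mul1r.
by congr (expR _ * _); rewrite /=; field.
Qed.

(** A limit of nonnegative sums when [lambda] is nonzero; for [lambda = 0]
    the cosine is 1. *)
Lemma cone_average_ge0 (a : R) (z : RR) : 0 <= cone_weight a z * pair_average z.
Proof.
rewrite /cone_weight /pospow; case: ifPn => [p0|_]; last by rewrite !mul0r.
rewrite mulr_ge0 ?mulr_ge0 ?powR_ge0//.
case: z p0 => lambda p /= p0; have [->|ln0] := eqVneq lambda 0.
  apply: Rintegral_ge0 => w _; rewrite /displacement_wave mul0r cos0 mulr1; exact: expR_ge0.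
apply: cvgr_to_ge (cvg_pair_average ln0 p0) _.
have l0 : 0 < `|lambda| by rewrite normr_gt0.
have q0 : 0 < p + 2 * `|lambda| by rewrite addr_gt0 ?mulr_gt0.
apply: nearW => N; rewrite mulr_ge0 ?exprn_ge0//.
  by rewrite subr_ge0 ler_pdivrMr// mul1r lerDl mulr_ge0.
rewrite /weighted_box_sum sumr_ge0// => f _; rewrite sumr_ge0// => g _.
by rewrite expr1n mulr1 mulr_ge0 ?sqr_ge0// exprn_ge0// divr_ge0// ltW.
Qed.

End pair_average.

(** * The integral over the frequency space *)

Section frequency_side.
Context (R : realType) (n : nat).
Notation leb := (@lebesgue_measure R).
Notation RR := (measurableTypeR R * measurableTypeR R)%type.
Variables (mu : {finite_measure set (heis R n) -> \bar R}) (sigma : R).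
Hypothesis sigma_range : 0 < sigma < hdim R n.
Let a := sigma / 4.

(** The constants of the Beta integral and of the density of the measure on
    the frequency space. *)
Definition frequency_constant : R :=
  (Gamma (n.+1%:R - sigma / 2) * 2 ^+ n * (2 * pi) ^+ n.+1)^-1.

Lemma frequency_constant_gt0 : 0 < frequency_constant.
Proof.
have /andP[s0 sQ] := sigma_range.
rewrite invr_gt0 mulr_gt0 ?exprn_gt0 ?mulr_gt0 ?pi_gt0 ?exprn_gt0// Gamma_gt0//.
by move: sQ; rewrite /hdim natrD natrM -(natr1 n); lra.
Qed.

Let K := frequency_constant.
Let term (alpha beta : multi_index n) (lambda : R) : R :=
  riesz_symbol (hdim R n - sigma) alpha lambda *
  cmod (fourier mu alpha beta lambda) ^+ 2 * (`|lambda| ^+ n / (2 * pi) ^+ n.+1).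

Let term_ge0 alpha beta lambda : 0 <= term alpha beta lambda.
Proof.
have /andP[s0 sQ] := sigma_range.
apply: mulr_ge0; last first.
  by rewrite divr_ge0 ?exprn_ge0 ?mulr_ge0 ?pi_ge0.
rewrite mulr_ge0 ?sqr_ge0//; apply: riesz_symbol_ge0.
by rewrite subr_gt0 sQ ltrBlDr ltrDl.
Qed.

Let measurable_term alpha beta :
  measurable_fun setT (term alpha beta : measurableTypeR R -> R).
Proof.
apply: measurable_funM.
  apply: measurable_funM; first exact: measurable_riesz_symbol.
  exact: measurable_cmod_fourier_sqr.
apply: measurable_funM => //.
by apply: measurable_funX; exact: (measurableT_comp (f := fun c : R => `|c|)).
Qed.

Let box N (lambda : R) : R :=
  \sum_(f : {ffun 'I_n -> 'I_N}) \sum_(g : {ffun 'I_n -> 'I_N})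
    term (box_index f) (box_index g) lambda.

Let layer N (lambda p : R) : R :=
  K * (cone_weight a (lambda, p) * ((1 - p / (p + 2 * `|lambda|)) ^+ n *
       weighted_box_sum lambda mu (p / (p + 2 * `|lambda|)) 1 N)).

Let has_integral_layer N lambda : lambda != 0 ->
  has_integral leb (layer N lambda) (box N lambda).
Proof.
move=> ln0.
have h (f g : {ffun 'I_n -> 'I_N}) := has_integralZ
  (K * cmod (fourier mu (box_index f) (box_index g) lambda) ^+ 2)
  (has_integral_riesz_symbol (box_index f) sigma_range ln0).
have := has_integral_sum (index_enum _) (fun f =>
  has_integral_sum (index_enum _) (fun g => h f g)).
apply: has_integral_eq => [p|].
  rewrite /layer /weighted_box_sum !mulr_sumr; apply: eq_bigr => f _.
  rewrite !mulr_sumr; apply: eq_bigr => g _; rewrite expr1n mulr1 -/a.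
  by rewrite !mulrA; ring.
apply: eq_bigr => f _; apply: eq_bigr => g _; rewrite /term /K /frequency_constant.
have G0 : Gamma (n.+1%:R - sigma / 2) != 0.
  by move: frequency_constant_gt0; rewrite /frequency_constant; apply: contraTneq => ->;
    rewrite !mul0r invr0 ltxx.
have T0 : (2 : R) ^+ n != 0 by rewrite expf_neq0.
have P0 : (2 * pi : R) ^+ n.+1 != 0 by rewrite expf_neq0// mulf_neq0// gt_eqF// pi_gt0.
move: ((2 : R) ^+ n) T0 ((2 * pi : R) ^+ n.+1) P0 => T T0 P P0.
by move: (Gamma _) G0 => G G0; field; rewrite G0 T0 P0.
Qed.

Let layer_limit (z : RR) : R := K * (cone_weight a z * pair_average mu z).

Let cvg_box lambda : lambda != 0 ->
  ((box N lambda)%:E @[N --> \oo] --> \int[leb]_p (layer_limit (lambda, p))%:E)%E.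
Proof.
move=> ln0; under eq_fun do rewrite -(has_integral_layer _ ln0).2.
have l0 : 0 < `|lambda| by rewrite normr_gt0.
have K0 := ltW frequency_constant_gt0.
have q0 p : 0 < p -> 0 < p + 2 * `|lambda| by move=> p0; rewrite addr_gt0 ?mulr_gt0.
have wF (p : R) : p <= 0 -> cone_weight a (lambda, p) = 0.
  by move=> p0; rewrite /cone_weight /pospow/= ltNge p0/= mul0r.
have w0 (p : R) : 0 <= cone_weight a (lambda, p).
  by rewrite mulr_ge0 ?powR_ge0 ?pospow_ge0.
have c0 (p : R) : 0 < p -> 0 <= (1 - p / (p + 2 * `|lambda|)) ^+ n.
  by move=> p0; rewrite exprn_ge0// subr_ge0 ler_pdivrMr ?q0// mul1r lerDl mulr_ge0.
have t0 (p : R) alpha beta : 0 < p ->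
    0 <= (p / (p + 2 * `|lambda|)) ^+ mi_abs alpha * 1 ^+ mi_abs beta *
         cmod (fourier mu alpha beta lambda) ^+ 2.
  move=> p0; rewrite expr1n mulr1 mulr_ge0 ?sqr_ge0// exprn_ge0// divr_ge0 ?(ltW p0)//.
  exact/ltW/q0.
apply: (@ge0_cvg_integral _ _ _ leb) => //.
- move=> N; apply/measurable_EFinP.
  exact: has_integral_measurable (has_integral_layer N ln0).
- move=> N p _; rewrite lee_fin /layer; have [p0|/wF ->] := ltP 0 p; last by rewrite mul0r mulr0.
  apply: mulr_ge0 => //; apply: mulr_ge0 => //; apply: mulr_ge0; first exact: c0.
  rewrite /weighted_box_sum; apply: sumr_ge0 => f _.
  by apply: sumr_ge0 => g _; exact: t0.
- move=> N p _; rewrite lee_fin /layer; have [p0|/wF ->] := ltP 0 p; last by rewrite !mul0r.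
  rewrite !ler_wpM2l ?c0// /weighted_box_sum.
  exact: (@box_sum2_le _ _ N _ (fun alpha beta => t0 p alpha beta p0)).
- move=> p _; apply: cvg_EFin; first exact: nearW.
  rewrite /layer_limit; have [p0|/wF wp] := ltP 0 p.
    apply: cvgM; first exact: cvg_cst.
    apply: cvgM; first exact: cvg_cst.
    exact: cvg_pair_average.
  have E : (fun N => layer N lambda p) = fun=> 0.
    by apply/funext => N; rewrite /layer wp mul0r mulr0.
  rewrite wp mul0r mulr0 -[X in X @ _]/(fun N => layer N lambda p) E.
  exact: cvg_cst.
Qed.

Let measurable_cone_average :
  measurable_fun setT (fun z : RR => cone_weight a z * pair_average mu z).
Proof.
by apply: measurable_funM; [exact: measurable_cone_weight|exact: measurable_pair_average].
Qed.

(** All terms are nonnegative, so the sum over boxes can be moved under the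
    integral in [lambda] and then under the integral in [p], where
    [cvg_pair_average] evaluates it. *)
Lemma freq_integral_average :
  freq_integral (fun (alpha beta : multi_index n) (lambda : R) =>
    (riesz_symbol (hdim R n - sigma) alpha lambda *
     cmod (fourier mu alpha beta lambda) ^+ 2)%:E) =
  (K%:E * \int[leb \x leb]_z (cone_weight a z * pair_average mu z)%:E)%E.
Proof.
pose D : set R := [set l | l != 0].
have DE : D = setT `\ (0 : R).
  by apply/seteqP; split => [x /= /eqP x0|x [_ /= /eqP]].
have mD : measurable (D : set (measurableTypeR R)).
  by rewrite DE; apply: measurableD.
have F0 alpha beta : (0 <= \int[leb]_(lambda in D) (term alpha beta lambda)%:E)%E.
  by apply: integral_ge0 => x _; rewrite lee_fin.
have T0 alpha beta lambda : (0 <= (term alpha beta lambda)%:E)%E by rewrite lee_fin.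
have mterm alpha beta : measurable_fun D (fun x : measurableTypeR R => (term alpha beta x)%:E).
  by apply/measurable_EFinP; apply: (measurable_funS measurableT) => //;
    exact: measurable_term.
have mbox N : measurable_fun D (fun x : measurableTypeR R => (box N x)%:E).
  apply/measurable_EFinP; apply: (measurable_funS measurableT) => //.
  by apply: measurable_sum => f; apply: measurable_sum => g; exact: measurable_term.
have lim1 := cvg_box_sum F0.
have lim2 : ((\int[leb]_(lambda in D) (box N lambda)%:E)%E @[N --> \oo] -->
    (\int[leb]_(lambda in D) \int[leb]_p (layer_limit (lambda, p))%:E)%E).
  apply: (@ge0_cvg_integral _ _ _ leb) => //.
  - by move=> N x _; rewrite lee_fin; apply: sumr_ge0 => f _; apply: sumr_ge0.
  - by move=> N x _; rewrite lee_fin; apply: (@box_sum2_le _ _ N (fun alpha beta => term alpha beta x)).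
have boxE N : (\int[leb]_(lambda in D) (box N lambda)%:E =
    \sum_(f : {ffun 'I_n -> 'I_N}) \sum_(g : {ffun 'I_n -> 'I_N})
      \int[leb]_(lambda in D) (term (box_index f) (box_index g) lambda)%:E)%E.
  have inner (f : {ffun 'I_n -> 'I_N}) :=
    @ge0_integral_sum _ _ _ leb D mD _
      (fun (g : {ffun 'I_n -> 'I_N}) x => (term (box_index f) (box_index g) x)%:E)
      (fun g => mterm _ _) (fun g x _ => T0 _ _ _) (index_enum _).
  have outer := @ge0_integral_sum _ _ _ leb D mD _
      (fun (f : {ffun 'I_n -> 'I_N}) x =>
        \sum_(g : {ffun 'I_n -> 'I_N}) (term (box_index f) (box_index g) x)%:E)
      (fun f => emeasurable_sum _ (fun g => mterm _ _))
      (fun f x _ => sume_ge0 (fun g _ => T0 _ _ _) _) (index_enum _).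
  transitivity (\sum_(f : {ffun 'I_n -> 'I_N}) \int[leb]_(x in D)
      \sum_(g : {ffun 'I_n -> 'I_N}) (term (box_index f) (box_index g) x)%:E)%E.
    rewrite -outer; apply: eq_integral => x _; rewrite /box -sumEFin.
    by apply: eq_bigr => f _; rewrite sumEFin.
  by apply: eq_bigr => f _; exact: inner.
transitivity (\int[leb]_(lambda in D) \int[leb]_p (layer_limit (lambda, p))%:E)%E.
  move: lim2; under eq_fun do rewrite boxE; move=> lim2.
  exact: (cvg_unique (@ereal_hausdorff R) lim1 lim2).
have L0 z : (0 <= (cone_weight a z * pair_average mu z)%:E)%E.
  by rewrite lee_fin cone_average_ge0.
have mL : measurable_fun setT (fun z : RR => (layer_limit z)%:E).
  exact/measurable_EFinP/measurable_funM.
have LL0 z : (0 <= (layer_limit z)%:E)%E.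
  by rewrite lee_fin mulr_ge0 ?cone_average_ge0// ltW// frequency_constant_gt0.
have := fubini_tonelli1 (m1 := leb) (m2 := leb) (fun z => (layer_limit z)%:E) mL LL0.
have mF := measurable_fun_fubini_tonelli_F (m2 := leb) _ mL LL0.
rewrite DE integral_setD1 -?DE//; last exact: (measurable_funS measurableT _ mF).
move=> <-; rewrite -ge0_integralZl//.
  by apply/measurable_EFinP; exact: measurable_cone_average.
by rewrite lee_fin ltW// frequency_constant_gt0.
Qed.

End frequency_side.

(** * The energy of a measure *)

(** The infinite value at a zero base is the value of the gauge kernel on
    the diagonal. *)
Lemma cvg_EFin_powRN (R : realType) (a : R) (X : nat -> R) (X0 : R) :
  0 < a -> (forall k, 0 < X k) -> X @ \oo --> X0 ->
  ((X k `^ (- a))%:E @[k --> \oo] -->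
    if X0 == 0%R then +oo else (X0 `^ (- a))%:E)%E.
Proof.
move=> a0 Xk0 cX; have X00 : 0 <= X0.
  by apply: cvgr_to_ge cX _; apply: nearW => k; exact: ltW.
have [X0E|X0n] := eqVneq X0 0.
  rewrite X0E in cX; apply/cvgeryP.
  under eq_fun do rewrite powRN.
  apply/(@cvgrVy _ _ _ _ (fun k => X k `^ a)); first by apply: nearW => k; rewrite powR_gt0.
  by move/cvg_at_rightP : (@powR_cvg0 R a a0); apply; split.
apply: cvg_EFin; first exact: nearW.
have X0_gt0 : 0 < X0 by rewrite lt_neqAle eq_sym X0n.
have h := cvg_comp X (fun x : R => x `^ (- a)) cX (@continuous_powR_gt0 R (- a) X0 X0_gt0).
exact: h.
Qed.

Section energy.
Context (R : realType) (n : nat).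
Notation leb := (@lebesgue_measure R).
Notation RR := (measurableTypeR R * measurableTypeR R)%type.
Notation HH := (heis R n * heis R n)%type.
Variables (mu : {finite_measure set (heis R n) -> \bar R}) (a : R).
Hypothesis a_gt0 : 0 < a.

(** For [e = 0] this is the fourth power of the gauge of [q^-1 p], divided
    by 64. *)
Definition gauge_quotient (e : R) (w : HH) : R :=
  ((hdist2 w.1 w.2 / 4 + e) ^+ 2 + vertical w.1 w.2 ^+ 2) / 4.

Definition gauge_value (e : R) (w : HH) : R :=
  2^-1 * (Gamma a ^+ 2 * gauge_quotient e w `^ (- a)).

Let cone_eq0 (z : RR) : z.2 <= 0 -> cone_weight a z = 0.
Proof. by move=> z0; rewrite /cone_weight /pospow ltNge z0 mul0r. Qed.

Let cone_ge0 (z : RR) : 0 <= cone_weight a z.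
Proof. by rewrite mulr_ge0 ?pospow_ge0 ?powR_ge0. Qed.

Let damping (e : R) (z : RR) : R := expR (- (z.2 + `|z.1|) * e).

Let measurable_damping e : measurable_fun setT (damping e).
Proof.
apply: measurable_expRT; apply: measurable_funM => //; apply: measurable_funN.
apply: measurable_funD; first exact: measurable_snd.
by apply: (measurableT_comp (f := fun c : R => `|c|)) => //; exact: measurable_fst.
Qed.

(** The exponential damping makes the double integral over frequencies and pairs
    of points absolutely convergent, so that the frequencies can be integrated
    first. *)
Lemma damped_average (e : R) : 0 < e -> exists v : R,
  has_integral (leb \x leb)%E
    (fun z => damping e z * (cone_weight a z * pair_average mu z)) v /\
  has_integral (mu \x mu)%E (gauge_value e) v.
Proof.
move=> e0.
pose f (zw : RR * HH) := damping e zw.1 * (cone_weight a zw.1 * displacement_wave zw.1 zw.2).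
pose g (zw : RR * HH) := damping e zw.1 * cone_weight a zw.1 * 1.
have mW := @measurable_cone_weight R a.
have h1 := has_integral_cst_prod mu 1.
have [] := @has_integral_prod _ _ RR HH R (sigma_finite_product leb leb)
  (sigma_finite_product mu mu) f g
  (fun z => damping e z * (cone_weight a z * pair_average mu z))
  (fun z => damping e z * cone_weight a z * \int[(mu \x mu)%E]_w 1)
  (2^-1 * (Gamma a ^+ 2 * ((e ^+ 2 + 0 ^+ 2) / 4) `^ (- a)) * \int[(mu \x mu)%E]_w 1).
- apply: measurable_funM; first exact: (measurableT_comp (measurable_damping e) (@measurable_fst _ _ RR HH)).
  apply: measurable_funM; last exact: measurable_displacement_wave.
  exact: (measurableT_comp mW (@measurable_fst _ _ RR HH)).
- apply: measurable_funM => //; apply: measurable_funM.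
    exact: (measurableT_comp (measurable_damping e) (@measurable_fst _ _ RR HH)).
  exact: (measurableT_comp mW (@measurable_fst _ _ RR HH)).
- move=> [z w]; rewrite /f /g/= -mulrA normrM ger0_norm ?expR_ge0// ler_wpM2l ?expR_ge0//.
  rewrite normrM (ger0_norm (cone_ge0 z)).
  have [z0|/cone_eq0 ->] := ltP 0 z.2; last by rewrite !mul0r.
  rewrite ler_wpM2l// displacement_wave_le1// ltW//.
- by move=> z; exact: (has_integralZ (damping e z * cone_weight a z) h1).
- have h0 := has_integral_cone 0 a_gt0 e0.
  apply: has_integral_eq (has_integralZ (\int[(mu \x mu)%E]_w 1) h0) => [z|]; last by rewrite mulrC.
  by rewrite /damping mulr0 cos0 mulr1 mulrC; congr (_ * _); rewrite mulrC.
- move=> z; have hw : has_integral (mu \x mu)%E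
      (fun w => cone_weight a z * displacement_wave z w) (cone_weight a z * pair_average mu z).
    have [z0|/cone_eq0 ->] := ltP 0 z.2.
      exact: (has_integralZ _ (has_integral_pair_average mu (ltW z0))).
    rewrite mul0r; apply: has_integral_eq (has_integral0 _) => // w.
    by rewrite mul0r.
  exact: (has_integralZ (damping e z) hw).
move=> hf hF; exists (\int[sigma_finite_product leb leb]_z
  (damping e z * (cone_weight a z * pair_average mu z))); split => //.
apply: (has_integral_swap hf) => w.
have A0 : 0 < hdist2 w.1 w.2 / 4 + e by rewrite ltr_wpDl// divr_ge0 ?hdist2_ge0.
apply: has_integral_eq (has_integral_cone (vertical w.1 w.2) a_gt0 A0) => // z.
rewrite /f /damping /displacement_wave/= [RHS]mulrCA; congr (_ * _).
by rewrite mulrA -expRD; congr (expR _ * _); ring.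
Qed.

Let eps (k : nat) : R := k.+1%:R^-1.
Let eps_gt0 k : 0 < eps k. Proof. by rewrite invr_gt0 ltr0n. Qed.
Let eps_le k : eps k.+1 <= eps k.
Proof. by rewrite lef_pV2 ?posrE ?ltr0n// ler_nat. Qed.
Let cvg_eps : eps @ \oo --> (0 : R).
Proof. exact: cvg_harmonic. Qed.

(** As the damping decreases, both sides of [damped_average] increase to
    their undamped values, finite or not. *)
Let cvg_damped :
  (\int[leb \x leb]_z (damping (eps k) z * (cone_weight a z * pair_average mu z))%:E
     @[k --> \oo] -->
   \int[leb \x leb]_z (cone_weight a z * pair_average mu z)%:E)%E.
Proof.
have mW : measurable_fun setT (fun z : RR => cone_weight a z * pair_average mu z).
  by apply: measurable_funM; [exact: measurable_cone_weight|exact: measurable_pair_average].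
apply: (@ge0_cvg_integral _ _ _ (leb \x leb)%E) => //.
- by move=> k; apply/measurable_EFinP; apply: measurable_funM.
- by move=> k z _; rewrite lee_fin mulr_ge0 ?expR_ge0 ?cone_average_ge0.
- move=> k z _; rewrite lee_fin; have [z0|/cone_eq0 ->] := ltP 0 z.2; last by rewrite !mul0r !mulr0.
  rewrite ler_wpM2r ?cone_average_ge0// ler_expR !mulNr lerN2 ler_wpM2l//.
  by rewrite addr_ge0// ltW.
- move=> z _; apply: cvg_EFin; first exact: nearW.
  have c0 : - (z.2 + `|z.1|) * eps k @[k --> \oo] --> (0 : R).
    rewrite -(mulr0 (- (z.2 + `|z.1|))).
    by apply: cvgM; [exact: cvg_cst|exact: cvg_eps].
  have := cvg_comp _ expR c0 (@continuous_expR R 0); rewrite expR0 => c1.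
  have := @cvgM R _ _ _ _ (fun=> cone_weight a z * pair_average mu z) _ _ c1 (cvg_cst _).
  by rewrite mul1r; apply.
Qed.

Let gauge_limit (w : HH) : \bar R :=
  if gauge_quotient 0 w == 0 then +oo%E
  else (2^-1 * (Gamma a ^+ 2 * gauge_quotient 0 w `^ (- a)))%:E.

Let gauge_quotient_gt0 e w : 0 < e -> 0 < gauge_quotient e w.
Proof.
move=> e0; rewrite divr_gt0// ltr_wpDr ?sqr_ge0// exprn_gt0// ltr_wpDl//.
by rewrite divr_ge0 ?hdist2_ge0.
Qed.

Let measurable_gauge_value e : measurable_fun setT (gauge_value e).
Proof.
apply: measurable_funM => //; apply: measurable_funM => //.
apply: (measurableT_comp (f := fun c : R => c `^ (- a))); first exact: measurable_powR.
apply: measurable_funM => //; apply: measurable_funD; apply: measurable_funX.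
  by apply: measurable_funD => //; apply: measurable_funM => //; exact: measurable_hdist2.
exact: measurable_vertical.
Qed.

Let cvg_gauge_value w : ((gauge_value (eps k) w)%:E @[k --> \oo] --> gauge_limit w)%E.
Proof.
have c0 : 0 < 2^-1 * Gamma a ^+ 2 by rewrite mulr_gt0 ?exprn_gt0 ?Gamma_gt0 ?invr_gt0.
have cE : hdist2 w.1 w.2 / 4 + eps k @[k --> \oo] --> (hdist2 w.1 w.2 / 4 + 0 : R).
  by apply: (@cvgD _ R^o); [exact: cvg_cst|exact: cvg_eps].
have cX : gauge_quotient (eps k) w @[k --> \oo] --> (gauge_quotient 0 w : R).
  apply: cvgM; last exact: cvg_cst.
  by apply: (@cvgD _ R^o); [exact: (cvgM cE cE)|exact: cvg_cst].
have := cvg_EFin_powRN a_gt0 (fun k => gauge_quotient_gt0 w (eps_gt0 k)) cX.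
move=> /(@cvgeZl _ _ _ _ _ (2^-1 * Gamma a ^+ 2)%:E erefl).
rewrite (_ : (_ * _)%E = gauge_limit w); last first.
  rewrite /gauge_limit; case: ifPn => q0; last first.
    by rewrite -EFinM -[in LHS]mulrA.
  by rewrite gt0_muley ?lte_fin.
by apply: cvg_trans; apply: near_eq_cvg; apply: nearW => k; rewrite -EFinM -mulrA.
Qed.

Let cvg_gauge : (\int[(mu \x mu)%E]_w (gauge_value (eps k) w)%:E @[k --> \oo] -->
   \int[(mu \x mu)%E]_w gauge_limit w)%E.
Proof.
have c0 : 0 <= 2^-1 * Gamma a ^+ 2 by rewrite mulr_ge0 ?sqr_ge0 ?invr_ge0.
apply: (@ge0_cvg_integral _ _ _ (mu \x mu)%E) => //.
- by move=> k; apply/measurable_EFinP.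
- by move=> k w _; rewrite lee_fin /gauge_value !mulr_ge0 ?(ltW (Gamma_gt0 a_gt0)) ?powR_ge0 ?invr_ge0.
- move=> k w _; rewrite lee_fin /gauge_value ler_wpM2l ?invr_ge0// ler_wpM2l ?sqr_ge0// !powRN.
  have q e : 0 < e -> 0 < gauge_quotient e w by exact: gauge_quotient_gt0.
  rewrite lef_pV2 ?posrE ?powR_gt0 ?q//.
  apply: ge0_ler_powR; rewrite ?nnegrE ?(ltW a_gt0)// ?(ltW (q _ _))//.
  rewrite ler_wpM2r// lerD2r ler_sqr ?nnegrE ?addr_ge0 ?(ltW (eps_gt0 _)) ?divr_ge0 ?hdist2_ge0//.
  by rewrite lerD2l.
Qed.

Let gauge_average : (\int[leb \x leb]_z (cone_weight a z * pair_average mu z)%:E =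
  \int[(mu \x mu)%E]_w gauge_limit w)%E.
Proof.
apply: (cvg_unique (@ereal_hausdorff R) cvg_damped).
rewrite (_ : (fun k => _) = fun k => \int[(mu \x mu)%E]_w (gauge_value (eps k) w)%:E)%E.
  exact: cvg_gauge.
by apply/funext => k; have [v [h1 h2]] := damped_average (eps_gt0 k); rewrite h1.2 h2.2.
Qed.

Definition gauge_constant : R := 2^-1 * Gamma a ^+ 2 * 64 `^ a.

Lemma gauge_constant_gt0 : 0 < gauge_constant.
Proof. by rewrite mulr_gt0 ?powR_gt0// mulr_gt0 ?exprn_gt0 ?Gamma_gt0 ?invr_gt0. Qed.

Let gauge_limitE (w : HH) : gauge_limit w =
  (gauge_constant%:E * koranyi_kernel (4 * a) (heis_mul (heis_inv w.2) w.1))%E.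
Proof.
have k0 := gauge_constant_gt0.
rewrite /koranyi_kernel; set h := heis_mul _ _.
have -> : koranyi h = (64 * gauge_quotient 0 w) `^ 4^-1.
  rewrite /koranyi /gauge_quotient /hdist2 /vertical -/h.
  by case: h => -[x y] t /=; congr (_ `^ _); field.
rewrite powR_eq0 mulf_eq0 pnatr_eq0/= invr_eq0 pnatr_eq0 andbT.
rewrite /gauge_limit; case: ifPn => q0; first by rewrite gt0_muley ?lte_fin.
rewrite -EFinM; congr EFin.
have q1 : 0 <= gauge_quotient 0 w by rewrite divr_ge0// addr_ge0 ?sqr_ge0.
rewrite -powRrM (_ : 4^-1 * - (4 * a) = - a); last by field.
have E : (64 : R) `^ a * 64 `^ (- a) = 1 by rewrite powRN mulfV// gt_eqF// powR_gt0.
rewrite powRM// /gauge_constant; move: (64 `^ a) (64 `^ - a) E => s t E.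
by rewrite [RHS](_ : _ = 2^-1 * (Gamma a ^+ 2 * gauge_quotient 0 w `^ (- a)) * (s * t));
  [rewrite E mulr1|ring].
Qed.

Lemma energy_average :
  (\int[leb \x leb]_z (cone_weight a z * pair_average mu z)%:E =
   gauge_constant%:E * energy (4 * a) mu)%E.
Proof.
have k0 := gauge_constant_gt0.
rewrite gauge_average.
pose ker (w : HH) := koranyi_kernel (4 * a) (heis_mul (heis_inv w.2) w.1).
have mlim : measurable_fun setT gauge_limit.
  apply: (emeasurable_fun_cvg (fun k w => (gauge_value (eps k) w)%:E)) => [k|w _].
    exact/measurable_EFinP.
  exact: cvg_gauge_value.
have kerE w : ker w = ((gauge_constant^-1)%:E * gauge_limit w)%E.
  by rewrite gauge_limitE muleA -EFinM mulVf ?mul1e// gt_eqF.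
have mker : measurable_fun setT ker.
  rewrite (_ : ker = fun w => (gauge_constant^-1)%:E * gauge_limit w)%E; last exact/funext.
  exact: measurable_funeM.
have ker0 w : (0 <= ker w)%E.
  by rewrite /ker /koranyi_kernel; case: ifP => // _; rewrite lee_fin powR_ge0.
rewrite (eq_integral (fun w => gauge_constant%:E * ker w)%E); last first.
  by move=> w _; exact: gauge_limitE.
rewrite ge0_integralZl//; last by rewrite lee_fin ltW.
by rewrite (fubini_tonelli1 ker).
Qed.

End energy.

Theorem proposition1p5 (R : realType) (n : nat) (n_gt0 : (0 < n)%N)
    (sigma : R) (sigma_range : 0 < sigma < hdim R n) :
  exists d : R, forall mu : {finite_measure set (heis R n) -> \bar R},
    radon mu -> compact (measure_support mu) ->
    energy sigma mu =
    (d%:E * freq_integral (fun (alpha beta : multi_index n) (lambda : R) =>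
       (riesz_symbol (hdim R n - sigma) alpha lambda *
        cmod (fourier mu alpha beta lambda) ^+ 2)%:E))%E.
Proof.
have /andP[sigma_gt0 _] := sigma_range.
have a_gt0 : 0 < sigma / 4 by rewrite divr_gt0.
have c_gt0 := frequency_constant_gt0 sigma_range.
have k_gt0 := gauge_constant_gt0 a_gt0.
exists (frequency_constant n sigma * gauge_constant (sigma / 4))^-1 => mu _ _.
rewrite freq_integral_average// energy_average//.
rewrite (_ : 4 * (sigma / 4) = sigma); last by field.
by rewrite !muleA -!EFinM -mulrA mulVf ?mul1e// mulf_neq0 ?gt_eqF.
Qed.
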